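(* Let $\mathcal Q\subset\mathbb C[Z_{i,j}]$ be a left ideal generated by noncommutative homogeneous polynomials and let $M_{\mathcal A(\mathcal V^{\mathbf m}_{\mathbf f,\mathcal Q})}$ be the set of all characters of $\mathcal A(\mathcal V^{\mathbf m}_{\mathbf f,\mathcal Q})$. Then the map $$\Psi:\mathcal V^{\mathbf m}_{\mathbf f,\mathcal Q}(\mathbb C)\to M_{\mathcal A(\mathcal V^{\mathbf m}_{\mathbf f,\mathcal Q})},\qquad\Psi(\lambda)=\Phi_\lambda,$$ is a homeomorphism of $\mathcal V^{\mathbf m}_{\mathbf f,\mathcal Q}(\mathbb C)$ onto $M_{\mathcal A(\mathcal V^{\mathbf m}_{\mathbf f,\mathcal Q})}$.
   Context: Fix $k\ge 1$ and $(n_1,\dots,n_k)$, $\mathbf m=(m_1,\dots,m_k)$ in $\mathbb N^k$, $\mathbb N=\{1,2,\dots\}$. $\mathbb F^+_{n_i}$ is the free unital semigroup on generators $g^i_1,\dots,g^i_{n_i}$ with identity $g^i_0$; $|\alpha|$ is word length. For a tuple $X_i=(X_{i,1},\dots,X_{i,n_i})$ (operators or scalars) and $\alpha=g^i_{j_1}\cdots g^i_{j_p}$ put $X_{i,\alpha}=X_{i,j_1}\cdots X_{i,j_p}$, $X_{i,g^i_0}=I$. $\mathbb C[Z_{i,j}]$ is the algebra of polynomials in indeterminates $Z_{i,j}$ ($1\le i\le k$, $1\le j\le n_i$), where $Z_{i,1},\dots,Z_{i,n_i}$ are noncommuting and $Z_{s,j},Z_{t,l}$ commute for $s\ne t$.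 $\mathbf f=(f_1,\dots,f_k)$, where each $f_i=\sum_{\alpha\in\mathbb F^+_{n_i}}a_{i,\alpha}Z_{i,\alpha}$ is a positive regular free holomorphic function: $a_{i,\alpha}\ge0$, $a_{i,g^i_0}=0$, $a_{i,g^i_j}>0$ for $1\le j\le n_i$, and $\limsup_{p\to\infty}(\sum_{|\alpha|=p}|a_{i,\alpha}|^2)^{1/2p}<\infty$. For $z=(z_1,\dots,z_k)\in\mathbb C^{n_1}\times\cdots\times\mathbb C^{n_k}$ put $\Phi_{f_i,z_i}(1)=\sum_{|\alpha|\ge1}a_{i,\alpha}|z_{i,\alpha}|^2$; $\mathbf D^{\mathbf m}_{\mathbf f}(\mathbb C)$ is the set of $z$ with $\prod_i(1-\Phi_{f_i,z_i}(1))^{p_i}\ge0$ for all $\mathbf 0\le\mathbf p\le\mathbf m$ (i.e. $\Phi_{f_i,z_i}(1)\le1$ for each $i$), and $\mathcal V^{\mathbf m}_{\mathbf f,\mathcal Q}(\mathbb C)=\{z\in\mathbf D^{\mathbf m}_{\mathbf f}(\mathbb C): g(z)=0\text{ for all }g\in\mathcal Q\}$, with the Euclidean topology. $F^2(H_{n_i})=\mathbb C1\oplus\bigoplus_{p\ge1}H_{n_i}^{\otimes p}$ is the full Fock space over an $n_i$-dimensional Hilbert space, with orthonormal basis $\{e^i_\alpha\}_{\alpha\in\mathbb F^+_{n_i}}$, $e^i_{g^i_0}=1$. Set $b^{(m_i)}_{i,g^i_0}=1$ and $b^{(m_i)}_{i,\alpha}=\sum_{p=1}^{|\alpha|}\sum_{\gamma_1\cdots\gamma_p=\alpha,\,|\gamma_s|\ge1}a_{i,\gamma_1}\cdots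 a_{i,\gamma_p}\binom{p+m_i-1}{m_i-1}$ for $|\alpha|\ge1$; $W_{i,j}e^i_\alpha=\sqrt{b^{(m_i)}_{i,\alpha}/b^{(m_i)}_{i,g^i_j\alpha}}\;e^i_{g^i_j\alpha}$; $\mathbf W_{i,j}=I\otimes\cdots\otimes W_{i,j}\otimes\cdots\otimes I$ ($i$-th factor) on $\otimes_{i=1}^kF^2(H_{n_i})$. $\mathcal M_{\mathcal Q}$ is the closed linear span of the ranges of $g(\mathbf W)$, $g\in\mathcal Q$; $\mathcal N_{\mathcal Q}=[\otimes_iF^2(H_{n_i})]\ominus\mathcal M_{\mathcal Q}$, always assumed $\ne\{0\}$; $\mathbf S_{i,j}=P_{\mathcal N_{\mathcal Q}}\mathbf W_{i,j}|_{\mathcal N_{\mathcal Q}}$. The variety algebra $\mathcal A(\mathcal V^{\mathbf m}_{\mathbf f,\mathcal Q})$ is the norm-closed algebra generated by all $\mathbf S_{i,j}$ and the identity. Characters are nonzero multiplicative linear functionals, with the weak-$*$ topology. For $\lambda\in\mathcal V^{\mathbf m}_{\mathbf f,\mathcal Q}(\mathbb C)$, $\Phi_\lambda$ is the evaluation character of $\mathcal A(\mathcal V^{\mathbf m}_{\mathbf f,\mathcal Q})$ determined by $\Phi_\lambda(p(\mathbf S_{i,j}))=p(\lambda_{i,j})$ for all polynomials $p$ (it is well defined). *)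

(* Defs.v *)
From HB Require Import structures.
From mathcomp Require Import all_boot all_order all_algebra.
From mathcomp Require Import finmap.
From mathcomp Require Import all_classical all_reals all_analysis.
From mathcomp Require Import complex ring lra.
From mathcomp.multinomials Require monalg.
(* The notations of monalg clash with those of mathcomp-analysis. *)
Import -(notations) monalg.

Set Implicit Arguments.
Unset Strict Implicit.
Unset Printing Implicit Defensive.
Import Order.TTheory GRing.Theory Num.Theory.
Import numFieldNormedType.Exports.
Local Open Scope classical_set_scope.
Local Open Scope ring_scope.
Local Open Scope complex_scope.

(* R[i] with the topology of its modulus; mathcomp-analysis only provides this
   instance for R[i]^o. *)
HB.instance Definition _ (R : realType) := NormedModule.copy R[i] R[i]^o.

Section Unordered_sums.
Context {R : realType} {I : choiceType}.

Definition rsum (f : I -> R) : R :=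
  fine (\esum_(i in [set: I]) (Num.max (f i) 0)%:E) -
  fine (\esum_(i in [set: I]) (Num.max (- f i) 0)%:E).

(* The sum of an absolutely summable complex family. *)
Definition csum (f : I -> R[i]) : R[i] :=
  rsum (fun i => complex.Re (f i)) +i* rsum (fun i => complex.Im (f i)).

Definition abs_summable (f : I -> R) : Prop :=
  (\esum_(i in [set: I]) `|f i|%:E < +oo)%E.

Lemma esum_fin (f : I -> R) : (forall i, 0 <= f i) -> abs_summable f ->
  (\esum_(i in [set: I]) (f i)%:E)%E \is a fin_num.
Proof.
move=> f0 sf; rewrite ge0_fin_numE; last first.
  by apply: esum_ge0 => i _; rewrite lee_fin.
apply: le_lt_trans sf; apply: le_esum => i _.
by rewrite lee_fin ger0_norm.
Qed.

Lemma abs_summable_le (f g : I -> R) : (forall i, `|f i| <= g i) ->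
  abs_summable g -> abs_summable f.
Proof.
move=> fg; apply: le_lt_trans; apply: le_esum => i _.
by rewrite lee_fin (le_trans (fg i))// ler_norm.
Qed.

Lemma abs_summableD (f g : I -> R) : abs_summable f -> abs_summable g ->
  abs_summable (fun i => f i + g i).
Proof.
move=> sf sg; apply: le_lt_trans (lte_add_pinfty sf sg).
rewrite -esumD; [|by move=> *; rewrite lee_fin..].
by apply: le_esum => i _; rewrite -EFinD lee_fin ler_normD.
Qed.

Lemma ge0_esumZl (c : R) (f : I -> R) : 0 <= c -> (forall i, 0 <= f i) ->
  (\esum_(i in [set: I]) (c * f i)%:E = c%:E * \esum_(i in [set: I]) (f i)%:E)%E.
Proof.
have le (d : R) (g : I -> R) : 0 <= d -> (forall i, 0 <= g i) ->
    (\esum_(i in [set: I]) (d * g i)%:E <= d%:E * \esum_(i in [set: I]) (g i)%:E)%E.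
  move=> d0 g0; apply: ub_ereal_sup => _ [A fA <-].
  have -> : (\sum_(x \in A) (d * g x)%:E = d%:E * \sum_(x \in A) (g x)%:E)%E.
    by rewrite ge0_mule_fsumr// => x; rewrite lee_fin.
  apply: lee_wpmul2l; first by rewrite lee_fin.
  by apply: ereal_sup_ubound; exists A.
move=> c0 f0; apply/eqP; rewrite eq_le le//=.
have [->|cn0] := eqVneq c 0.
  rewrite mul0e; apply: esum_ge0 => i _.
  by rewrite mul0r.
have {cn0 c0}c0 : 0 < c by rewrite lt_def cn0.
rewrite -lee_pdivlMl//.
rewrite (_ : \esum_(i in _) (f i)%:E =
  \esum_(i in [set: I]) (c^-1 * (c * f i))%:E)%E; last first.
  by apply: eq_esum => i _; rewrite mulKf// gt_eqF.
by apply: le => [|i]; rewrite ?invr_ge0 ?mulr_ge0// ltW.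
Qed.

Lemma abs_summableZ (c : R) (f : I -> R) : abs_summable f ->
  abs_summable (fun i => c * f i).
Proof.
move=> sf; rewrite /abs_summable.
under eq_esum do rewrite normrM.
by rewrite ge0_esumZl// lte_mul_pinfty// lee_fin.
Qed.

Lemma rsum_diff (f g h : I -> R) :
  (forall i, 0 <= g i) -> (forall i, 0 <= h i) ->
  abs_summable g -> abs_summable h -> (forall i, f i = g i - h i) ->
  rsum f = fine (\esum_(i in [set: I]) (g i)%:E) -
           fine (\esum_(i in [set: I]) (h i)%:E).
Proof.
move=> g0 h0 sg sh fE.
pose p i := Num.max (f i) 0; pose q i := Num.max (- f i) 0.
have p0 i : 0 <= p i by rewrite le_max lexx orbT.
have q0 i : 0 <= q i by rewrite le_max lexx orbT.
have sp : abs_summable p.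
  apply: abs_summable_le sg => i; rewrite ger0_norm// ge_max g0 andbT fE.
  by rewrite gerBl.
have sq : abs_summable q.
  apply: abs_summable_le sh => i; rewrite ger0_norm// ge_max h0 andbT fE opprB.
  by rewrite gerBl.
have E : (\esum_(i in [set: I]) (p i)%:E + \esum_(i in [set: I]) (h i)%:E =
    \esum_(i in [set: I]) (q i)%:E + \esum_(i in [set: I]) (g i)%:E)%E.
  rewrite -!esumD; try by move=> *; rewrite lee_fin.
  apply: eq_esum => i _; rewrite -!EFinD; congr (_%:E).
  rewrite /p /q fE; case: (lerP (g i - h i) 0) => gh.
    by rewrite add0r max_l ?oppr_ge0// opprB subrK.
  by rewrite max_r ?oppr_le0 1?ltW// subrK add0r.
rewrite /rsum -/p -/q.
move/(congr1 fine): E; rewrite !fineD ?esum_fin// => E.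
by apply/eqP; rewrite subr_eq addrAC eq_sym subr_eq E addrC.
Qed.

Lemma pospart_ge0 (x : R) : 0 <= Num.max x 0.
Proof. by rewrite le_max lexx orbT. Qed.

Lemma abs_summable_pos f : abs_summable f ->
  abs_summable (fun i => Num.max (f i) 0).
Proof.
move=> sf; apply: (@abs_summable_le _ (fun i => `|f i|)).
  by move=> i; rewrite ger0_norm ?pospart_ge0// ge_max normr_ge0 ler_norm.
by apply: le_lt_trans sf; apply: le_esum => i _; rewrite normr_id.
Qed.

Lemma abs_summable_neg f : abs_summable f ->
  abs_summable (fun i => Num.max (- f i) 0).
Proof.
move=> sf; apply: (abs_summable_pos (f := fun i => - f i)).
by apply: le_lt_trans sf; apply: le_esum => i _; rewrite normrN.
Qed.

Lemma pos_sub_neg (x : R) : x = Num.max x 0 - Num.max (- x) 0.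
Proof.
case: (lerP x 0) => x0; first by rewrite max_l ?oppr_ge0// opprK add0r.
by rewrite max_r ?subr0// oppr_le0 ltW.
Qed.

Lemma rsumD f g : abs_summable f -> abs_summable g ->
  rsum (fun i => f i + g i) = rsum f + rsum g.
Proof.
move=> sf sg.
have [fp fn] := (abs_summable_pos sf, abs_summable_neg sf).
have [gp gn] := (abs_summable_pos sg, abs_summable_neg sg).
rewrite (@rsum_diff _ (fun i => Num.max (f i) 0 + Num.max (g i) 0)
  (fun i => Num.max (- f i) 0 + Num.max (- g i) 0)); last first.
- by move=> i; rewrite {1}(pos_sub_neg (f i)) {1}(pos_sub_neg (g i)) addrACA opprD.
- exact: abs_summableD.
- exact: abs_summableD.
- by move=> i; rewrite addr_ge0// pospart_ge0.
- by move=> i; rewrite addr_ge0// pospart_ge0.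
under eq_esum do rewrite EFinD.
under [X in _ - fine X]eq_esum do rewrite EFinD.
rewrite !esumD; try by move=> *; rewrite lee_fin pospart_ge0.
rewrite !fineD ?esum_fin//; try by move=> *; rewrite pospart_ge0.
by rewrite opprD addrACA.
Qed.

Lemma rsumN f : rsum (fun i => - f i) = - rsum f.
Proof.
rewrite /rsum opprB; congr (_ - fine _).
by apply: eq_esum => i _; rewrite opprK.
Qed.

Lemma rsumZ c f : abs_summable f -> rsum (fun i => c * f i) = c * rsum f.
Proof.
wlog c0 : c / 0 <= c => [H|] sf.
  have [/H->//|/ltW c0] := leP 0 c.
  rewrite (_ : (fun i => _) = (fun i => - (- c * f i))); last first.
    by apply/funext => i; rewrite mulNr opprK.
  by rewrite rsumN H ?oppr_ge0// mulNr opprK.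
have [fp fn] := (abs_summable_pos sf, abs_summable_neg sf).
rewrite (@rsum_diff _ (fun i => c * Num.max (f i) 0)
  (fun i => c * Num.max (- f i) 0)); last first.
- by move=> i; rewrite -mulrBr -pos_sub_neg.
- exact: abs_summableZ.
- exact: abs_summableZ.
- by move=> i; rewrite mulr_ge0// pospart_ge0.
- by move=> i; rewrite mulr_ge0// pospart_ge0.
rewrite !ge0_esumZl//; try by move=> *; rewrite pospart_ge0.
rewrite !fineM ?esum_fin//; try by move=> *; rewrite pospart_ge0.
by rewrite /rsum mulrBr.
Qed.

End Unordered_sums.

Section Square_summable.
Context {R : realType} {I : choiceType}.
Implicit Types (c : R[i]) (f g : I -> R[i]).

Definition sqmod (z : R[i]) : R := complex.Re z ^+ 2 + complex.Im z ^+ 2.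

Definition l2_pred : {pred I -> R[i]} :=
  fun f => `[< abs_summable (fun i => sqmod (f i)) >].

Lemma sqmod_ge0 z : 0 <= sqmod z.
Proof. by rewrite addr_ge0// sqr_ge0. Qed.

Lemma sqmodM z w : sqmod (z * w) = sqmod z * sqmod w.
Proof. by case: z w => [a b] [c d]; rewrite /sqmod/=; ring. Qed.

Lemma sqmodD_le z w : sqmod (z + w) <= 2 * sqmod z + 2 * sqmod w.
Proof.
case: z w => [a b] [c d]; rewrite /sqmod/= -subr_ge0.
rewrite [leRHS](_ : _ = (a - c) ^+ 2 + (b - d) ^+ 2); last by ring.
by rewrite addr_ge0// sqr_ge0.
Qed.

Lemma l2_predP f : reflect (abs_summable (fun i => sqmod (f i))) (f \in l2_pred).
Proof. exact: asboolP. Qed.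

Lemma l2_submod_closed : submod_closed l2_pred.
Proof.
split=> [|c f g /l2_predP sf /l2_predP sg]; apply/l2_predP.
  rewrite /abs_summable esum1// => i _.
  by rewrite /sqmod/= expr0n/= addr0 normr0.
apply: abs_summable_le (abs_summableD (abs_summableZ (2 * sqmod c) sf)
  (abs_summableZ 2 sg)) => i.
by rewrite ger0_norm ?sqmod_ge0// (le_trans (sqmodD_le _ _))// sqmodM mulrA.
Qed.

End Square_summable.

HB.instance Definition _ (R : realType) (I : choiceType) :=
  GRing.isSubmodClosed.Build R[i] (I -> R[i]) (@l2_pred R I)
    (@l2_submod_closed R I).

(* The Hilbert space l^2(I) over the complex numbers. *)
Record l2 (R : realType) (I : choiceType) := L2 {
  l2_fun :> I -> R[i];
  l2_funP : l2_fun \in l2_pred }.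

HB.instance Definition _ (R : realType) (I : choiceType) :=
  [isSub for @l2_fun R I].
HB.instance Definition _ (R : realType) (I : choiceType) :=
  [Choice of l2 R I by <:].
HB.instance Definition _ (R : realType) (I : choiceType) :=
  [SubChoice_isSubLmodule of l2 R I by <:].

Section L2_norm.
Context {R : realType} {I : choiceType}.
Implicit Types (c : R[i]) (x y z : l2 R I).

Definition l2_norm x : R :=
  Num.sqrt (fine (\esum_(i in [set: I]) (sqmod (x i))%:E)).

Definition l2_inner x y : R[i] := csum (fun i => x i * (y i)^*).

Lemma l2_summable x : abs_summable (fun i => sqmod (x i)).
Proof. exact/l2_predP/l2_funP. Qed.

Lemma l2_sqnorm_fin x : (\esum_(i in [set: I]) (sqmod (x i))%:E)%E \is a fin_num.
Proof. by apply: esum_fin (l2_summable x) => i; exact: sqmod_ge0. Qed.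

Lemma l2_norm_ge0 x : 0 <= l2_norm x.
Proof. exact: sqrtr_ge0. Qed.

Lemma l2_sqnorm x :
  (\esum_(i in [set: I]) (sqmod (x i))%:E = (l2_norm x ^+ 2)%:E)%E.
Proof.
rewrite /l2_norm sqr_sqrtr ?fineK ?l2_sqnorm_fin//.
by rewrite fine_ge0// esum_ge0// => i _; rewrite lee_fin sqmod_ge0.
Qed.

Lemma l2_norm_eq0 x : l2_norm x = 0 -> x = 0.
Proof.
move=> x0; have := l2_sqnorm x; rewrite x0 expr0n/= => E.
apply: val_inj; apply/funext => i /=.
have : ((sqmod (x i))%:E <= \esum_(i in [set: I]) (sqmod (x i))%:E)%E.
  apply: esum_ge; exists [set i]; first by split.
  by rewrite fsbig_set1.
rewrite E lee_fin => xi.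
have /eqP : sqmod (x i) == 0 by rewrite eq_le xi sqmod_ge0.
move/eqP; rewrite /sqmod paddr_eq0 ?sqr_ge0// !sqrf_eq0.
by case: (x i) => a b /= /andP[/eqP -> /eqP ->].
Qed.

Lemma l2_normZ c x : l2_norm (c *: x) = Num.sqrt (sqmod c) * l2_norm x.
Proof.
apply/eqP; rewrite -(@eqrXn2 _ 2)// ?mulr_ge0 ?sqrtr_ge0 ?l2_norm_ge0//.
rewrite exprMn (sqr_sqrtr (sqmod_ge0 c)); apply/eqP/EFin_inj.
rewrite [in RHS]EFinM -!l2_sqnorm.
rewrite -ge0_esumZl ?sqmod_ge0//; last by move=> i; exact: sqmod_ge0.
by apply: eq_esum => i _; rewrite -sqmodM.
Qed.

Lemma sqmodD_weighted (s t : R) (z w : R[i]) : 0 < s -> 0 < t ->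
  sqmod (z + w) <= (1 + t / s) * sqmod z + (1 + s / t) * sqmod w.
Proof.
move=> s0 t0; case: z w => [a b] [c d]; rewrite /sqmod/= -subr_ge0.
rewrite [leRHS](_ : _ = ((t * a - s * c) ^+ 2 + (t * b - s * d) ^+ 2) / (s * t)).
  by rewrite divr_ge0 ?addr_ge0 ?sqr_ge0// mulr_ge0// ltW.
by field; rewrite !gt_eqF.
Qed.

Lemma l2_normD x y : l2_norm (x + y) <= l2_norm x + l2_norm y.
Proof.
have [x0|x0] := eqVneq (l2_norm x) 0.
  by rewrite (l2_norm_eq0 x0) add0r lerDr l2_norm_ge0.
have [y0|y0] := eqVneq (l2_norm y) 0.
  by rewrite (l2_norm_eq0 y0) addr0 lerDl l2_norm_ge0.
set s := l2_norm x in x0 *; set t := l2_norm y in y0 *.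
have s0 : 0 < s by rewrite lt_def x0 l2_norm_ge0.
have t0 : 0 < t by rewrite lt_def y0 l2_norm_ge0.
rewrite -(@ler_pXn2r _ 2) ?nnegrE ?addr_ge0 ?l2_norm_ge0//.
rewrite -lee_fin -l2_sqnorm.
apply: (@le_trans _ _ (\esum_(i in [set: I])
    ((1 + t / s) * sqmod (x i) + (1 + s / t) * sqmod (y i))%:E)%E).
  by apply: le_esum => i _; rewrite lee_fin sqmodD_weighted.
under eq_esum do rewrite EFinD.
have st : 0 <= 1 + t / s by rewrite addr_ge0// divr_ge0// ltW.
have ts : 0 <= 1 + s / t by rewrite addr_ge0// divr_ge0// ltW.
rewrite esumD; try by move=> i _; rewrite lee_fin mulr_ge0// sqmod_ge0.
rewrite !ge0_esumZl//; try by move=> i; exact: sqmod_ge0.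
rewrite !l2_sqnorm -/s -/t -!EFinM -EFinD lee_fin le_eqVlt; apply/orP; left.
by apply/eqP; field; rewrite !gt_eqF.
Qed.

Lemma normc_sqmod c : `|c| = (Num.sqrt (sqmod c))%:C.
Proof. exact: normc_def. Qed.

Lemma l2_inner_summable x y :
  abs_summable (fun i => complex.Re (x i * (y i)^*)) /\
  abs_summable (fun i => complex.Im (x i * (y i)^*)).
Proof.
have [h1 h2] : (forall z w : R[i], `|complex.Re (z * w^*)| <= sqmod z + sqmod w) /\
    (forall z w : R[i], `|complex.Im (z * w^*)| <= sqmod z + sqmod w).
  split=> -[a b] [c d]; rewrite /sqmod/= ler_norml.
    have [] := (sqr_ge0 (a + c), sqr_ge0 (a - c)).
    have [] := (sqr_ge0 (b + d), sqr_ge0 (b - d)).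
    have [] := (sqr_ge0 a, sqr_ge0 b); have [] := (sqr_ge0 c, sqr_ge0 d).
    by move=> *; apply/andP; split; lra.
  have [] := (sqr_ge0 (a + d), sqr_ge0 (a - d)).
  have [] := (sqr_ge0 (b + c), sqr_ge0 (b - c)).
  have [] := (sqr_ge0 a, sqr_ge0 b); have [] := (sqr_ge0 c, sqr_ge0 d).
  by move=> *; apply/andP; split; lra.
by split; apply: abs_summable_le (abs_summableD (l2_summable x) (l2_summable y))
  => i.
Qed.

Lemma l2_inner_linear c x y z :
  l2_inner (c *: x + y) z = c * l2_inner x z + l2_inner y z.
Proof.
have [xr xi] := l2_inner_summable x z; have [yr yi] := l2_inner_summable y z.
rewrite /l2_inner /csum; case: c => a b; simpc.
have E i : (((a +i* b) *: x + y) i * (z i)^*) =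
   (a +i* b) * (x i * (z i)^*) + y i * (z i)^* :> R[i].
  by rewrite mulrA -mulrDl.
congr Complex.
  transitivity (rsum (fun i => (a * complex.Re (x i * (z i)^*) +
     - b * complex.Im (x i * (z i)^*)) + complex.Re (y i * (z i)^*))).
    congr rsum; apply/funext => i; rewrite E.
    by case: (x i * _) => u v; case: (y i * _) => u' v' /=; rewrite mulNr.
  rewrite !rsumD ?rsumZ//; first by rewrite mulNr.
  - exact: abs_summableZ.
  - exact: abs_summableZ.
  - by apply: abs_summableD => //; exact: abs_summableZ.
transitivity (rsum (fun i => (a * complex.Im (x i * (z i)^*) +
   b * complex.Re (x i * (z i)^*)) + complex.Im (y i * (z i)^*))).
  congr rsum; apply/funext => i; rewrite E.
  by case: (x i * _) => u v; case: (y i * _) => u' v' /=.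
rewrite !rsumD ?rsumZ//.
- exact: abs_summableZ.
- exact: abs_summableZ.
- by apply: abs_summableD => //; exact: abs_summableZ.
Qed.

End L2_norm.

Section L2_normedModType.
Context (R : realType) (I : choiceType).
Implicit Types x y : l2 R I.

Let norm x : R[i] := (l2_norm x)%:C.

Let normD x y : norm (x + y) <= norm x + norm y.
Proof. by rewrite /norm -rmorphD lecR l2_normD. Qed.

Let normZ (c : R[i]) x : norm (c *: x) = `|c| * norm x.
Proof. by rewrite /norm l2_normZ normc_sqmod rmorphM. Qed.

Let norm_eq0 x : norm x = 0 -> x = 0.
Proof. by move=> /complexI /l2_norm_eq0. Qed.

HB.instance Definition _ :=
  Lmodule_isNormed.Build R[i] (l2 R I) normD normZ norm_eq0.

End L2_normedModType.

Section Orthogonal_complement.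
Context {R : realType} {I : choiceType}.
Variable M : set (l2 R I).

Definition ocompl_pred : {pred l2 R I} :=
  fun x => `[< forall y, M y -> l2_inner x y = 0 >].

Lemma ocompl_predP x :
  reflect (forall y, M y -> l2_inner x y = 0) (x \in ocompl_pred).
Proof. exact: asboolP. Qed.

Lemma ocompl_submod_closed : submod_closed ocompl_pred.
Proof.
have lin c u v : u \in ocompl_pred -> v \in ocompl_pred ->
    c *: u + v \in ocompl_pred.
  move=> /ocompl_predP hu /ocompl_predP hv; apply/ocompl_predP => y My.
  by rewrite l2_inner_linear hu// hv// mulr0 addr0.
split=> //; apply/ocompl_predP => y My.
have := l2_inner_linear (-1) 0 0 y; rewrite scaler0 addr0 => ->.
by rewrite mulN1r addNr.
Qed.

HB.instance Definition _ :=
  GRing.isSubmodClosed.Build R[i] (l2 R I) ocompl_pred ocompl_submod_closed.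

(* The orthogonal complement of M, as a Hilbert space. *)
Record ocompl := OCompl {
  ocompl_val :> l2 R I;
  ocompl_valP : ocompl_val \in ocompl_pred }.

HB.instance Definition _ := [isSub for ocompl_val].
HB.instance Definition _ := [Choice of ocompl by <:].
HB.instance Definition _ := [SubChoice_isSubLmodule of ocompl by <:].

Let norm (x : ocompl) : R[i] := `|ocompl_val x|.

Let normD x y : norm (x + y) <= norm x + norm y.
Proof. exact: ler_normD. Qed.

Let normZ (c : R[i]) x : norm (c *: x) = `|c| * norm x.
Proof. exact: normrZ. Qed.

Let norm_eq0 x : norm x = 0 -> x = 0.
Proof. by move=> /normr0_eq0 ?; exact: val_inj. Qed.

HB.instance Definition _ :=
  Lmodule_isNormed.Build R[i] ocompl normD normZ norm_eq0.

(* The orthogonal projection onto the complement of M: the element y of the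
   complement such that u - y is orthogonal to it. By the projection theorem
   y exists, so the default 0 is never used. *)
Definition oproj (u : l2 R I) : ocompl :=
  xget 0 [set y : ocompl | forall w : ocompl, l2_inner (u - ocompl_val y) w = 0].

End Orthogonal_complement.

Section Bounded_operators.
Context {R : realType}.
Variable V : normedModType R[i].
Implicit Types (f : V -> V) (c : R[i]).

Definition bop_pred : {pred V -> V} :=
  fun f => `[< linear f /\ exists k : R, forall x, `|f x| <= k%:C * `|x| >].

Lemma bop_predP f :
  reflect (linear f /\ exists k : R, forall x, `|f x| <= k%:C * `|x|)
          (f \in bop_pred).
Proof. exact: asboolP. Qed.

Lemma bop_submod_closed : submod_closed bop_pred.
Proof.
split=> [|c f g /bop_predP[lf [k fk]] /bop_predP[lg [l gl]]]; apply/bop_predP.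
  split=> [a x y|]; first by rewrite /= scaler0 addr0.
  by exists 0 => x; rewrite normr0 mul0r.
split=> [a x y|].
  rewrite -[LHS]/(c *: f (a *: x + y) + g (a *: x + y)) lf lg.
  by rewrite !scalerDr !scalerA (mulrC c a) addrACA.
exists (Num.sqrt (sqmod c) * k + l) => x.
rewrite (le_trans (ler_normD _ _))// rmorphD mulrDl lerD//.
rewrite -[X in `|X|]/(c *: f x) normrZ rmorphM /= -normc_sqmod.
by rewrite -mulrA ler_wpM2l.
Qed.

HB.instance Definition _ :=
  GRing.isSubmodClosed.Build R[i] (V -> V) bop_pred bop_submod_closed.

(* The algebra B(V) of bounded linear operators, with composition as product
   and the operator norm. *)
Record bop := BOp {
  bop_fun :> V -> V;
  bop_funP : bop_fun \in bop_pred }.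

HB.instance Definition _ := [isSub for bop_fun].
HB.instance Definition _ := [Choice of bop by <:].
HB.instance Definition _ := [SubChoice_isSubLmodule of bop by <:].

Implicit Types S T U : bop.

Lemma bop_linear T : linear T.
Proof. by have /bop_predP[] := bop_funP T. Qed.

Lemma bop_bounded T : exists k : R, forall x, `|T x| <= k%:C * `|x|.
Proof. by have /bop_predP[] := bop_funP T. Qed.

Lemma bop_bounded_ge0 T :
  exists2 k : R, 0 <= k & forall x, `|T x| <= k%:C * `|x|.
Proof.
have [k Tk] := bop_bounded T; exists `|k| => // x.
by rewrite (le_trans (Tk x))// ler_wpM2r// lecR ler_norm.
Qed.

Lemma bop_one_subproof : (id : V -> V) \in bop_pred.
Proof.
by apply/bop_predP; split => [a x y //|]; exists 1 => x; rewrite mul1r.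
Qed.

Lemma bop_mul_subproof S T : (fun x => S (T x)) \in bop_pred.
Proof.
apply/bop_predP; split => [a x y|]; first by rewrite !bop_linear.
have [k k0 Sk] := bop_bounded_ge0 S; have [l Tl] := bop_bounded T.
exists (k * l) => x; rewrite (le_trans (Sk _))// rmorphM -mulrA.
by rewrite ler_wpM2l// ler0c.
Qed.

Definition bop_one : bop := BOp bop_one_subproof.
Definition bop_mul S T : bop := BOp (bop_mul_subproof S T).

Let bop_mulA : associative bop_mul.
Proof. by move=> S T U; exact: val_inj. Qed.
Let bop_mul1 : left_id bop_one bop_mul.
Proof. by move=> S; exact: val_inj. Qed.
Let bop_1mul : right_id bop_one bop_mul.
Proof. by move=> S; exact: val_inj. Qed.
Let bop_mulDl : left_distributive bop_mul +%R.
Proof. by move=> S T U; exact: val_inj. Qed.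
Let bop_mulDr : right_distributive bop_mul +%R.
Proof.
move=> S T U; apply: val_inj; apply/funext => x /=.
by have := bop_linear S 1 (T x) (U x); rewrite !scale1r.
Qed.

HB.instance Definition _ := GRing.Zmodule_isPzRing.Build bop
  bop_mulA bop_mul1 bop_1mul bop_mulDl bop_mulDr.

Definition opnorm T : R :=
  inf [set k : R | 0 <= k /\ forall x, `|T x| <= k%:C * `|x|].

Lemma norm_ReE (x : V) : `|x| = (complex.Re `|x|)%:C.
Proof. by rewrite RRe_real// ger0_real. Qed.

Lemma opnorm_ge0 T : 0 <= opnorm T.
Proof.
have [k k0 Tk] := bop_bounded_ge0 T.
by apply: lb_le_inf => [|l []//]; exists k.
Qed.

Lemma opnormP T x : `|T x| <= (opnorm T)%:C * `|x|.
Proof.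
have [k k0 Tk] := bop_bounded_ge0 T.
rewrite (norm_ReE x) (norm_ReE (T x)) -rmorphM lecR.
set t := complex.Re `|x|; set s := complex.Re _.
have t0 : 0 <= t by rewrite -ler0c -norm_ReE.
have st l : (forall x, `|T x| <= l%:C * `|x|) -> s <= l * t.
  by move=> /(_ x); rewrite norm_ReE (norm_ReE x) -rmorphM lecR.
have [tE|tn0] := eqVneq t 0.
  by have := st _ Tk; rewrite tE !mulr0.
have {tn0}t0 : 0 < t by rewrite lt_def tn0.
rewrite -ler_pdivrMr//; apply: lb_le_inf; first by exists k.
by move=> l [_ /st]; rewrite ler_pdivrMr.
Qed.

Lemma opnorm_le T k : 0 <= k -> (forall x, `|T x| <= k%:C * `|x|) ->
  opnorm T <= k.
Proof. by move=> k0 Tk; apply: ge_inf => //; exists 0 => l []. Qed.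

Let norm T : R[i] := (opnorm T)%:C.

Let normD S T : norm (S + T) <= norm S + norm T.
Proof.
rewrite -rmorphD lecR opnorm_le ?addr_ge0 ?opnorm_ge0// => x.
by rewrite rmorphD mulrDl (le_trans (ler_normD _ _))// lerD ?opnormP.
Qed.

Let normZ_le c T : norm (c *: T) <= `|c| * norm T.
Proof.
rewrite normc_sqmod -rmorphM lecR.
rewrite opnorm_le ?mulr_ge0 ?sqrtr_ge0 ?opnorm_ge0// => x.
rewrite -[X in `|X|]/(c *: T x) normrZ rmorphM /= -normc_sqmod.
by rewrite -mulrA ler_wpM2l// opnormP.
Qed.

Let norm_eq0 T : norm T = 0 -> T = 0.
Proof.
move=> /complexI T0; apply: val_inj; apply/funext => x /=.
apply: normr0_eq0; apply/eqP; rewrite eq_le normr_ge0 andbT.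
by have := opnormP T x; rewrite T0 mul0r.
Qed.

Let normZ c T : norm (c *: T) = `|c| * norm T.
Proof.
apply/eqP; rewrite eq_le normZ_le /=.
have [->|c0] := eqVneq c 0.
  by rewrite normr0 mul0r ler0c opnorm_ge0.
rewrite -ler_pdivlMl ?normr_gt0// -normfV.
by rewrite (le_trans _ (normZ_le _ _))// scalerA mulVf// scale1r.
Qed.

HB.instance Definition _ :=
  Lmodule_isNormed.Build R[i] bop normD normZ norm_eq0.

End Bounded_operators.

Section L2_basis.
Context {R : realType} {I : choiceType}.

Lemma l2_basis_subproof (i : I) :
  (fun j => (j == i)%:R : R[i]) \in l2_pred.
Proof.
apply/l2_predP.
apply: (@abs_summable_le _ _ _ (fun j => if j \in [set i] then 1 else 0)).
  move=> j; rewrite ger0_norm ?sqmod_ge0//; case: ifPn => ji.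
    by case: eqP => _; rewrite /sqmod/= ?expr0n ?expr1n/= ?addr0 ?ler01.
  rewrite (_ : j == i = false) ?/sqmod/= ?expr0n/= ?addr0//.
  by apply: contraNF ji => /eqP ->; rewrite inE.
rewrite /abs_summable (_ : esum _ _ = \esum_(j in [set i]) 1%:E)%E; last first.
  rewrite [RHS]esum_mkcond; apply: eq_esum => j _.
  by case: ifP => _; rewrite ?normr1 ?normr0.
by rewrite esum_set1 ?ltry// lee_fin.
Qed.

Definition l2_basis (i : I) : l2 R I := L2 (l2_basis_subproof i).

End L2_basis.

Section Multiwords.
Context {k : nat}.
Variable n : 'I_k -> nat.

(* Tuples (alpha_1, ..., alpha_k) of words, alpha_i being a word in the n_i
   letters g^i_j. They index the basis
   e_(alpha_1) (x) ... (x) e_(alpha_k) of the tensor product of the full Fock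
   spaces, and the monomials Z_(1,alpha_1) ... Z_(k,alpha_k). *)
Definition mword := {dffun forall i : 'I_k, seq 'I_(n i)}.

HB.instance Definition _ := Choice.on mword.

Implicit Types u v w : mword.

Definition mword_one : mword := finfun (fun i => [::] : seq 'I_(n i)).

Definition mword_mul u v : mword := finfun (fun i => u i ++ v i).

Definition mword_gen (i : 'I_k) (j : 'I_(n i)) : mword :=
  finfun (dfwith (fun i => [::] : seq 'I_(n i)) i [:: j]).

Definition mword_length w : nat := (\sum_(i < k) size (w i))%N.

Lemma mword_mulA : associative mword_mul.
Proof. by move=> u v w; apply/ffunP => i; rewrite !ffunE catA. Qed.

Lemma mword_mul1 : left_id mword_one mword_mul.
Proof. by move=> u; apply/ffunP => i; rewrite !ffunE. Qed.

Lemma mword_1mul : right_id mword_one mword_mul.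
Proof. by move=> u; apply/ffunP => i; rewrite !ffunE cats0. Qed.

Lemma mword_unit u v : mword_mul u v = mword_one ->
  u = mword_one /\ v = mword_one.
Proof.
move=> /ffunP uv; split; apply/ffunP => i; have := uv i; rewrite !ffunE;
  by case: (u i) => [|? ?] //=.
Qed.

HB.instance Definition _ := Choice_isMonomialDef.Build mword
  mword_mulA mword_mul1 mword_1mul mword_unit.

End Multiwords.

(* The algebra C[Z_(i,j)]: the monoid algebra of the product of the free
   monoids on n_1, ..., n_k letters. *)
Definition ncpoly (R : realType) (k : nat) (n : 'I_k -> nat) :=
  malg (mword n) R[i].

HB.instance Definition _ (R : realType) (k : nat) (n : 'I_k -> nat) :=
  GRing.Lalgebra.on (ncpoly R n).

Section Polynomials.
Context {R : realType} {k : nat} {n : 'I_k -> nat}.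
Implicit Types (p g : ncpoly R n).

Definition mword_prod (A : pzRingType) (X : forall i, 'I_(n i) -> A)
    (w : mword n) : A :=
  \prod_(i < k) \prod_(j <- w i) X i j.

Definition poly_op (V : normedModType R[i]) (X : forall i, 'I_(n i) -> bop V) p
    : bop V :=
  \sum_(w <- msupp p) mcoeff w p *: mword_prod X w.

Definition poly_eval (z : forall i, 'I_(n i) -> R[i]) p : R[i] :=
  \sum_(w <- msupp p) mcoeff w p * mword_prod z w.

(* Homogeneous for the total degree: all Z_(i,j) have degree 1. *)
Definition homogeneous p : Prop :=
  exists d : nat, forall w, w \in msupp p -> mword_length w = d.

Definition left_ideal (J : set (ncpoly R n)) : Prop :=
  [/\ J 0, forall p q, J p -> J q -> J (p + q) &
      forall p q, J q -> J (p * q)].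

Definition left_ideal_generated (G : set (ncpoly R n)) : set (ncpoly R n) :=
  smallest left_ideal G.

End Polynomials.

(* a alpha is the coefficient of Z_alpha in f = sum_alpha a_alpha Z_alpha. *)
Record positive_regular (R : realType) (n : nat) (a : seq 'I_n -> R) : Prop := {
  posreg_ge0 : forall alpha, 0 <= a alpha;
  posreg_nil : a [::] = 0;
  posreg_gen : forall j, 0 < a [:: j];
  posreg_limsup : (limn_esup (fun p : nat =>
    ((\sum_(alpha : p.-tuple 'I_n) `|a alpha| ^+ 2) `^ (2 * p)%:R^-1)%:E)
      < +oo)%E }.

(* The coefficient b^(m)_alpha; gamma runs over the factorizations of alpha
   into p nonempty words. *)
Definition bcoef (R : realType) (n : nat) (a : seq 'I_n -> R) (m : nat)
    (alpha : seq 'I_n) : R :=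
  if alpha is [::] then 1 else
  \sum_(1 <= p < (size alpha).+1)
    \sum_(gamma \in [set gamma : p.-tuple (seq 'I_n) |
                      flatten gamma = alpha /\ [::] \notin (gamma : seq _)])
      (\prod_(s <- gamma) a s) * 'C(p + m - 1, m - 1)%:R.

Definition subspace_set (R : realType) (V : lmodType R[i]) (M : set V) : Prop :=
  M 0 /\ forall (c : R[i]) x y, M x -> M y -> M (c *: x + y).

Definition closed_span (R : realType) (V : normedModType R[i]) (X : set V)
    : set V :=
  smallest (fun M => subspace_set M /\ closed M) X.

Definition subalgebra_set (R : realType) (V : normedModType R[i])
    (B : set (bop V)) : Prop :=
  subspace_set B /\ forall S T, B S -> B T -> B (S * T).

Definition closed_algebra_generated (R : realType) (V : normedModType R[i])
    (X : set (bop V)) : set (bop V) :=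
  smallest (fun B => subalgebra_set B /\ closed B) X.

Section Polydomains.
Context {R : realType} {k : nat} {n : 'I_k -> nat}.

(* C^(n_1) x ... x C^(n_k), with the product topology. *)
Definition Cspace : topologicalType :=
  prod_topology (fun i : 'I_k => 'rV[R[i]]_(n i)).

Definition entry (z : Cspace) (i : 'I_k) (j : 'I_(n i)) : R[i] := z i 0 j.

Variable a : forall i, seq 'I_(n i) -> R.
Variable m : 'I_k -> nat.
Variable Q : set (ncpoly R n).

Definition Phi_one (i : 'I_k) (z : Cspace) : \bar R :=
  (\esum_(alpha in [set alpha : seq 'I_(n i) | (1 <= size alpha)%N])
    (a alpha * sqmod (\prod_(j <- alpha) entry z j))%:E)%E.

Definition polydomain : set Cspace :=
  [set z | (forall i, Phi_one i z < +oo)%E /\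
    forall p : 'I_k -> nat, (forall i, (p i <= m i)%N) ->
      0 <= \prod_(i < k) (1 - fine (Phi_one i z)) ^+ p i].

Definition variety : set Cspace :=
  [set z | polydomain z /\ forall g, Q g -> poly_eval (entry z) g = 0].

Definition Fock : normedModType R[i] := l2 R (mword n).

(* The operator I (x) ... (x) W_(i,j) (x) ... (x) I. When every f_i is positive
   regular, exactly one bounded operator acts on the basis in this way. *)
Definition Wop (i : 'I_k) (j : 'I_(n i)) : bop Fock :=
  xget 0 [set T : bop Fock | forall w : mword n,
    T (l2_basis w) =
      (Num.sqrt (bcoef (a (i := i)) (m i) (w i) /
                 bcoef (a (i := i)) (m i) (j :: w i)))%:C
      *: (l2_basis (mword_mul (mword_gen j) w) : Fock)].

Definition MQ : set Fock :=
  closed_span [set y | exists2 g, Q g & exists x : Fock, y = poly_op Wop g x].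

Definition NQ : normedModType R[i] := ocompl MQ.

(* The compression of W_(i,j) to N_Q, which is a bounded operator: the default
   0 of insubd is never used. *)
Definition Sop (i : 'I_k) (j : 'I_(n i)) : bop NQ :=
  insubd (0 : bop NQ) (fun x : NQ => oproj MQ (Wop j (ocompl_val x)) : NQ).

Definition variety_algebra_set : set (bop NQ) :=
  closed_algebra_generated
    [set T | T = 1 \/ exists i : 'I_k, exists j : 'I_(n i), T = Sop j].

Definition variety_algebra_pred : {pred bop NQ} :=
  fun T => `[< variety_algebra_set T >].

Lemma variety_algebra_predP T :
  reflect (variety_algebra_set T) (T \in variety_algebra_pred).
Proof. exact: asboolP. Qed.

Lemma variety_algebra_submod_closed : submod_closed variety_algebra_pred.
Proof.
split=> [|c S T /variety_algebra_predP hS /variety_algebra_predP hT];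
  apply/variety_algebra_predP => B BP;
  have [[[[B0 BZ] BM] Bc] BX] := BP => //.
by apply: BZ; [exact: (hS B BP)|exact: (hT B BP)].
Qed.

Lemma variety_algebra_mulr_closed : mulr_closed variety_algebra_pred.
Proof.
split=> [|S T /variety_algebra_predP hS /variety_algebra_predP hT];
  apply/variety_algebra_predP => B BP;
  have [[[[B0 BZ] BM] Bc] BX] := BP => //.
  by apply: BX; left.
by apply: BM; [exact: (hS B BP)|exact: (hT B BP)].
Qed.

HB.instance Definition _ := GRing.isSubmodClosed.Build R[i] (bop NQ)
  variety_algebra_pred variety_algebra_submod_closed.
HB.instance Definition _ := GRing.isMulClosed.Build (bop NQ)
  variety_algebra_pred variety_algebra_mulr_closed.

Record variety_algebra := VarietyAlgebra {
  va_val :> bop NQ;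
  va_valP : va_val \in variety_algebra_pred }.

HB.instance Definition _ := [isSub for va_val].
HB.instance Definition _ := [Choice of variety_algebra by <:].
HB.instance Definition _ := [SubChoice_isSubLmodule of variety_algebra by <:].
HB.instance Definition _ := GRing.SubZmodule_isSubPzRing.Build
  (bop NQ) variety_algebra_pred variety_algebra (GRing.subringClosedP _).

Lemma poly_op_Sop_in g : poly_op Sop g \in variety_algebra_pred.
Proof.
rewrite /poly_op; apply: rpred_sum => w _; apply: rpredZ.
apply: rpred_prod => i _; apply: rpred_prod => j _.
by apply/variety_algebra_predP; apply: sub_gen_smallest; right; exists i, j.
Qed.

(* g(S), as an element of the variety algebra. *)
Definition va_poly g : variety_algebra := VarietyAlgebra (poly_op_Sop_in g).

Definition is_character (phi : variety_algebra -> R[i]) : Prop :=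
  [/\ scalar phi, {morph phi : S T / S * T} & exists T, phi T != 0].

(* The weak-* topology is that of pointwise convergence. *)
Definition characters : set {ptws variety_algebra -> R[i]} := is_character.

Definition is_evaluation (lambda : variety) (phi : characters) : Prop :=
  forall g, \val phi (va_poly g) = poly_eval (entry (\val lambda)) g.

End Polydomains.

Definition is_homeomorphism (X Y : topologicalType) (f : X -> Y) : Prop :=
  continuous f /\
  exists g : Y -> X, [/\ continuous g, cancel f g & cancel g f].

Arguments polydomain {R k n} a m _ : rename.
Arguments variety {R k n} a m Q _ : rename.
Arguments characters {R k n} a m Q _ : rename.

(* Main.v *)
Require Import Defs.
From mathcomp Require Import all_boot all_order all_algebra.
From mathcomp Require Import finmap.
From mathcomp Require Import all_classical all_reals all_analysis.
From mathcomp Require Import complex ring lra.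
From mathcomp.multinomials Require monalg.
Import -(notations) monalg.
Set Implicit Arguments.
Unset Strict Implicit.
Unset Printing Implicit Defensive.
Import Order.TTheory GRing.Theory Num.Theory.
Import numFieldNormedType.Exports.
Local Open Scope classical_set_scope.
Local Open Scope ring_scope.
Local Open Scope complex_scope.

(** The map lambda |-> Phi_lambda is a homeomorphism for the following reasons.

    Write f = sum_alpha a_alpha Z_alpha for one of the f_i. The weights of the
    universal model are the coefficients of (1 - f) ^ (- m). Comparing
    coefficients gives the two facts on which everything rests. First,
    multiplying by f does not increase these coefficients
    ([front_conv_bcoef_le]); hence the row with entries sqrt(a_alpha) W_alpha is
    a contraction ([row_contraction]). Second, the sum of b_alpha |z_alpha|^2 is
    at most (1 - r) ^ (- m) as soon as that of a_alpha |z_alpha|^2 is at most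
    r < 1 ([bsum_bcoef_le]); hence the kernel
    sum_w sqrt(b_w) conj(z_w) e_w is a vector of the Fock space when z is in the
    interior of the polydomain ([kernel_l2]).

    Evaluations are contractive. The kernel at z is an eigenvector of the adjoint
    shifts, the eigenvalues being the conjugates of the coordinates of z. If the
    ideal Q vanishes at z, the kernel is orthogonal to M_Q, and the vector state
    that it defines sends p(S) to p(z), so that |p(z)| <= ||p(S)||
    ([poly_eval_le_interior]). A point of the variety on the boundary is the
    limit of the points t z with t < 1; since the generators of Q are
    homogeneous, these are interior points of the variety, and the inequality
    passes to the limit ([poly_eval_le]). Evaluation at z therefore extends to
    the norm closure of the polynomials in S, where it is a character.

    Every character is an evaluation. A character phi of the variety algebra is
    contractive by the Neumann series ([character_le]), hence determined by the
    point z with coordinates phi(S_(i,j)) ([eq_character]). This z is in the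
    variety. For g in Q, g(S) = 0, so that g(z) = phi(g(S)) = 0. For a finite set
    of words alpha in the letters of one tuple,
    L = sum a_alpha |z_alpha|^2 is the value of phi at
    sum a_alpha conj(z_alpha) S_alpha, whose norm is at most sqrt L by row
    contractivity; so L <= 1 ([character_value_row_le]).

    Topology. The inverse map is given by finitely many values of the character,
    hence is continuous. For T in the algebra, lambda |-> Phi_lambda(T) is a
    uniform limit of polynomial functions, by contractivity of the evaluations
    ([Psi_continuous]).

    The analysis used (completeness of l2, the projection theorem, completeness
    of bounded operators) is developed first, with limits handled by explicit
    rates of convergence ([rate_complete]). *)

(** * Real-valued norms and completeness *)

Section Real_norm.
Context {R : realType}.

(** The norms of normed modules over R[i] take values in R[i]; this is the same
    number in R, where ordered-field arithmetic is available. *)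
Definition nrm (V : normedModType R[i]) (x : V) : R := complex.Re `|x|.

Section Generic.
Context {V : normedModType R[i]}.
Implicit Types x y z : V.

Lemma nrmE x : `|x| = (nrm x)%:C.
Proof. exact: norm_ReE. Qed.

Lemma nrm_ge0 x : 0 <= nrm x.
Proof. by rewrite -ler0c -nrmE. Qed.

Lemma nrm0 : nrm (0 : V) = 0.
Proof. by rewrite /nrm normr0. Qed.

Lemma nrm_eq0 x : nrm x = 0 -> x = 0.
Proof. by move=> x0; apply: normr0_eq0; rewrite nrmE x0. Qed.

Lemma nrmD x y : nrm (x + y) <= nrm x + nrm y.
Proof. by rewrite -lecR rmorphD /= -!nrmE ler_normD. Qed.

Lemma nrmN x : nrm (- x) = nrm x.
Proof. by rewrite /nrm normrN. Qed.

Lemma nrm_distC x y : nrm (x - y) = nrm (y - x).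
Proof. by rewrite /nrm distrC. Qed.

Lemma nrmB z x y : nrm (x - y) <= nrm (x - z) + nrm (z - y).
Proof. by rewrite (le_trans _ (nrmD _ _))// subrKA. Qed.

Lemma nrm_sum (T : Type) (s : seq T) (P : pred T) (F : T -> V) :
  nrm (\sum_(i <- s | P i) F i) <= \sum_(i <- s | P i) nrm (F i).
Proof.
elim/big_ind2 : _ => //; first by rewrite nrm0.
by move=> x1 x2 y1 y2 h1 h2; rewrite (le_trans (nrmD _ _))// lerD.
Qed.

Lemma nrmZ (c : R[i]) x : nrm (c *: x) = nrm c * nrm x.
Proof. by apply/complexI; rewrite rmorphM /= -!nrmE normrZ. Qed.

Lemma closed_nrmP (M : set V) : closed M <->
  forall x, (forall e : R, 0 < e -> exists2 y, M y & nrm (x - y) < e) -> M x.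
Proof.
rewrite closure_id; split=> [cM x H|H].
  rewrite cM => B /nbhs_ballP[e /= e0 eB].
  have eE : e = (complex.Re e)%:C by rewrite RRe_real// gtr0_real.
  have {}e0 : 0 < complex.Re e by rewrite -(ltcR 0) -eE.
  have [y My xy] := H _ e0; exists y; split=> //; apply: eB.
  by rewrite -ball_normE /ball_/= eE nrmE ltcR.
apply/seteqP; split; first exact: subset_closure.
move=> x /= cx; apply: H => e e0.
have /cx[y [My]] : nbhs x (ball x e%:C).
  by apply/nbhs_ballP; exists e%:C => //=; rewrite (ltcR 0).
rewrite -ball_normE /ball_/= nrmE ltcR => xy.
by exists y.
Qed.

End Generic.

Lemma nrm_sqmod (z : R[i]) : nrm z ^+ 2 = sqmod z.
Proof. by rewrite /nrm normc_sqmod /= sqr_sqrtr// sqmod_ge0. Qed.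

Lemma nrmM (z w : R[i]) : nrm (z * w) = nrm z * nrm w.
Proof. exact: (nrmZ z (w : R[i])). Qed.

Lemma nrm_real (r : R) : nrm (r%:C : R[i]) = `|r|.
Proof.
apply/eqP; rewrite -(@eqrXn2 _ 2)// ?nrm_ge0// nrm_sqmod /sqmod/= expr0n/= addr0.
by rewrite real_normK// num_real.
Qed.

Lemma mul_conj (z : R[i]) : z * z^* = (sqmod z)%:C.
Proof. by case: z => a b; rewrite /sqmod; simpc; congr (_ +i* _); ring. Qed.

Lemma Re_le_nrm (z : R[i]) : `|complex.Re z| <= nrm z.
Proof.
rewrite -(@ler_pXn2r _ 2)// ?nnegrE ?nrm_ge0// nrm_sqmod real_normK ?num_real//.
by rewrite lerDl sqr_ge0.
Qed.

Lemma Im_le_nrm (z : R[i]) : `|complex.Im z| <= nrm z.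
Proof.
rewrite -(@ler_pXn2r _ 2)// ?nnegrE ?nrm_ge0// nrm_sqmod real_normK ?num_real//.
by rewrite lerDr sqr_ge0.
Qed.

Lemma nrm_le_ReIm (z : R[i]) : nrm z <= `|complex.Re z| + `|complex.Im z|.
Proof.
rewrite -(@ler_pXn2r _ 2)// ?nnegrE ?nrm_ge0// ?addr_ge0// nrm_sqmod.
rewrite sqrrD !real_normK ?num_real// -addrA lerD2l lerDr.
by rewrite mulrn_wge0// mulr_ge0.
Qed.

(** Only arbitrarily small values are asked for, not convergence: in
    [rate_complete] the bound at one index controls all later terms. *)
Definition null_seq (e : nat -> R) := forall d : R, 0 < d -> exists n, e n < d.

(** Completeness with an explicit modulus. The modulus passes unchanged to the
    limit, so that completeness of R lifts to R[i], then to l2 coordinate by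
    coordinate, then to operators vector by vector. *)
Definition rate_complete (V : normedModType R[i]) := forall (x : nat -> V) e,
  null_seq e ->
  (forall n m, (n <= m)%N -> nrm (x n - x m) <= e n) ->
  exists y, forall n, nrm (x n - y) <= e n.

Lemma null_seq_natSinv : null_seq (fun n => n.+1%:R^-1).
Proof.
move=> r r0; have [n _ nr] := near_infty_natSinv_lt (PosNum r0).
by exists n; exact: nr n (leqnn n).
Qed.

(** The intervals of centre [x n] and radius [e n] meet pairwise, so the
    supremum of their left ends lies in all of them. *)
Lemma real_rate_limit (x e : nat -> R) :
  (forall n m, (n <= m)%N -> `|x n - x m| <= e n) ->
  exists y, forall n, `|x n - y| <= e n.
Proof.
move=> H; pose S := range (fun n => x n - e n).
have ub n : ubound S (x n + e n).
  move=> _ [m _ <-].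
  have := H n _ (leq_maxl n m); have := H m _ (leq_maxr n m).
  rewrite !ler_norml => /andP[_ h1] /andP[h2 _]; lra.
have S0 : S !=set0 by exists (x 0 - e 0), 0.
have hS : has_ubound S by exists (x 0 + e 0); exact: ub.
exists (sup S) => n; rewrite ler_norml.
have h1 : sup S <= x n + e n by apply: ge_sup => //; exact: ub.
have h2 : x n - e n <= sup S by apply: ub_le_sup => //; exists n.
by apply/andP; split; lra.
Qed.

Lemma complex_rate_complete : rate_complete R[i].
Proof.
move=> x e e0 H.
have [n m nm|u hu] := @real_rate_limit (fun n => complex.Re (x n)) e.
  by rewrite -raddfB/= (le_trans (Re_le_nrm _))// H.
have [n m nm|v hv] := @real_rate_limit (fun n => complex.Im (x n)) e.
  by rewrite -raddfB/= (le_trans (Im_le_nrm _))// H.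
exists (u +i* v) => n; apply/ler_addgt0Pr => d d0.
have d2 : 0 < d / 4 by lra.
have [p pd] := e0 _ d2.
(* The two coordinates only give the bound [2 * e q]; comparing with a later
   index where this is small restores the modulus [e n]. *)
have near q : nrm (x q - u +i* v) <= 2 * e q.
  apply: le_trans (nrm_le_ReIm _) _; rewrite !raddfB/=.
  have := hu q; have := hv q; lra.
rewrite (le_trans (nrmB (x (maxn n p)) _ _))//.
have := H _ _ (leq_maxl n p).
have := H _ _ (leq_maxr n p); have := near p; have := near (maxn n p).
have := nrmB (x p) (x (maxn n p)) (u +i* v).
rewrite (nrm_distC (x (maxn n p)) (x p)); lra.
Qed.

End Real_norm.

(** * The Hilbert space of square-summable families *)

Section L2_theory.
Context {R : realType} {I : choiceType}.
Implicit Types (x y z : l2 R I) (c : R[i]).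
Local Notation H := (l2 R I).
Local Notation "'[ x , y ]" := (l2_inner x y).

Local Arguments l2_fun : simpl never.
Lemma esum_le_fin (f : I -> R) (c : R) :
  (forall A : {fset I}, \sum_(i <- A) f i <= c) ->
  (\esum_(i in [set: I]) (f i)%:E <= c%:E)%E.
Proof.
move=> fc; apply: ub_ereal_sup => _ [A [fA _] <-].
by rewrite fsbig_finite// sumEFin lee_fin.
Qed.

Lemma fin_le_esum (f : I -> R) (A : {fset I}) :
  ((\sum_(i <- A) f i)%:E <= \esum_(i in [set: I]) (f i)%:E)%E.
Proof.
apply: esum_ge; exists [set` A]; first by split => //; exact: finite_fset.
by rewrite fsbig_finite ?set_fsetK ?sumEFin//; exact: finite_fset.
Qed.

Lemma l2_coordD x y i : (x + y : H) i = x i + y i.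
Proof. by []. Qed.
Lemma l2_coordB x y i : (x - y : H) i = x i - y i.
Proof. by []. Qed.
Lemma l2_coordZ c x i : (c *: x : H) i = c * x i.
Proof. by []. Qed.
Lemma l2_coord_sum (T : Type) (s : seq T) (P : pred T) (F : T -> H) i :
  (\sum_(t <- s | P t) F t) i = \sum_(t <- s | P t) F t i.
Proof. by elim/big_ind2 : _ => // x1 x2 y1 y2 <- <-. Qed.

Lemma l2P x y : (forall i, x i = y i) -> x = y.
Proof. by move=> xy; apply: val_inj; apply/funext. Qed.

Lemma l2_predI (f : I -> R[i]) (c : R) :
  (forall A : {fset I}, \sum_(i <- A) sqmod (f i) <= c) -> f \in l2_pred.
Proof.
move=> fc; apply/l2_predP; rewrite /abs_summable.
under eq_esum do rewrite ger0_norm ?sqmod_ge0//.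
by apply: le_lt_trans (ltry c); exact: esum_le_fin.
Qed.

Lemma l2_normE x : nrm x = l2_norm x.
Proof. by []. Qed.

Lemma le_l2_norm x (A : {fset I}) : \sum_(i <- A) sqmod (x i) <= nrm x ^+ 2.
Proof. by rewrite -lee_fin l2_normE -l2_sqnorm; exact: fin_le_esum. Qed.

Lemma l2_norm_le x (c : R) : 0 <= c ->
  (forall A : {fset I}, \sum_(i <- A) sqmod (x i) <= c ^+ 2) -> nrm x <= c.
Proof.
move=> c0 xc; rewrite -(@ler_pXn2r _ 2)// ?nnegrE ?nrm_ge0//.
by rewrite -lee_fin l2_normE -l2_sqnorm; exact: esum_le_fin.
Qed.

Lemma l2_coord_le x i : nrm (x i) <= nrm x.
Proof.
rewrite -(@ler_pXn2r _ 2)// ?nnegrE ?nrm_ge0// nrm_sqmod.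
by have := le_l2_norm x [fset i]%fset; rewrite big_seq_fset1.
Qed.

Lemma l2_basisE i j : l2_basis (R := R) (I := I) i j = (j == i)%:R.
Proof. by []. Qed.

Local Arguments l2_basis : simpl never.

Definition trunc (A : {fset I}) (f : I -> R[i]) : H :=
  \sum_(i <- A) f i *: l2_basis i.

Lemma truncE A f j : trunc A f j = if j \in A then f j else 0.
Proof.
have E i : (f i *: l2_basis i : H) j = f i * (j == i)%:R by [].
rewrite /trunc l2_coord_sum; under eq_bigr do rewrite E.
case: ifPn => jA.
  rewrite (big_fsetD1 j jA) /= big1_seq ?addr0 ?eqxx ?mulr1// => i.
  by rewrite !inE eq_sym => /andP[_ /andP[/negPf -> _]]; rewrite mulr0.
rewrite big1_seq// => i /andP[_ iA]; case: eqP => [ji|]; rewrite ?mulr0//.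
by rewrite -ji (negPf jA) in iA.
Qed.

Lemma trunc_norm_sqr_le (A : {fset I}) (f : I -> R[i]) (c : R) :
  0 <= c -> \sum_(i <- A) sqmod (f i) <= c ^+ 2 ->
  nrm (trunc A f) <= c.
Proof.
move=> c0 fc; apply: l2_norm_le => // B; apply: le_trans fc.
under eq_bigr do rewrite truncE.
rewrite (big_fsetID _ (fun i => i \in A))/= [X in _ + X]big1_seq ?addr0; last first.
  by move=> i; rewrite !inE/= => /andP[_ /negPf ->]; rewrite /sqmod/= expr0n/= addr0.
rewrite (_ : [fset _ | _ in _ & _] = B `&` A)%fset; last first.
  by apply/fsetP => i; rewrite !inE.
rewrite (eq_big_seq (fun i => sqmod (f i))) => [|i]; last first.
  by rewrite inE => /andP[_ ->].
rewrite [leRHS](big_fsetID _ (fun i => i \in B))/=.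
rewrite (_ : [fset _ | _ in A & _ \in B] = B `&` A)%fset; last first.
  by apply/fsetP => i; rewrite !inE andbC.
by rewrite lerDl sumr_ge0// => i _; exact: sqmod_ge0.
Qed.

Lemma trunc_le_norm A x : nrm (trunc A x) <= nrm x.
Proof. by apply: trunc_norm_sqr_le; [exact: nrm_ge0|exact: le_l2_norm]. Qed.

(** The squared norm is a supremum of finite partial sums, and what is left
    after truncation is the tail of that sum. *)
Lemma trunc_approx x (e : R) : 0 < e -> exists A, nrm (x - trunc A x) < e.
Proof.
move=> e0.
suff [A hA] : exists A : {fset I},
    nrm x ^+ 2 - (e / 2) ^+ 2 <= \sum_(i <- A) sqmod (x i).
  exists A; apply: (@le_lt_trans _ _ (e / 2)); last by lra.
  apply: l2_norm_le => [|B]; first by lra.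
  have E i : (x - trunc A x : H) i = x i - trunc A x i by [].
  have -> : \sum_(i <- B) sqmod ((x - trunc A x : H) i) =
      \sum_(i <- (B `\` A)%fset) sqmod (x i).
    rewrite (big_fsetID _ (fun i => i \in A))/= big1_seq ?add0r.
      rewrite (_ : [fset _ | _ in _ & _] = B `\` A)%fset; last first.
        by apply/fsetP => i; rewrite !inE andbC.
      apply: eq_big_seq => i; rewrite inE => /andP[/negPf iA _].
      by rewrite E truncE iA subr0.
    move=> i; rewrite !inE/= => /andP[_ iA]; rewrite E truncE iA subrr.
    by rewrite /sqmod/= expr0n/= addr0.
  have := le_l2_norm x (A `|` B)%fset.
  rewrite (big_fsetID _ (fun i => i \in A))/=.
  rewrite (_ : [fset _ | _ in _ & _ \in A] = A)%fset; last first.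
    by apply/fsetP => i; rewrite !inE andbC; case: (i \in A).
  rewrite (_ : [fset _ | _ in _ & _] = B `\` A)%fset; last first.
    by apply/fsetP => i; rewrite !inE andbC; case: (i \in A).
  lra.
have [//|hA] := pselect (exists A : {fset I},
    nrm x ^+ 2 - (e / 2) ^+ 2 <= \sum_(i <- A) sqmod (x i)).
have : (\esum_(i in [set: I]) (sqmod (x i))%:E <=
    (nrm x ^+ 2 - (e / 2) ^+ 2)%:E)%E.
  apply: esum_le_fin => A; rewrite leNgt; apply/negP => /ltW h.
  by apply: hA; exists A.
rewrite l2_sqnorm lee_fin l2_normE => h.
have : 0 < (e / 2) ^+ 2 by rewrite exprn_gt0//; lra.
lra.
Qed.

(** Finitely supported families are dense, hence linear and continuous
    statements about l2 need only be checked on the basis. *)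
Lemma l2_closed_ind (M : set H) : subspace_set M -> closed M ->
  (forall i, M (l2_basis i)) -> forall x, M x.
Proof.
move=> [M0 ML] /closed_nrmP cM Mb x; apply: cM => e /(trunc_approx x)[A xA].
exists (trunc A x) => //; rewrite /trunc.
elim/big_ind : _ => // [y z My Mz|i _].
  by have := ML 1 y z My Mz; rewrite scale1r.
by have := ML (x i) (l2_basis i) 0 (Mb i) M0; rewrite addr0.
Qed.

Lemma l2_innerC x y : '[y, x] = ('[x, y])^*.
Proof.
have conjE (a b : R) : (a +i* b)^* = a +i* - b by [].
rewrite /l2_inner /csum conjE -rsumN; congr (_ +i* _).
  by congr rsum; apply/funext => i; case: (x i) (y i) => a b [c d] /=; ring.
congr rsum; apply/funext => i.
by case: (x i) (y i) => a b [c d] /=; ring.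
Qed.

Lemma l2_inner_norm x : '[x, x] = (nrm x ^+ 2)%:C.
Proof.
rewrite /l2_inner; under eq_fun do rewrite mul_conj.
rewrite /csum; congr (_ +i* _) => /=.
  rewrite (@rsum_diff _ _ _ (fun i => sqmod (x i)) (fun=> 0)).
  - rewrite [X in _ - fine X]esum1// subr0 l2_sqnorm/=.
    by rewrite l2_normE.
  - by move=> i; exact: sqmod_ge0.
  - by [].
  - exact: l2_summable.
  - by rewrite /abs_summable esum1// => i _; rewrite normr0.
  - by move=> i; rewrite subr0.
by rewrite /rsum !esum1 ?subrr// => i _; rewrite ?oppr0 maxxx.
Qed.

Lemma rsum_single (w : I) (f : I -> R) : (forall i, i != w -> f i = 0) ->
  rsum f = f w.
Proof.
move=> fw.
have E (g : I -> R) : (forall i, 0 <= g i) -> (forall i, i != w -> g i = 0) ->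
    fine (\esum_(i in [set: I]) (g i)%:E) = g w.
  move=> g0 gw; rewrite (_ : esum _ _ = \esum_(i in [set w]) (g i)%:E)%E.
    by rewrite esum_set1// lee_fin.
  rewrite [RHS]esum_mkcond; apply: eq_esum => i _; case: ifPn => //.
  by rewrite notin_setE/= => /eqP /gw ->.
rewrite /rsum (E (fun i => Num.max (f i) 0)) ?(E (fun i => Num.max (- f i) 0)).
- by rewrite -pos_sub_neg.
- by move=> i; exact: pospart_ge0.
- by move=> i /fw ->; rewrite oppr0 maxxx.
- by move=> i; exact: pospart_ge0.
- by move=> i /fw ->; rewrite maxxx.
Qed.

Lemma l2_inner_basis x i : '[x, l2_basis i] = x i.
Proof.
rewrite /l2_inner /csum !(rsum_single (w := i)).
- by rewrite l2_basisE eqxx rmorph1 mulr1; case: (x i).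
- by move=> j /negPf ji; rewrite l2_basisE ji rmorph0 mulr0.
- by move=> j /negPf ji; rewrite l2_basisE ji rmorph0 mulr0.
Qed.

Lemma l2_innerDl x y z : '[x + y, z] = '[x, z] + '[y, z].
Proof. by have := l2_inner_linear 1 x y z; rewrite scale1r mul1r. Qed.

Lemma l2_inner0l z : '[0, z] = 0.
Proof.
have := l2_innerDl 0 0 z; rewrite addr0 => /eqP.
by rewrite -subr_eq0 opprD addrA subrr add0r oppr_eq0 => /eqP.
Qed.

Lemma l2_innerZl c x z : '[c *: x, z] = c * '[x, z].
Proof. by have := l2_inner_linear c x 0 z; rewrite addr0 l2_inner0l addr0. Qed.

Lemma l2_innerNl x z : '[- x, z] = - '[x, z].
Proof. by rewrite -scaleN1r l2_innerZl mulN1r. Qed.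

Lemma l2_innerBl x y z : '[x - y, z] = '[x, z] - '[y, z].
Proof. by rewrite l2_innerDl l2_innerNl. Qed.

Lemma l2_innerDr x y z : '[z, x + y] = '[z, x] + '[z, y].
Proof. by rewrite !(l2_innerC _ z) l2_innerDl rmorphD. Qed.

Lemma l2_innerZr c x z : '[z, c *: x] = c^* * '[z, x].
Proof. by rewrite !(l2_innerC _ z) l2_innerZl rmorphM. Qed.

Lemma l2_inner0r z : '[z, 0] = 0.
Proof. by rewrite l2_innerC l2_inner0l rmorph0. Qed.

Lemma l2_innerNr x z : '[z, - x] = - '[z, x].
Proof. by rewrite !(l2_innerC _ z) l2_innerNl rmorphN. Qed.

Lemma l2_innerBr x y z : '[z, x - y] = '[z, x] - '[z, y].
Proof. by rewrite l2_innerDr l2_innerNr. Qed.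

Lemma l2_norm_sqrB x y :
  nrm (x - y) ^+ 2 = nrm x ^+ 2 - 2 * complex.Re '[x, y] + nrm y ^+ 2.
Proof.
have := l2_inner_norm (x - y).
rewrite l2_innerBl !l2_innerBr !l2_inner_norm (l2_innerC x y).
case: '[x, y] => a b /= /(congr1 (@complex.Re _)) /= <-; ring.
Qed.

Lemma l2_norm_sqrD x y :
  nrm (x + y) ^+ 2 = nrm x ^+ 2 + 2 * complex.Re '[x, y] + nrm y ^+ 2.
Proof.
rewrite -[y in LHS]opprK l2_norm_sqrB l2_innerNr nrmN raddfN /=; ring.
Qed.


(** The multiple of [y] subtracted here is the one nearest to [x]. Positivity of
    the left-hand side is the Cauchy-Schwarz inequality, and its minimality
    yields the orthogonality in the projection theorem. *)
Lemma l2_norm_sqr_residual x y : 0 < nrm y ->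
  nrm (x - (((nrm y ^+ 2)^-1)%:C * '[x, y]) *: y) ^+ 2 =
  nrm x ^+ 2 - nrm '[x, y] ^+ 2 / nrm y ^+ 2.
Proof.
move=> y0; rewrite l2_norm_sqrB l2_innerZr nrmZ nrmM nrm_real.
rewrite ger0_norm ?invr_ge0 ?sqr_ge0//.
have -> (s : R) (c : R[i]) : complex.Re ((s%:C * c)^* * c) = s * nrm c ^+ 2.
  by rewrite nrm_sqmod; case: c => a b; rewrite /sqmod/=; ring.
by field; rewrite gt_eqF.
Qed.

Lemma l2_CS x y : nrm '[x, y] <= nrm x * nrm y.
Proof.
have [y0|yn0] := eqVneq (nrm y) 0.
  by rewrite (nrm_eq0 y0) l2_inner0r !nrm0 mulr0.
have {yn0}y0 : 0 < nrm y by rewrite lt_def yn0 nrm_ge0.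
rewrite -(@ler_pXn2r _ 2)// ?nnegrE ?mulr_ge0 ?nrm_ge0//.
have := sqr_ge0 (nrm (x - (((nrm y ^+ 2)^-1)%:C * '[x, y]) *: y)).
rewrite l2_norm_sqr_residual// subr_ge0 exprMn ler_pdivrMr//.
by rewrite exprn_gt0.
Qed.

Lemma l2_basis_norm i : nrm (l2_basis i : H) = 1.
Proof.
have := l2_inner_norm (l2_basis i); rewrite l2_inner_basis l2_basisE eqxx.
move=> /(congr1 (@complex.Re _)) /= /esym /eqP.
by rewrite sqrp_eq1 ?nrm_ge0// => /eqP.
Qed.

Lemma trunc_norm_le_sum (A : {fset I}) (f : I -> R[i]) :
  nrm (trunc A f) <= \sum_(i <- A) nrm (f i).
Proof.
rewrite (le_trans (nrm_sum _ _ _))//; apply: ler_sum => i _.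
by rewrite nrmZ l2_basis_norm mulr1.
Qed.

(** The coordinates converge with the same modulus, and the norm bound on each
    finite set of coordinates survives in the limit. *)
Lemma l2_complete : rate_complete H.
Proof.
move=> x e e0 Hx.
have lim i : exists y : R[i], forall n, nrm (x n i - y) <= e n.
  apply: complex_rate_complete => // n m nm.
  by rewrite -l2_coordB (le_trans (l2_coord_le _ _))// Hx.
pose y i := xget 0 [set y : R[i] | forall n, nrm (x n i - y) <= e n].
have yP i n : nrm (x n i - y i) <= e n.
  have := @xgetPex _ 0 [set y : R[i] | forall n, nrm (x n i - y) <= e n] (lim i).
  exact.
have en0 n : 0 <= e n by rewrite (le_trans _ (Hx n n _))// nrm_ge0.
have trE (A : {fset I}) n : nrm (trunc A (fun i => x n i - y i)) <= e n.
  apply/ler_addgt0Pr => d d0.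
  have s0 : 0 < (size A).+1%:R :> R by rewrite ltr0n.
  have [p] := e0 _ (divr_gt0 d0 s0); rewrite ltr_pdivlMr// => pd.
  have -> : trunc A (fun i => x n i - y i) =
      trunc A (x n - x p) + trunc A (fun i => x p i - y i).
    rewrite /trunc -big_split/=; apply: eq_bigr => i _.
    by rewrite -scalerDl l2_coordB subrKA.
  have h1 : nrm (trunc A (x n - x p)) <= e n + e p.
    rewrite (le_trans (trunc_le_norm _ _))//.
    case: (leqP n p) => [np|/ltnW pn].
      by rewrite (le_trans (Hx _ _ np))// lerDl.
    by rewrite nrm_distC (le_trans (Hx _ _ pn))// lerDr.
  have h2 : nrm (trunc A (fun i => x p i - y i)) <= (size A)%:R * e p.
    rewrite (le_trans (trunc_norm_le_sum _ _))//.
    rewrite (le_trans (ler_sum _ (fun i _ => yP i p)))//.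
    by rewrite big_const_seq count_predT iter_addr_0 mulr_natl.
  rewrite (le_trans (nrmD _ _))//; move: pd; rewrite -natr1; lra.
have finE (A : {fset I}) n : \sum_(i <- A) sqmod (x n i - y i) <= e n ^+ 2.
  rewrite (@le_trans _ _ (nrm (trunc A (fun i => x n i - y i)) ^+ 2))//.
    apply: le_trans (le_l2_norm _ A); rewrite le_eqVlt; apply/orP; left.
    by apply/eqP/eq_big_seq => i iA; rewrite truncE iA.
  by rewrite lerXn2r ?nnegrE ?nrm_ge0.
pose z : H := x 0%N - L2 (l2_predI (finE^~ 0%N)).
have zE i : z i = y i by rewrite /z l2_coordB /= opprB addrC subrK.
exists z => n; apply: l2_norm_le => // A.
rewrite (le_trans _ (finE A n))// le_eqVlt; apply/orP; left.
by apply/eqP/eq_bigr => i _; rewrite l2_coordB zE.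
Qed.

(** The projection theorem: by the parallelogram identity, a sequence in [M]
    minimizing the distance to [u] is Cauchy, and its limit is the nearest
    point. *)
Lemma l2_projection (M : set H) : subspace_set M -> closed M ->
  forall u, exists2 y, M y & forall w, M w -> '[u - y, w] = 0.
Proof.
move=> [M0 ML] /closed_nrmP cM u.
pose S := [set nrm (u - w) ^+ 2 | w in M]; pose d := inf S.
have S0 : S !=set0 by exists (nrm (u - 0) ^+ 2), 0.
have lS : has_lbound S by exists 0 => _ [w _ <-]; exact: sqr_ge0.
have dS w : M w -> d <= nrm (u - w) ^+ 2 by move=> Mw; apply: ge_inf => //; exists w.
have d0 : 0 <= d by apply: lb_le_inf => // _ [w _ <-]; exact: sqr_ge0.
pose e n : R := n.+1%:R^-1.
have e0 n : 0 < e n by rewrite invr_gt0 ltr0n.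
have null : null_seq e := null_seq_natSinv.
have app n : exists w, M w /\ nrm (u - w) ^+ 2 < d + e n ^+ 2 / 4.
  have [_ [w Mw <-] wd] : exists2 s, S s & s < d + e n ^+ 2 / 4.
    apply/inf_adherent => //; rewrite divr_gt0// exprn_gt0//.
  by exists w.
pose w n := xget 0 [set w | M w /\ nrm (u - w) ^+ 2 < d + e n ^+ 2 / 4].
have wP n : M (w n) /\ nrm (u - w n) ^+ 2 < d + e n ^+ 2 / 4.
  exact: (@xgetPex _ 0 [set w | M w /\ nrm (u - w) ^+ 2 < d + e n ^+ 2 / 4] (app n)).
have mono n m : (n <= m)%N -> e m <= e n.
  by move=> nm; rewrite lef_pV2 ?posrE ?ltr0n// ler_nat.
have [|y yw] := @l2_complete w e null.
  move=> n m nm; have [Mn wn] := wP n; have [Mm wm] := wP m.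
  rewrite -(@ler_pXn2r _ 2)// ?nnegrE ?nrm_ge0 ?(ltW (e0 _))//.
  have par := l2_norm_sqrB (u - w m) (u - w n).
  have par' := l2_norm_sqrD (u - w m) (u - w n).
  have E1 : u - w m - (u - w n) = w n - w m by rewrite opprB addrC addrA subrK.
  have E2 : u - w m + (u - w n) = 2 *: (u - 2^-1 *: (w n + w m)).
    rewrite scalerBr scalerA divff ?pnatr_eq0// scale1r scaler_nat mulr2n.
    by rewrite addrACA -opprD (addrC (w m)).
  have : d <= nrm (u - 2^-1 *: (w n + w m)) ^+ 2.
    apply: dS; rewrite -[X in M X]addr0; apply: (ML) => //.
    by have := ML 1 _ _ Mn Mm; rewrite scale1r.
  have n2 : nrm (2 : R[i]) = 2.
    by rewrite -(rmorph_nat (real_complex R)) nrm_real ger0_norm.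
  rewrite {}E1 in par; rewrite {}E2 nrmZ n2 exprMn in par'.
  have : e m ^+ 2 <= e n ^+ 2 by rewrite lerXn2r ?nnegrE ?(ltW (e0 _))//; exact: mono.
  lra.
have My : M y.
  apply: cM => r /null[n nr]; exists (w n); first by have [] := wP n.
  by rewrite nrm_distC (le_lt_trans (yw n)).
have yd : nrm (u - y) ^+ 2 <= d.
  apply/ler_addgt0Pr => r r0.
  have K0 : 0 < 2 * d + 6 by lra.
  have [n] := null _ (divr_gt0 r0 K0); rewrite ltr_pdivlMr// => nr.
  have [_ wn] := wP n; have e1 : e n <= 1 by rewrite invf_le1 ?ltr0n// ler1n.
  have := nrmB (w n) u y; have := yw n; have := e0 n.
  have := nrm_ge0 (u - w n); have := nrm_ge0 (u - y).
  move: wn nr e1; set s := nrm (u - y); set t := nrm (u - w n); set E := e n.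
  move=> h1 h2 h3 h4 h5 h6 h7 h8.
  have E2 : E ^+ 2 <= E by rewrite expr2 ler_piMr// ltW.
  have t2 : t <= d + 2.
    rewrite leNgt; apply/negP => td.
    have : (d + 2) * (d + 2) <= t * t by apply: ler_pM; lra.
    have := sqr_ge0 d; rewrite expr2 in h1 *; nra.
  have : s ^+ 2 <= (t + E) ^+ 2 by rewrite lerXn2r ?nnegrE//; lra.
  have : t * E <= (d + 2) * E by rewrite ler_wpM2r// ltW.
  nra.
exists y => // v Mv.
have [v0|vn0] := eqVneq (nrm v) 0; first by rewrite (nrm_eq0 v0) l2_inner0r.
have {vn0}v0 : 0 < nrm v by rewrite lt_def vn0 nrm_ge0.
apply: nrm_eq0; apply/eqP; rewrite -sqrf_eq0 eq_le sqr_ge0 andbT.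
set c := ((nrm v ^+ 2)^-1)%:C * '[u - y, v].
have := l2_norm_sqr_residual (u - y) v0; rewrite -/c.
have : d <= nrm (u - y - c *: v) ^+ 2.
  have -> : u - y - c *: v = u - (c *: v + y) by rewrite opprD addrA addrAC.
  exact: (dS _ (ML c _ _ Mv My)).
move=> h1 h2; rewrite h2 in h1; have := le_trans yd h1.
by rewrite lerBrDl gerDr ler_pdivrMr ?exprn_gt0// mul0r.
Qed.

End L2_theory.

(** * Bounded operators, projections and compressions *)

Section Operators.
Context {R : realType}.

Section Bop.
Context {V : normedModType R[i]}.
Implicit Types (S T : bop V) (x y : V).

Lemma bopD T x y : T (x + y) = T x + T y.
Proof. by have := bop_linear T 1 x y; rewrite !scale1r. Qed.

Lemma bop0 T : T 0 = 0.
Proof. by apply: (addIr (T 0)); rewrite -bopD !add0r. Qed.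

Lemma bopZ T (c : R[i]) x : T (c *: x) = c *: T x.
Proof. by have := bop_linear T c x 0; rewrite bop0 !addr0. Qed.

Lemma bopN T x : T (- x) = - T x.
Proof. by rewrite -scaleN1r bopZ scaleN1r. Qed.

Lemma bopB T x y : T (x - y) = T x - T y.
Proof. by rewrite bopD bopN. Qed.

Lemma bop_ext S T : (forall x, S x = T x) -> S = T.
Proof. by move=> ST; apply: val_inj; apply/funext. Qed.

Lemma bop_addE S T x : (S + T : bop V) x = S x + T x.
Proof. by []. Qed.

Lemma bop_scaleE (c : R[i]) T x : (c *: T : bop V) x = c *: T x.
Proof. by []. Qed.

Lemma bop_mulE S T x : (S * T : bop V) x = S (T x).
Proof. by []. Qed.

Lemma bop_oneE x : (1 : bop V) x = x.
Proof. by []. Qed.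

Lemma bop_sumE (J : Type) (s : seq J) (P : pred J) (F : J -> bop V) x :
  (\sum_(j <- s | P j) F j) x = \sum_(j <- s | P j) F j x.
Proof. by elim/big_ind2 : _ => // S1 S2 y1 y2 <- <-. Qed.

Lemma bop_scaleAl (c : R[i]) S T : (c *: S) * T = c *: (S * T).
Proof. exact: bop_ext. Qed.

Lemma bop_scaleAr (c : R[i]) S T : S * (c *: T) = c *: (S * T).
Proof.
by apply: bop_ext => x; rewrite !(bop_mulE, bop_scaleE) bopZ.
Qed.

Lemma nrm_bop T x : nrm (T x) <= nrm T * nrm x.
Proof. by rewrite -lecR rmorphM /= -!nrmE; exact: opnormP. Qed.

Lemma nrm_bop_le T (k : R) : 0 <= k -> (forall x, nrm (T x) <= k * nrm x) ->
  nrm T <= k.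
Proof.
move=> k0 Tk; apply: opnorm_le => // x.
by rewrite !nrmE -rmorphM lecR.
Qed.

Lemma bop_predI (f : V -> V) (k : R) : linear f ->
  (forall x, nrm (f x) <= k * nrm x) -> f \in @bop_pred R V.
Proof.
move=> lf fk; apply/bop_predP; split=> //; exists k => x.
by rewrite !nrmE -rmorphM lecR.
Qed.

Lemma nrm_bopM S T : nrm (S * T) <= nrm S * nrm T.
Proof.
apply: nrm_bop_le => [|x]; first by rewrite mulr_ge0 ?nrm_ge0.
rewrite bop_mulE (le_trans (nrm_bop _ _))// -mulrA ler_wpM2l ?nrm_ge0//.
exact: nrm_bop.
Qed.

(** The form in which limits are taken below: an inequality that holds up to a
    multiple of a null sequence holds. *)
Lemma null_seq_le0 (a : R) (e : nat -> R) (c : R) : null_seq e -> 0 <= c ->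
  (forall n, a <= c * e n) -> a <= 0.
Proof.
move=> e0 c0 ac; apply/ler_addgt0Pr => d d0; rewrite add0r.
have c1 : 0 < c + 1 by lra.
have [n] := e0 _ (divr_gt0 d0 c1); rewrite ltr_pdivlMr// => nd.
have [en|en] := leP (e n) 0.
  by rewrite (le_trans (ac n))// (le_trans _ (ltW d0))// mulr_ge0_le0.
by rewrite (le_trans (ac n))//; nra.
Qed.

Lemma null_seqM (e : nat -> R) (c : R) : null_seq e -> 0 <= c ->
  (forall n, 0 <= e n) -> null_seq (fun n => e n * c).
Proof.
move=> e0 c0 en d d0; have c1 : 0 < c + 1 by lra.
have [n] := e0 _ (divr_gt0 d0 c1); rewrite ltr_pdivlMr// => nd.
by exists n; have := en n; nra.
Qed.

(** The pointwise limit of the operators is linear and bounded, and the modulus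
    is uniform in the vector. *)
Lemma bop_complete : rate_complete V -> rate_complete (bop V).
Proof.
move=> cV T e e0 HT.
have en n : 0 <= e n by rewrite (le_trans _ (HT n n _))// nrm_ge0.
have lim x : exists y : V, forall n, nrm (T n x - y) <= e n * nrm x.
  apply: (cV (fun n => T n x)) => [|n m nm].
    by apply: null_seqM => //; exact: nrm_ge0.
  rewrite -[X in nrm X]/((T n - T m) x) (le_trans (nrm_bop _ _))//.
  by rewrite ler_wpM2r ?nrm_ge0// HT.
pose L x := xget 0 [set y : V | forall n, nrm (T n x - y) <= e n * nrm x].
have LP x n : nrm (T n x - L x) <= e n * nrm x.
  by have := @xgetPex _ 0
    [set y : V | forall n, nrm (T n x - y) <= e n * nrm x] (lim x); exact.
have linL : linear L.
  move=> c x y; apply/eqP; rewrite -subr_eq0; apply/eqP/nrm_eq0/eqP.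
  rewrite eq_le nrm_ge0 andbT.
  apply: (@null_seq_le0 _ _ (nrm (c *: x + y) + (nrm c * nrm x + nrm y)) e0).
    by rewrite !addr_ge0 ?mulr_ge0 ?nrm_ge0.
  move=> n; rewrite mulrDl (le_trans (nrmB (T n (c *: x + y)) _ _))// lerD//.
    by rewrite nrm_distC mulrC LP.
  have -> : T n (c *: x + y) - (c *: L x + L y) =
      c *: (T n x - L x) + (T n y - L y).
    by rewrite bop_linear scalerBr opprD addrACA.
  rewrite (le_trans (nrmD _ _))// nrmZ mulrDl lerD//.
    by rewrite -mulrA ler_wpM2l ?nrm_ge0// mulrC LP.
  by rewrite mulrC LP.
have bL x : nrm (L x) <= (nrm (T 0%N) + e 0%N) * nrm x.
  have -> : L x = T 0%N x - (T 0%N x - L x) by rewrite opprB addrC subrK.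
  rewrite (le_trans (nrmD _ _))// nrmN mulrDl lerD//.
  exact: nrm_bop.
exists (BOp (bop_predI linL bL)) => n; apply: nrm_bop_le => // x.
exact: LP.
Qed.

End Bop.

Section Complement.
Context {I : choiceType}.
Variable M : set (l2 R I).
Local Notation N := (ocompl M).
Local Notation "'[ x , y ]" := (l2_inner x y).
Implicit Types (w : N) (u : l2 R I).

Lemma ocompl_orth w u : M u -> '[ocompl_val w, u] = 0.
Proof. by move=> Mu; have /ocompl_predP := ocompl_valP w; exact. Qed.

Lemma ocompl_orthC w u : M u -> '[u, ocompl_val w] = 0.
Proof. by move=> Mu; rewrite l2_innerC ocompl_orth// rmorph0. Qed.

Lemma ocompl_valD w1 w2 :
  ocompl_val (w1 + w2) = ocompl_val w1 + ocompl_val w2.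
Proof. by []. Qed.

Lemma ocompl_valB w1 w2 :
  ocompl_val (w1 - w2) = ocompl_val w1 - ocompl_val w2.
Proof. by []. Qed.

Lemma ocompl_valZ (c : R[i]) w : ocompl_val (c *: w) = c *: ocompl_val w.
Proof. by []. Qed.

Lemma ocompl_complete : rate_complete N.
Proof.
move=> x e e0 Hx.
have [|y yx] := @l2_complete R I (fun n => ocompl_val (x n)) e e0.
  by move=> n m nm; exact: Hx.
have yN : y \in ocompl_pred M.
  apply/ocompl_predP => u Mu; apply/nrm_eq0/eqP; rewrite eq_le nrm_ge0 andbT.
  apply: (null_seq_le0 e0 (nrm_ge0 u)) => n.
  have -> : '[y, u] = - '[ocompl_val (x n) - y, u].
    by rewrite l2_innerBl ocompl_orth// sub0r opprK.
  by rewrite nrmN (le_trans (l2_CS _ _))// mulrC ler_wpM2l ?nrm_ge0.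
by exists (OCompl yN) => n; exact: yx.
Qed.

Hypothesis sM : subspace_set M.
Hypothesis cM : closed M.

Lemma subspaceD u v : M u -> M v -> M (u + v).
Proof. by move=> Mu Mv; have := sM.2 1 _ _ Mu Mv; rewrite scale1r. Qed.

Lemma ocompl_decomp u : exists w, M (u - ocompl_val w).
Proof.
have [y My uy] := l2_projection sM cM u.
have wN : u - y \in ocompl_pred M by apply/ocompl_predP.
by exists (OCompl wN); rewrite /= opprB addrC subrK.
Qed.

(** Two candidates for the projection of [u] differ by a vector orthogonal to
    itself. *)
Lemma oproj_eq u w : M (u - ocompl_val w) -> oproj M u = w.
Proof.
move=> Mw.
have pP : forall v : N, '[u - ocompl_val (oproj M u), ocompl_val v] = 0.
  apply: (@xgetPex _ 0
    [set y : N | forall v : N, '[u - ocompl_val y, ocompl_val v] = 0]).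
  by exists w => v; exact: ocompl_orthC.
apply/eqP; rewrite -subr_eq0; apply/eqP/nrm_eq0/eqP.
set d := oproj M u - w.
have : '[ocompl_val d, ocompl_val d] = 0.
  have -> : '[ocompl_val d, ocompl_val d] =
     '[(u - ocompl_val w) - (u - ocompl_val (oproj M u)), ocompl_val d].
    by rewrite opprB addrC subrKA -ocompl_valB.
  by rewrite l2_innerBl pP ocompl_orthC// subr0.
rewrite l2_inner_norm => /complexI /eqP.
by rewrite sqrf_eq0.
Qed.

Lemma oproj_diff u : M (u - ocompl_val (oproj M u)).
Proof. by have [w Mw] := ocompl_decomp u; rewrite (oproj_eq Mw). Qed.

Lemma oproj_linear : linear (oproj M).
Proof.
move=> c u v; apply: oproj_eq; rewrite ocompl_valD ocompl_valZ.
rewrite opprD addrACA -scalerBr.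
by apply: (sM.2); exact: oproj_diff.
Qed.

Lemma oproj_orth u : M u -> oproj M u = 0.
Proof. by move=> Mu; apply: oproj_eq; rewrite subr0. Qed.

Lemma oproj_inner u w : '[ocompl_val (oproj M u), ocompl_val w] = '[u, ocompl_val w].
Proof.
apply/eqP; rewrite eq_sym -subr_eq0 -l2_innerBl ocompl_orthC//.
exact: oproj_diff.
Qed.

Lemma oproj_le u : nrm (oproj M u) <= nrm u.
Proof.
have [->|p0] := eqVneq (nrm (oproj M u)) 0; first exact: nrm_ge0.
have {}p0 : 0 < nrm (oproj M u) by rewrite lt_def p0 nrm_ge0.
rewrite -(ler_pM2r p0).
have := l2_CS u (ocompl_val (oproj M u)); rewrite -oproj_inner l2_inner_norm.
by rewrite nrm_real ger0_norm ?sqr_ge0// expr2.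
Qed.

Lemma compress_subproof (T : bop (l2 R I)) :
  (fun w : N => oproj M (T (ocompl_val w)) : N) \in @bop_pred R N.
Proof.
apply: (@bop_predI _ _ (nrm T)) => [c x y|x].
  by rewrite ocompl_valD ocompl_valZ bop_linear oproj_linear.
by rewrite (le_trans (oproj_le _))// nrm_bop.
Qed.

Definition compress (T : bop (l2 R I)) : bop N := BOp (compress_subproof T).

Lemma compressE T w : compress T w = oproj M (T (ocompl_val w)).
Proof. by []. Qed.

Lemma nrm_compress T : nrm (compress T) <= nrm T.
Proof.
apply: nrm_bop_le; first exact: nrm_ge0.
by move=> w; rewrite compressE (le_trans (oproj_le _))// nrm_bop.
Qed.

Lemma compress1 : compress 1 = 1.
Proof.
apply: bop_ext => w; rewrite compressE !bop_oneE; apply: oproj_eq.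
by rewrite subrr; exact: sM.1.
Qed.

Lemma compressD S T : compress (S + T) = compress S + compress T.
Proof.
apply: bop_ext => w; rewrite bop_addE !compressE bop_addE.
by have := oproj_linear 1 (S (ocompl_val w)) (T (ocompl_val w));
  rewrite !scale1r.
Qed.

Lemma compressZ (c : R[i]) T : compress (c *: T) = c *: compress T.
Proof.
apply: bop_ext => w; rewrite bop_scaleE !compressE bop_scaleE.
have := oproj_linear c (T (ocompl_val w)) 0.
by rewrite (oproj_orth sM.1) !addr0.
Qed.

(** If [S] preserves [M], the component along [M] that the inner projection
    discards would be killed by the outer one anyway. *)
Lemma compressM (S T : bop (l2 R I)) : (forall u, M u -> M (S u)) ->
  compress (S * T) = compress S * compress T.
Proof.
move=> SM; apply: bop_ext => w; rewrite bop_mulE !compressE bop_mulE.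
set v := T _; apply: oproj_eq.
rewrite -[X in S X](subrK (ocompl_val (oproj M v))) bopD -addrA.
by apply: subspaceD; [apply: SM|]; exact: oproj_diff.
Qed.

End Complement.

End Operators.

(** * The weights of the shifts *)

Section Words.
Context {R : realType} {n : nat}.
Local Notation word := (seq 'I_n).
Implicit Types (a F G : word -> R) (alpha beta : word).

(** The coefficient of the word [beta] in the [p]-th power of the sum of
    a_alpha Z_alpha over the nonempty words alpha. *)
Fixpoint conv_pow a (p : nat) beta : R :=
  if p is q.+1 then
    \sum_(i < size beta) a (take i.+1 beta) * conv_pow a q (drop i.+1 beta)
  else (beta == [::])%:R.

(** An explicit list for the finite set of tuples that indexes the inner sum of
    [bcoef]; the recursion on the first factor is that of [conv_pow]. *)
Fixpoint factorizations (p : nat) beta : seq (seq word) :=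
  if p is q.+1 then
    [seq take i.+1 beta :: g | i <- iota 0 (size beta),
                               g <- factorizations q (drop i.+1 beta)]
  else if beta is [::] then [:: [::]] else [::].

Lemma mem_factorizations p beta g : (g \in factorizations p beta) =
  [&& size g == p, flatten g == beta & [::] \notin g].
Proof.
elim: p beta g => [|p IH] beta g.
  by case: beta g => [|x beta] [|y g] //=; rewrite ?inE// andbF.
apply/allpairsPdep/idP => [[i [h [+ hi ->]]]|/and3P[]].
  rewrite mem_iota add0n /= => ib; move: hi; rewrite IH => /and3P[sh fh nh].
  rewrite eqSS sh (eqP fh) cat_take_drop eqxx/= inE negb_or nh andbT.
  by case: beta ib {fh}.
case: g => [//|alpha g]; rewrite eqSS inE negb_or /= => sg /eqP fg /andP[na ng].
have a0 : (0 < size alpha)%N by case: alpha na {fg}.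
exists (size alpha).-1, g; rewrite prednK// -fg take_size_cat// drop_size_cat//.
by rewrite IH sg eqxx ng mem_iota/= size_cat prednK// leq_addr.
Qed.

Lemma factorizations_uniq p beta : uniq (factorizations p beta).
Proof.
elim: p beta => [|p IH] beta; first by case: beta.
apply: allpairs_uniq_dep => [|i _|]; [exact: iota_uniq|exact: IH|].
move=> [i g] [j h] /= /allpairsPdep[i' [g' [+ _ [-> ->]]]].
move=> + /allpairsPdep[j' [h' [+ _ [-> ->]]]].
rewrite !mem_iota !add0n /= => ib jb [] /(congr1 size).
rewrite !size_take => + gh; rewrite {}gh.
have E k : (k < size beta)%N ->
    (if (k.+1 < size beta)%N then k.+1 else size beta) = k.+1.
  by move=> kb; case: (ltnP k.+1) => // sb; apply/eqP; rewrite eqn_leq sb kb.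
by rewrite !E// => -[->].
Qed.

Lemma sum_factorizations a p beta :
  \sum_(g <- factorizations p beta) \prod_(s <- g) a s = conv_pow a p beta.
Proof.
elim: p beta => [|p IH] beta /=.
  by case: beta => [|x beta]; rewrite ?big_seq1 ?big_nil.
rewrite big_allpairs_dep/= -[in LHS](subn0 (size beta)) -/(index_iota 0 _) big_mkord.
apply: eq_bigr => i _; rewrite -IH mulr_sumr; apply: eq_bigr => g _.
by rewrite big_cons.
Qed.

Lemma sum_tuple_factorizations a p beta (c : R) :
  \sum_(g \in [set g : p.-tuple word |
      flatten g = beta /\ [::] \notin (g : seq _)]) (\prod_(s <- g) a s) * c =
  conv_pow a p beta * c.
Proof.
rewrite -sum_factorizations [RHS]mulr_suml [RHS]fsbig_seq ?factorizations_uniq//=.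
apply/esym/(@reindex_fsbig _ _ _ _ _ (fun g : p.-tuple word => tval g)).
split=> [g /= [fg ng]|g h _ _ /val_inj//|g /=].
  by rewrite mem_factorizations size_tuple fg ng !eqxx.
rewrite mem_factorizations => /and3P[sg /eqP fg ng].
by exists (Tuple sg).
Qed.

Lemma conv_pow_ge0 a p beta : (forall s, 0 <= a s) -> 0 <= conv_pow a p beta.
Proof.
move=> a0; elim: p beta => [|p IH] beta /=; first by rewrite ler0n.
by apply: sumr_ge0 => i _; rewrite mulr_ge0.
Qed.

Lemma conv_pow_gt_size a p beta : (size beta < p)%N -> conv_pow a p beta = 0.
Proof.
elim: p beta => // p IH beta sb /=; rewrite big1// => i _.
rewrite IH ?mulr0// size_drop.
by case: (size beta) sb i => [|s] sb i //; rewrite ?subSS; case: i => //= i _;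
  rewrite (leq_ltn_trans (leq_subr _ _)).
Qed.

(** A word has no factorization into more nonempty words than it has letters,
    so the summation bound may be any larger one; the term [p = 0] absorbs the
    separate clause for the empty word. Formally,
    sum_beta b_beta Z_beta = sum_p C(p + m - 1, m - 1) f ^ p = (1 - f) ^ (- m). *)
Lemma bcoefE a m beta N : (size beta <= N)%N ->
  bcoef a m beta = \sum_(p < N.+1) conv_pow a p beta * 'C(p + m - 1, m - 1)%:R.
Proof.
move=> sN.
rewrite -(big_mkord xpredT (fun p => conv_pow a p beta * 'C(p + m - 1, m - 1)%:R)).
rewrite (@big_cat_nat _ _ _ (size beta).+1)//=.
rewrite [X in _ + X]big1_seq ?addr0; last first.
  move=> p; rewrite mem_index_iota => /andP[_ /andP[sp _]].
  by rewrite conv_pow_gt_size// mul0r.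
case: beta {sN} => [|x beta].
  by rewrite big_nat1 /= mul1r add0n binn.
rewrite big_nat_recl// [conv_pow _ 0 _]/= mul0r add0r.
rewrite /bcoef big_add1/=; apply: eq_bigr => p _.
exact: sum_tuple_factorizations.
Qed.

(** The coefficient of [beta] in the product of the series f, taken without
    constant term, with sum_beta b_beta Z_beta. *)
Definition front_conv a (b : word -> R) beta : R :=
  \sum_(i < size beta) a (take i.+1 beta) * b (drop i.+1 beta).

Lemma front_conv_bcoefE a m beta : front_conv a (bcoef a m) beta =
  \sum_(p < (size beta).+1) conv_pow a p.+1 beta * 'C(p + m - 1, m - 1)%:R.
Proof.
rewrite /front_conv.
under eq_bigr => i _.
  rewrite (@bcoefE _ _ _ (size beta)); last by rewrite size_drop leq_subr.
  rewrite mulr_sumr; over.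
rewrite exchange_big/=; apply: eq_bigr => p _.
by rewrite mulr_suml; apply: eq_bigr => i _; rewrite mulrA.
Qed.

Lemma bcoef_shift a m beta : bcoef a m beta = (beta == [::])%:R +
  \sum_(p < (size beta).+1) conv_pow a p.+1 beta * 'C(p + m, m - 1)%:R.
Proof.
rewrite (@bcoefE _ _ _ (size beta).+1)// big_ord_recl [conv_pow _ 0 _]/=.
rewrite add0n binn mulr1; congr (_ + _); apply: eq_bigr => p _.
by rewrite (_ : nat_of_ord (lift ord0 p) = p.+1)// addSn subSS subn0.
Qed.

(** Multiplying (1 - f) ^ (- m) by f shifts the powers of f by one, and the
    binomial coefficients increase with the power. This is the coefficient form
    of the operator inequality sum_alpha a_alpha W_alpha W_alpha ^* <= 1. *)
Lemma front_conv_bcoef_le a m beta : (forall s, 0 <= a s) ->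
  front_conv a (bcoef a m) beta <= bcoef a m beta.
Proof.
move=> a0; rewrite front_conv_bcoefE bcoef_shift -[leLHS]add0r lerD ?ler0n//.
apply: ler_sum => p _; rewrite ler_wpM2l ?conv_pow_ge0// ler_nat.
by apply: leq_bin2l; rewrite leq_subr.
Qed.

Lemma bcoef1E a beta :
  bcoef a 1 beta = (beta == [::])%:R + front_conv a (bcoef a 1) beta.
Proof.
rewrite front_conv_bcoefE bcoef_shift; congr (_ + _); apply: eq_bigr => p _.
by rewrite subnn !bin0.
Qed.

(** Pascal's rule, that is
    (1 - f) ^ (- m - 1) = (1 - f) ^ (- m) + f (1 - f) ^ (- m - 1). *)
Lemma bcoef_succ a m beta : (0 < m)%N ->
  bcoef a m.+1 beta = bcoef a m beta + front_conv a (bcoef a m.+1) beta.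
Proof.
move=> m0; rewrite front_conv_bcoefE 2!bcoef_shift -addrA -big_split/=.
congr (_ + _); apply: eq_bigr => p _; rewrite -mulrDr -natrD; congr (_ * _%:R).
case: m m0 => // m _; by rewrite !subn1 addnS /= binS addnC.
Qed.

Lemma bcoef_ge0 a m beta : (forall s, 0 <= a s) -> 0 <= bcoef a m beta.
Proof.
move=> a0; rewrite (@bcoefE _ _ _ (size beta))//; apply: sumr_ge0 => p _.
by rewrite mulr_ge0 ?conv_pow_ge0// ler0n.
Qed.

(** Only the term of [front_conv_bcoef_le] with first factor [j] is kept. This
    bounds the weights of the shifts and makes all of them positive. *)
Lemma bcoef_cons_ge a m j beta : (forall s, 0 <= a s) ->
  a [:: j] * bcoef a m beta <= bcoef a m (j :: beta).
Proof.
move=> a0; rewrite (le_trans _ (front_conv_bcoef_le m _ a0))//.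
rewrite /front_conv /= big_ord_recl /= take0 drop0 lerDl.
by apply: sumr_ge0 => i _; rewrite mulr_ge0// bcoef_ge0.
Qed.

Lemma bcoef_gt0 a m beta : (forall s, 0 <= a s) -> (forall j, 0 < a [:: j]) ->
  0 < bcoef a m beta.
Proof.
move=> a0 aj; elim: beta => [|j beta IH]; first by rewrite /bcoef ltr01.
by rewrite (lt_le_trans _ (bcoef_cons_ge m j beta a0))// mulr_gt0.
Qed.

(** The sum over the words of length [l], by recursion on the first letter so
    that cutting words at a given place is an induction. *)
Fixpoint lsum (l : nat) F : R :=
  if l is l'.+1 then \sum_(j < n) lsum l' (fun w => F (j :: w)) else F [::].

Lemma lsumZ l (c : R) F : lsum l (fun w => c * F w) = c * lsum l F.
Proof.
elim: l F => //= l IH F; rewrite mulr_sumr; apply: eq_bigr => j _.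
exact: IH.
Qed.

Lemma lsumD l F G : lsum l (fun w => F w + G w) = lsum l F + lsum l G.
Proof.
elim: l F G => //= l IH F G; rewrite -big_split; apply: eq_bigr => j _.
exact: IH.
Qed.

Lemma eq_lsum l F G : (forall w, size w = l -> F w = G w) -> lsum l F = lsum l G.
Proof.
elim: l F G => /= [|l IH] F G FG; first exact: FG.
by apply: eq_bigr => j _; apply: IH => w sw; apply: FG; rewrite /= sw.
Qed.

Lemma ler_lsum l F G : (forall w, size w = l -> F w <= G w) ->
  lsum l F <= lsum l G.
Proof.
elim: l F G => /= [|l IH] F G FG; first exact: FG.
by apply: ler_sum => j _; apply: IH => w sw; apply: FG; rewrite /= sw.
Qed.

Lemma lsum_ge0 l F : (forall w, 0 <= F w) -> 0 <= lsum l F.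
Proof. by elim: l F => //= l IH F F0; apply: sumr_ge0 => j _; exact: IH. Qed.

Lemma lsum_sum l k (F : 'I_k -> word -> R) :
  lsum l (fun w => \sum_(i < k) F i w) = \sum_(i < k) lsum l (F i).
Proof.
elim: l F => //= l IH F; rewrite exchange_big; apply: eq_bigr => j _.
exact: IH.
Qed.

Lemma lsum_split p q F G :
  lsum (p + q) (fun w => F (take p w) * G (drop p w)) = lsum p F * lsum q G.
Proof.
elim: p F => [|p IH] F /=.
  by rewrite add0n -lsumZ; apply: eq_lsum => w _; rewrite take0 drop0.
by rewrite mulr_suml; apply: eq_bigr => j _; rewrite -IH.
Qed.

Lemma lsum_tuple l F : lsum l F = \sum_(t : l.-tuple 'I_n) F t.
Proof.
elim: l F => [|l IH] F /=.
  rewrite (eq_bigr (fun=> F [::])) => [|t _]; last by rewrite tuple0.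
  by rewrite sumr_const card_tuple expn0.
under eq_bigr do rewrite IH.
rewrite pair_big/= (reindex (fun t : l.+1.-tuple 'I_n => (thead t, behead_tuple t)))/=.
  by apply: eq_bigr => t _; rewrite [in RHS](tuple_eta t).
exists (fun p => cons_tuple p.1 p.2) => [t _|[j t] _] /=.
  by rewrite [RHS]tuple_eta; apply: val_inj.
by congr pair; apply: val_inj.
Qed.


Definition bsum (N : nat) F : R := \sum_(l < N.+1) lsum l F.

Lemma bsumD N F G : bsum N (fun w => F w + G w) = bsum N F + bsum N G.
Proof. by rewrite /bsum -big_split; apply: eq_bigr => l _; exact: lsumD. Qed.

Lemma eq_bsum N F G : (forall w, F w = G w) -> bsum N F = bsum N G.
Proof. by move=> FG; apply: eq_bigr => l _; apply: eq_lsum => w _. Qed.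

Lemma bsum_bseq N F : \sum_(t : N.-bseq 'I_n) F t = bsum N F.
Proof.
rewrite /bsum; under [RHS]eq_bigr do rewrite lsum_tuple.
rewrite sig_big_dep/= (reindex (@bseq_tagged_tuple N 'I_n))/=.
  by apply: eq_bigr => t _.
by apply: onW_bij; exists (@tagged_tuple_bseq N 'I_n);
  [exact: bseq_tagged_tupleK|exact: tagged_tuple_bseqK].
Qed.

Section Weighted.
Variables (a u : word -> R) (r : R).
Hypothesis a_ge0 : forall w, 0 <= a w.
Hypothesis u_ge0 : forall w, 0 <= u w.
Hypothesis u_nil : u [::] = 1.
Hypothesis u_cat : forall v w, u (v ++ w) = u v * u w.
Hypothesis r_ge0 : 0 <= r.
Hypothesis r_lt1 : r < 1.
Hypothesis au_le : forall N, \sum_(i < N) lsum i.+1 (fun w => a w * u w) <= r.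

Lemma lsum_front_conv (b : word -> R) l :
  lsum l (fun w => front_conv a b w * u w) =
  \sum_(i < l) lsum i.+1 (fun w => a w * u w) *
     lsum (l - i.+1) (fun w => b w * u w).
Proof.
transitivity (lsum l (fun w => \sum_(i < l)
    (a (take i.+1 w) * u (take i.+1 w)) * (b (drop i.+1 w) * u (drop i.+1 w)))).
  apply: eq_lsum => w sw; rewrite /front_conv sw mulr_suml; apply: eq_bigr => i _.
  by rewrite -[X in _ * u X = _](cat_take_drop i.+1 w) u_cat mulrACA.
rewrite lsum_sum; apply: eq_bigr => i _.
rewrite -(@lsum_split i.+1 (l - i.+1) (fun w => a w * u w) (fun w => b w * u w)).
by rewrite subnKC.
Qed.

(** The truncation to length at most [N] turns the multiplicativity of the
    generating functions into an inequality, both factors of a short word being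
    short. *)
Lemma bsum_front_conv (b : word -> R) N : (forall w, 0 <= b w) ->
  bsum N (fun w => front_conv a b w * u w) <= r * bsum N (fun w => b w * u w).
Proof.
move=> b0; rewrite /bsum; under eq_bigr do rewrite lsum_front_conv.
have bu0 l : 0 <= lsum l (fun w => b w * u w).
  by apply: lsum_ge0 => w; rewrite mulr_ge0.
have au0 l : 0 <= lsum l (fun w => a w * u w).
  by apply: lsum_ge0 => w; rewrite mulr_ge0.
pose x i := lsum i (fun w => a w * u w).
pose y i := lsum i (fun w => b w * u w).
rewrite (eq_bigr (fun l : 'I_N.+1 =>
  \sum_(i < N | (i < l)%N) x i.+1 * y (l - i.+1)%N)); last first.
  by move=> [l /= lN] _; rewrite (big_ord_widen_cond N xpredT
    (fun i => x i.+1 * y (l - i.+1)%N)).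
rewrite (exchange_big_dep xpredT)//=.
apply: (@le_trans _ _ (\sum_(i < N) x i.+1 * \sum_(l < N.+1) y l)); last first.
  rewrite -mulr_suml; apply: ler_wpM2r; last exact: au_le.
  by apply: sumr_ge0 => l _; exact: bu0.
apply: ler_sum => i _; rewrite -mulr_sumr; apply: ler_wpM2l; first exact: au0.
rewrite -(big_mkord (fun l => (i < l)%N) (fun l => y (l - i.+1)%N)).
rewrite -(big_mkord xpredT y).
rewrite (@big_cat_nat _ _ _ i.+1)//=; last exact: leqW.
rewrite big_nat_cond big1 ?add0r; last first.
  by move=> l /andP[/andP[_]]; rewrite ltnS leqNgt => /negPf ->.
rewrite -{1}(add0n i.+1) big_addn.
rewrite (@big_cat_nat _ _ _ (N.+1 - i.+1) 0%N N.+1)//= ?leq_subr//.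
rewrite big_mkcond/= -[leLHS]addr0 lerD//; last by apply: sumr_ge0 => l _; exact: bu0.
by apply: ler_sum => l _; rewrite addnK; case: ifP => // _; exact: bu0.
Qed.

(** The generating function of b is bounded by (1 - r) ^ (- m) where f is bounded
    by r: the truncated sums B_m satisfy B_m <= B_(m-1) + r B_m, with B_0 = 1,
    and being finite they can be solved for. *)
Lemma bsum_bcoef_le m N : (0 < m)%N ->
  bsum N (fun w => bcoef a m w * u w) <= ((1 - r)^-1) ^+ m.
Proof.
have r1 : 0 < 1 - r by rewrite subr_gt0.
have b0 m' w : 0 <= bcoef a m' w by exact: bcoef_ge0.
case: m => // m _; elim: m => [|m IH].
  have := bsum_front_conv N (b0 1%N).
  have -> : bsum N (fun w => bcoef a 1 w * u w) =
      1 + bsum N (fun w => front_conv a (bcoef a 1) w * u w).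
    under eq_bsum do rewrite bcoef1E mulrDl.
    rewrite bsumD; congr (_ + _); rewrite /bsum big_ord_recl/= u_nil mul1r.
    rewrite big1 ?addr0// => l _; rewrite /= big1// => j _.
    rewrite (@eq_lsum _ _ (fun w => 0 * u w)) ?lsumZ ?mul0r// => w _.
    by rewrite !mul0r.
  rewrite expr1 -div1r ler_pdivlMr//; set t := bsum _ _ => ht; nra.
have := bsum_front_conv N (b0 m.+2).
have -> : bsum N (fun w => bcoef a m.+2 w * u w) =
    bsum N (fun w => bcoef a m.+1 w * u w) +
    bsum N (fun w => front_conv a (bcoef a m.+2) w * u w).
  by rewrite -bsumD; apply: eq_bsum => w; rewrite bcoef_succ// mulrDl.
rewrite exprSr ler_pdivlMr//; move: IH.
set s := bsum _ _; set t := bsum _ _; set e := _ ^+ _; move=> h1 h2; nra.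
Qed.

End Weighted.

End Words.

(** * Polynomials in operators, closed subspaces, partial shifts *)

Section Polynomial_maps.
Context {R : realType} {k : nat} {n : 'I_k -> nat}.
Variables (A : lmodType R[i]) (mul : A -> A -> A) (H : mword n -> A).
Implicit Types p q : ncpoly R n.

(** The linear extension of [H] to polynomials. The product of the target is a
    parameter, so that scalars and operators are treated at once. *)
Definition poly_map p : A := \sum_(w <- msupp p) mcoeff w p *: H w.

Lemma poly_mapEw (d : {fset mword n}) p : (msupp p `<=` d)%fset ->
  poly_map p = \sum_(w <- d) mcoeff w p *: H w.
Proof.
move=> pd; rewrite /poly_map (big_fset_incl _ pd)// => w wd wp.
by rewrite mcoeff_outdom// scale0r.
Qed.

Lemma poly_mapD p q : poly_map (p + q) = poly_map p + poly_map q.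
Proof.
rewrite (poly_mapEw (msuppD_le p q)) (poly_mapEw (fsubsetUl (msupp p) (msupp q))).
rewrite (poly_mapEw (fsubsetUr (msupp p) (msupp q))) -big_split/=.
by apply: eq_bigr => w _; rewrite mcoeffD scalerDl.
Qed.

Lemma poly_map0 : poly_map 0 = 0.
Proof. by rewrite /poly_map msupp0 big_seq_fset0. Qed.

Lemma poly_map_sum (J : Type) (s : seq J) (P : pred J) (F : J -> ncpoly R n) :
  poly_map (\sum_(j <- s | P j) F j) = \sum_(j <- s | P j) poly_map (F j).
Proof. exact: (big_morph poly_map poly_mapD poly_map0). Qed.

Lemma poly_mapU (c : R[i]) w : poly_map (mkmalgU w c) = c *: H w.
Proof.
by rewrite (poly_mapEw (@msuppU_le _ _ w c)) big_seq_fset1 mcoeffUU.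
Qed.

Lemma poly_mapZ (c : R[i]) p : poly_map (c *: p) = c *: poly_map p.
Proof.
rewrite (poly_mapEw (msuppZ_le c p)) /poly_map scaler_sumr.
by apply: eq_bigr => w _; rewrite mcoeffZ scalerA.
Qed.

Hypothesis mulDl : forall x y z, mul (x + y) z = mul x z + mul y z.
Hypothesis mulDr : forall x y z, mul z (x + y) = mul z x + mul z y.
Hypothesis mulZl : forall c x z, mul (c *: x) z = c *: mul x z.
Hypothesis mulZr : forall c x z, mul z (c *: x) = c *: mul z x.
Hypothesis HM : forall u v, H (mword_mul u v) = mul (H u) (H v).

Lemma poly_mapM p q : poly_map (p * q) = mul (poly_map p) (poly_map q).
Proof.
have mul0l z : mul 0 z = 0 by have := mulZl 0 0 z; rewrite !scale0r.
have mul0r z : mul z 0 = 0 by have := mulZr 0 0 z; rewrite !scale0r.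
rewrite (malgME p q) poly_map_sum [poly_map p]/poly_map [poly_map q]/poly_map.
rewrite (big_morph (mul^~ _) (fun x y => mulDl x y _) (mul0l _)).
apply: eq_bigr => u _; rewrite poly_map_sum.
rewrite (big_morph (mul _) (fun x y => mulDr x y _) (mul0r _)).
apply: eq_bigr => v _; rewrite poly_mapU mulZl mulZr scalerA.
by rewrite -[in RHS]HM.
Qed.

End Polynomial_maps.

Section Operator_polynomials.
Context {R : realType} {k : nat} {n : 'I_k -> nat}.
Context {V : normedModType R[i]}.
Variable X : forall i, 'I_(n i) -> bop V.
Implicit Types p q : ncpoly R n.

Lemma poly_opD p q : poly_op X (p + q) = poly_op X p + poly_op X q.
Proof. exact: (@poly_mapD R k n (bop V) (mword_prod X)). Qed.

Lemma poly_opZ (c : R[i]) p : poly_op X (c *: p) = c *: poly_op X p.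
Proof. exact: (@poly_mapZ R k n (bop V) (mword_prod X)). Qed.

Lemma poly_opU w : poly_op X (mkmalgU w 1) = mword_prod X w.
Proof. by rewrite -[LHS]/(poly_map _ _) poly_mapU scale1r. Qed.

Hypothesis X_mul : forall u v,
  mword_prod X (mword_mul u v) = mword_prod X u * mword_prod X v.

Lemma poly_opM p q : poly_op X (p * q) = poly_op X p * poly_op X q.
Proof.
apply: (@poly_mapM R k n (bop V) (fun S T => S * T) (mword_prod X)) =>
  [x y z|x y z|c x z|c x z|u v].
- exact: mulrDl.
- exact: mulrDr.
- exact: bop_scaleAl.
- exact: bop_scaleAr.
- exact: X_mul.
Qed.

End Operator_polynomials.

Section Closed_subspaces.
Context {R : realType} {V : normedModType R[i]}.
Implicit Types X : set V.

Lemma closed_span_subspace X : subspace_set (closed_span X).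
Proof.
split=> [M [[[M0 _] _]]//|c x y hx hy M hM].
by have [[[_ ML] _] _] := hM; apply: (ML); [exact: hx|exact: hy].
Qed.

Lemma closed_span_closed X : closed (closed_span X).
Proof. by apply: closed_bigI => M [[_ cM] _]. Qed.

Lemma sub_closed_span X : X `<=` closed_span X.
Proof. exact: sub_gen_smallest. Qed.

Lemma closed_span_min X (M : set V) : subspace_set M -> closed M ->
  X `<=` M -> closed_span X `<=` M.
Proof. by move=> sM cM XM; apply: smallest_sub. Qed.

Lemma closed_preimage_lip (W : normedModType R[i]) (F : V -> W) (K : R)
    (M : set W) :
  (forall x y, nrm (F x - F y) <= K * nrm (x - y)) -> closed M ->
  closed [set x | M (F x)].
Proof.
move=> FK /closed_nrmP cM; apply/closed_nrmP => x hx /=; apply: cM => e e0.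
have K1 : 0 < `|K| + 1 by rewrite ltr_wpDl.
have [y My xy] := hx _ (divr_gt0 e0 K1); exists (F y) => //.
rewrite ltr_pdivlMr// in xy; apply: le_lt_trans xy.
rewrite (le_trans (FK x y))// mulrC ler_wpM2l ?nrm_ge0//.
by rewrite (le_trans (ler_norm K))// lerDl.
Qed.

Lemma closed_eq0 : closed [set (0 : V)].
Proof.
apply/closed_nrmP => x hx; apply/nrm_eq0/eqP; rewrite eq_le nrm_ge0 andbT.
by apply/ler_addgt0Pr => e /hx[y /= ->]; rewrite subr0 add0r => /ltW.
Qed.

Lemma closed_bop_preimage (T : bop V) (M : set V) : closed M ->
  closed [set x | M (T x)].
Proof.
apply: (@closed_preimage_lip _ _ (nrm T)) => x y.
by rewrite -bopB nrm_bop.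
Qed.

End Closed_subspaces.

Section L2_operators.
Context {R : realType} {I : choiceType}.
Implicit Types (S T : bop (l2 R I)).

Lemma bop_basis_eq0 T : (forall i, T (l2_basis i) = 0) -> forall x, T x = 0.
Proof.
move=> T0; apply: (l2_closed_ind (M := [set x | T x = 0])) => //.
- split=> [|c u v /= hu hv]; first exact: bop0.
  by apply: (etrans (bop_linear T c u v)); rewrite hu hv scaler0 addr0.
- exact: (closed_bop_preimage closed_eq0).
Qed.

Lemma bop_basis_ext S T :
  (forall i, S (l2_basis i) = T (l2_basis i)) -> S = T.
Proof.
move=> ST; apply: bop_ext => x; apply/eqP; rewrite -subr_eq0; apply/eqP.
apply: (@bop_basis_eq0 (S - T)) => i.
by rewrite -[LHS]/(S _ - T _) ST subrr.
Qed.

(** Each coordinate of [x] is counted at most once. *)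
Lemma sum_partial_inj_le (g : I -> option I) (x : l2 R I)
    (A : {fset I}) :
  (forall i j l, g i = Some l -> g j = Some l -> i = j) ->
  \sum_(i <- A) (if g i is Some j then sqmod (x j) else 0) <= nrm x ^+ 2.
Proof.
move=> gI; pose s := pmap g A.
have us : uniq s.
  rewrite /s; have := fset_uniq A; elim: (enum_fset A) => //= i t IH.
  case/andP => it ut; case E : (g i) => [j|]; last exact: IH.
  rewrite /= IH// andbT mem_pmap; apply/negP => /mapP[i' i't E'].
  by move: it; rewrite (gI _ _ _ E (esym E')) i't.
have -> : \sum_(i <- A) (if g i is Some j then sqmod (x j) else 0) =
    \sum_(j <- s) sqmod (x j).
  rewrite /s; elim: (enum_fset A) => [|i t IH] /=; first by rewrite !big_nil.
  by rewrite big_cons IH; case E : (g i) => [j|] /=; rewrite ?big_cons ?add0r.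
rewrite (le_trans _ (le_l2_norm x [fset j in s]%fset))//.
rewrite (perm_big (enum_fset [fset j in s]%fset))//.
by apply: uniq_perm => // j; rewrite inE.
Qed.

(** Weighted shifts are given by a formula for the coordinates of their values,
    which needs no limit, rather than by their values on the basis. *)
Lemma partial_shift_exists (g : I -> option I) (c : I -> R[i]) (K : R) :
  (forall i j l, g i = Some l -> g j = Some l -> i = j) ->
  (forall i, sqmod (c i) <= K) -> 0 <= K ->
  exists T : bop (l2 R I), forall x i,
    T x i = if g i is Some j then c i * x j else 0.
Proof.
move=> gI cK K0.
pose f (x : l2 R I) i := if g i is Some j then c i * x j else 0.
have fle x (A : {fset I}) : \sum_(i <- A) sqmod (f x i) <= K * nrm x ^+ 2.
  apply: le_trans (ler_wpM2l K0 (sum_partial_inj_le x A gI)).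
  rewrite mulr_sumr; apply: ler_sum => i _; rewrite /f.
  case: (g i) => [j|]; last by rewrite mulr0 /sqmod/= expr0n/= addr0.
  by rewrite sqmodM ler_wpM2r ?sqmod_ge0.
pose Tx x : l2 R I := L2 (l2_predI (fle x)).
have TP : Tx \in @bop_pred R (l2 R I).
  apply: (@bop_predI _ _ _ (Num.sqrt K)) => [d x y|x].
    apply: l2P => i; rewrite l2_coordD l2_coordZ /Tx /= /f.
    case: (g i) => [j|]; last by rewrite mulr0 addr0.
    by rewrite l2_coordD l2_coordZ mulrDr mulrCA.
  apply: l2_norm_le => [|A]; first by rewrite mulr_ge0 ?sqrtr_ge0 ?nrm_ge0.
  by rewrite exprMn sqr_sqrtr//; exact: fle.
by exists (BOp TP) => x i.
Qed.

End L2_operators.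

(** * The universal model and its compression *)

Section Mword_update.
Context {k : nat} {n : 'I_k -> nat}.
Implicit Types (u v w : mword n).

Definition mupd w (i : 'I_k) (s : seq 'I_(n i)) : mword n :=
  finfun (dfwith (fun l => w l) i s).

Lemma mupdE w i (s : seq 'I_(n i)) : mupd w s i = s.
Proof. by rewrite ffunE dfwithin. Qed.

Lemma mupd_out w i (s : seq 'I_(n i)) l : i != l -> mupd w s l = w l.
Proof. by move=> il; rewrite ffunE dfwithout. Qed.

Lemma mupd_id w i : mupd w (w i) = w.
Proof.
apply/ffunP => l; have [<-|il] := eqVneq i l; first by rewrite mupdE.
by rewrite mupd_out.
Qed.

Lemma mupd_mupd w i (s t : seq 'I_(n i)) : mupd (mupd w s) t = mupd w t.
Proof.
apply/ffunP => l; have [<-|il] := eqVneq i l; first by rewrite !mupdE.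
by rewrite !mupd_out.
Qed.

Lemma mword_mul_gen i (j : 'I_(n i)) w :
  mword_mul (mword_gen j) w = mupd w (j :: w i).
Proof.
apply/ffunP => l; rewrite !ffunE.
have [<-|il] := eqVneq i l; first by rewrite !dfwithin.
by rewrite !dfwithout.
Qed.

End Mword_update.

Section Weighted_shifts.
Context {R : realType} {k : nat} {n : 'I_k -> nat}.
Variable a : forall i : 'I_k, seq 'I_(n i) -> R.
Variable m : 'I_k -> nat.
Hypothesis a_ge0 : forall i s, 0 <= @a i s.
Hypothesis a_gen : forall i j, 0 < @a i [:: j].
Implicit Types (u v w : mword n).

Definition wcoef i (s : seq 'I_(n i)) : R := bcoef (@a i) (m i) s.

Definition wprod w : R := \prod_(i < k) wcoef (w i).

Lemma wcoef_gt0 i (s : seq 'I_(n i)) : 0 < wcoef s.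
Proof. exact: bcoef_gt0. Qed.

Lemma wprod_gt0 w : 0 < wprod w.
Proof. by apply: prodr_gt0 => i _; exact: wcoef_gt0. Qed.

Definition rsqrt (x : R) : R[i] := (Num.sqrt x)%:C.

Lemma rsqrtM x y : 0 <= x -> rsqrt (x * y) = rsqrt x * rsqrt y.
Proof. by move=> x0; rewrite /rsqrt sqrtrM// rmorphM. Qed.

Lemma sqmod_rsqrt x : 0 <= x -> sqmod (rsqrt x) = x.
Proof. by move=> x0; rewrite /sqmod/= expr0n/= addr0 sqr_sqrtr. Qed.

(** The multiword that the shift sends to [v], if any. *)
Definition shift_pre i (j : 'I_(n i)) v : option (mword n) :=
  if v i is j' :: s then if j' == j then Some (mupd v s) else None else None.

Lemma shift_preP i (j : 'I_(n i)) v w :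
  shift_pre j v = Some w <-> v = mupd w (j :: w i).
Proof.
rewrite /shift_pre; split=> [|->].
  case E : (v i) => [//|j' s]; case: eqP => // j'j [<-].
  by rewrite mupd_mupd mupdE -j'j -E mupd_id.
by rewrite mupdE eqxx mupd_mupd mupd_id.
Qed.

Definition shift_coef i (j : 'I_(n i)) v : R[i] :=
  if shift_pre j v is Some w then rsqrt (wcoef (w i) / wcoef (j :: w i)) else 0.

Lemma shift_coef_le i (j : 'I_(n i)) v :
  sqmod (shift_coef j v) <= (@a i [:: j])^-1.
Proof.
rewrite /shift_coef; case: shift_pre => [w|]; last first.
  by rewrite /sqmod/= expr0n/= addr0 invr_ge0 ltW.
rewrite sqmod_rsqrt ?divr_ge0 ?(ltW (wcoef_gt0 _))//.
rewrite ler_pdivrMr ?wcoef_gt0// ler_pdivlMl//.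
exact: bcoef_cons_ge.
Qed.

(** [Wop] selects an operator by its values on the basis; the weighted partial
    shift shows that there is one. *)
Lemma WopE i (j : 'I_(n i)) w : Wop a m j (l2_basis w) =
  rsqrt (wcoef (w i) / wcoef (j :: w i)) *: (l2_basis (mupd w (j :: w i)) : Fock).
Proof.
have [T TE] : exists T : bop (l2 R (mword n)), forall x v,
    T x v = if shift_pre j v is Some w then shift_coef j v * x w else 0.
  apply: (@partial_shift_exists _ _ (shift_pre j) (shift_coef j) (@a i [:: j])^-1).
  - by move=> v1 v2 w' /shift_preP -> /shift_preP ->.
  - exact: shift_coef_le.
  - by rewrite invr_ge0 ltW.
have -> := @xgetPex _ 0 [set T : bop Fock | forall w : mword n,
    T (l2_basis w) =
      (Num.sqrt (bcoef (a (i := i)) (m i) (w i) /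
                 bcoef (a (i := i)) (m i) (j :: w i)))%:C
      *: (l2_basis (mword_mul (mword_gen j) w) : Fock)].
  by rewrite mword_mul_gen.
exists T => {}w; apply: l2P => v; rewrite TE l2_coordZ mword_mul_gen.
rewrite /shift_coef l2_basisE; case E : shift_pre => [w'|].
  move/shift_preP : E => ->; rewrite l2_basisE.
  have [->|ww'] := eqVneq w' w; first by rewrite eqxx.
  rewrite (_ : (mupd w' _ == _) = false) ?mulr0//; apply/eqP => E.
  have : shift_pre j (mupd w (j :: w i)) = Some w by exact/shift_preP.
  have : shift_pre j (mupd w' (j :: w' i)) = Some w' by exact/shift_preP.
  by rewrite E => -> [/eqP]; rewrite (negPf ww').
case: eqP => [vE|]; last by rewrite mulr0.
by move/shift_preP : vE; rewrite E.
Qed.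

Lemma prod_Wop_letter i (s : seq 'I_(n i)) w :
  (\prod_(j <- s) Wop a m j) (l2_basis w) =
  rsqrt (wcoef (w i) / wcoef (s ++ w i)) *: (l2_basis (mupd w (s ++ w i)) : Fock).
Proof.
elim: s => [|j s IH].
  rewrite big_nil bop_oneE/= mupd_id divff ?gt_eqF ?wcoef_gt0//.
  by rewrite /rsqrt sqrtr1 scale1r.
rewrite big_cons bop_mulE IH bopZ WopE mupdE mupd_mupd scalerA.
rewrite -rsqrtM ?divr_ge0 ?(ltW (wcoef_gt0 _))//.
congr (rsqrt _ *: _); rewrite mulrA mulfVK// gt_eqF//; exact: wcoef_gt0.
Qed.

Definition mcat_on (s : seq 'I_k) u w : mword n :=
  finfun (fun i => if i \in s then u i ++ w i else w i).

Lemma prod_Wop_seq (s : seq 'I_k) u w : uniq s ->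
  (\prod_(i <- s) \prod_(j <- u i) Wop a m j) (l2_basis w) =
  rsqrt (\prod_(i <- s) (wcoef (w i) / wcoef (u i ++ w i))) *:
    (l2_basis (mcat_on s u w) : Fock).
Proof.
elim: s => [|i s IH]/= => [_|/andP[si us]].
  rewrite !big_nil bop_oneE /rsqrt sqrtr1 scale1r; congr l2_basis.
  by apply/ffunP => i; rewrite ffunE.
rewrite !big_cons bop_mulE IH// bopZ prod_Wop_letter scalerA mulrC -rsqrtM; last first.
  by rewrite divr_ge0 ?(ltW (wcoef_gt0 _)).
have E : mcat_on s u w i = w i by rewrite ffunE (negPf si).
rewrite E; congr (_ *: l2_basis _); apply/ffunP => l.
have [<-|il] := eqVneq i l; first by rewrite mupdE ffunE mem_head.
by rewrite mupd_out// !ffunE inE eq_sym (negPf il).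
Qed.

Local Notation Wword u := (mword_prod (Wop a m) u).

(** The weights of successive shifts telescope to one quotient that depends only
    on the two ends. Hence W_u W_v = W_(uv) on the basis, which contains the
    commutation of shifts on different tensor factors. *)
Lemma WwordE u w : Wword u (l2_basis w) =
  rsqrt (wprod w / wprod (mword_mul u w)) *: (l2_basis (mword_mul u w) : Fock).
Proof.
rewrite /mword_prod prod_Wop_seq ?index_enum_uniq//.
rewrite prodf_div; congr (rsqrt (_ / _) *: l2_basis _).
  by apply: eq_bigr => i _; rewrite /mword_mul ffunE.
by apply/ffunP => i; rewrite !ffunE mem_index_enum.
Qed.

Lemma Wword_mul u v : Wword (mword_mul u v) = Wword u * Wword v.
Proof.
apply: bop_basis_ext => w; rewrite bop_mulE !WwordE bopZ WwordE scalerA.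
rewrite mword_mulA -rsqrtM ?divr_ge0 ?(ltW (wprod_gt0 _))// mulrA mulfVK//.
by rewrite gt_eqF// wprod_gt0.
Qed.

Lemma Wop_gen i (j : 'I_(n i)) : Wop a m j = Wword (mword_gen j).
Proof.
apply: bop_basis_ext => w; rewrite WopE WwordE mword_mul_gen.
congr (rsqrt _ *: _); rewrite /wprod (bigD1 i)// [X in _ = _ / X](bigD1 i)//.
rewrite mupdE invfM mulrACA -prodf_div big1 ?mulr1// => l il.
by rewrite mupd_out 1?eq_sym// divff// gt_eqF// wcoef_gt0.
Qed.

Section Ideal.
Variable Q : set (ncpoly R n).
Hypothesis Q_ideal : left_ideal Q.

Lemma MQ_subspace : subspace_set (MQ a m Q).
Proof. exact: closed_span_subspace. Qed.

Lemma MQ_closed : closed (MQ a m Q).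
Proof. exact: closed_span_closed. Qed.

Lemma MQ_poly q x : Q q -> MQ a m Q (poly_op (Wop a m) q x).
Proof. by move=> Qq; apply: sub_closed_span; exists q => //; exists x. Qed.

(** A left ideal is stable under left multiplication by monomials. *)
Lemma MQ_invariant u x : MQ a m Q x -> MQ a m Q (Wword u x).
Proof.
move: x; apply: closed_span_min.
- split=> [|c x y hx hy] /=; first by rewrite bop0; exact: MQ_subspace.1.
  by rewrite bop_linear; apply: MQ_subspace.2.
- exact: (closed_bop_preimage (T := Wword u) MQ_closed).
- move=> _ [q Qq [x ->]] /=.
  rewrite -poly_opU -bop_mulE -(poly_opM Wword_mul); apply: MQ_poly.
  by case: Q_ideal => _ _; exact.
Qed.

Lemma MQ_invariant_gen i (j : 'I_(n i)) x : MQ a m Q x -> MQ a m Q (Wop a m j x).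
Proof. by rewrite Wop_gen; exact: MQ_invariant. Qed.

Local Notation cpr := (compress MQ_subspace MQ_closed).

Lemma Sop_compress i (j : 'I_(n i)) : Sop a m Q j = cpr (Wop a m j).
Proof.
apply: val_inj; rewrite /Sop val_insubd.
rewrite ifT//; exact: (compress_subproof MQ_subspace MQ_closed (Wop a m j)).
Qed.

Local Notation Sword u := (mword_prod (Sop a m Q) u).

(** M_Q being invariant, compressing is multiplicative on the W_u. *)
Lemma Sword_compress u : Sword u = cpr (Wword u).
Proof.
pose P (S : bop (NQ a m Q)) (T : bop (Fock (R := R) (n := n))) :=
  S = cpr T /\ forall x, MQ a m Q x -> MQ a m Q (T x).
suff [] : P (Sword u) (Wword u) by [].
have P1 : P 1 1 by split => //; rewrite compress1.
have PM S1 T1 S2 T2 : P S1 T1 -> P S2 T2 -> P (S1 * S2) (T1 * T2).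
  move=> [-> h1] [-> h2]; split; first by rewrite compressM.
  by move=> x /h2 /h1.
rewrite /mword_prod; apply: (big_ind2 P) => // i _; apply: (big_ind2 P) => // j _.
by split; [exact: Sop_compress|exact: MQ_invariant_gen].
Qed.

Lemma Sword_mul u v : Sword (mword_mul u v) = Sword u * Sword v.
Proof.
by rewrite !Sword_compress Wword_mul compressM//; exact: MQ_invariant.
Qed.

(** Hence g(S) is the compression of g(W): it vanishes for g in the ideal, whose
    range under W is in M_Q, and is dominated in norm by g(W). *)
Lemma poly_op_Scompress p : poly_op (Sop a m Q) p = cpr (poly_op (Wop a m) p).
Proof.
have c0 : cpr 0 = 0.
  by have := compressZ MQ_subspace MQ_closed 0 0; rewrite !scale0r.
rewrite /poly_op (big_morph _ (compressD MQ_subspace MQ_closed) c0).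
by apply: eq_bigr => w _; rewrite compressZ Sword_compress.
Qed.

Lemma Sop_gen i (j : 'I_(n i)) : Sop a m Q j = Sword (mword_gen j).
Proof. by rewrite Sword_compress Sop_compress Wop_gen. Qed.

Lemma poly_op_S_eq0 q : Q q -> poly_op (Sop a m Q) q = 0.
Proof.
move=> Qq; rewrite poly_op_Scompress; apply: bop_ext => x; rewrite compressE.
transitivity (0 : NQ a m Q); last by [].
have Mx := MQ_poly (ocompl_val x) Qq.
exact: oproj_orth Mx.
Qed.

End Ideal.

End Weighted_shifts.

(** * Contractivity of point evaluations inside the domain *)

Section Product_sums.
Context {R : realType} {k : nat} {n : 'I_k -> nat}.

Lemma sum_uniq_le (T : finType) (s : seq T) (H : T -> R) : uniq s ->
  (forall x, 0 <= H x) -> \sum_(x <- s) H x <= \sum_x H x.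
Proof.
move=> us H0; rewrite big_uniq//= [leRHS](bigID [in s])/= lerDl.
exact: sumr_ge0.
Qed.

Lemma prod_sum_fprod (T : 'I_k -> finType) (F : forall i, T i -> R) :
  \prod_(i < k) \sum_(t : T i) F i t =
  \sum_(g : fprod T) \prod_(i < k) F i (g i).
Proof.
under eq_bigr do rewrite (big_tag (fun i t => F i t)).
rewrite bigA_distr_big_dep.
pose P i : {ffun T i -> R} := [ffun t => F i t].
transitivity (\sum_(g : fprod T) \prod_(i in 'I_k) P i (g i)).
  rewrite (@big_fprod _ _ _ _ _ _ _ P); apply: eq_big => // g _; apply: eq_bigr => i _.
  rewrite /untag; case: eqP => // p; by rewrite ffunE.
by apply: eq_bigr => g _; apply: eq_bigr => i _; rewrite ffunE.
Qed.

(** A finite set of multiwords lies in a product of finite sets of words, over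
    which the sum of a product is the product of the sums. *)
Lemma sum_mword_le (F : forall i, seq 'I_(n i) -> R) (K : 'I_k -> R)
    (A : {fset mword n}) :
  (forall i s, 0 <= F i s) -> (forall i N, bsum N (F i) <= K i) ->
  \sum_(w <- A) \prod_(i < k) F i (w i) <= \prod_(i < k) K i.
Proof.
move=> F0 FK.
pose N := \max_(w <- A) \max_(i < k) size (w i).
have wN w i : w \in A -> (size (w i) <= N)%N.
  move=> wA; apply: (@leq_trans (\max_(i < k) size (w i))%N).
    exact: (leq_bigmax (F := fun i => size (w i))).
  by rewrite /N (big_fsetD1 w)//= leq_maxl.
pose T i : finType := N.-bseq 'I_(n i).
pose e (w : mword n) : fprod T := [fprod i => insub_bseq N (w i)].
have eE w i : w \in A -> e w i = w i :> seq _.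
  by move=> wA; rewrite /e fprodE /= /insub_bseq insubdK// ; exact: wN.
apply: (@le_trans _ _ (\prod_(i < k) \sum_(t : T i) F i t)); last first.
  apply: ler_prod => i _; apply/andP; split; first exact: sumr_ge0.
  by rewrite bsum_bseq.
rewrite prod_sum_fprod.
rewrite (_ : \sum_(w <- A) _ =
    \sum_(g <- map e A) \prod_(i < k) F i (g i)); last first.
  rewrite big_map; apply: eq_big_seq => w wA; apply: eq_bigr => i _.
  by rewrite eE.
apply: sum_uniq_le; last by move=> g; apply: prodr_ge0 => i _.
rewrite map_inj_in_uniq ?fset_uniq// => v w vA wA evw.
by apply/ffunP => i; rewrite -eE// evw eE.
Qed.

End Product_sums.

Section Evaluation.
Context {R : realType} {k : nat} {n : 'I_k -> nat}.
Variable z : forall i, 'I_(n i) -> R[i].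

Lemma mword_prodM (u v : mword n) :
  mword_prod z (mword_mul u v) = mword_prod z u * mword_prod z v.
Proof.
rewrite /mword_prod -big_split/=; apply: eq_bigr => i _.
by rewrite ffunE big_cat.
Qed.

Lemma poly_evalM (p q : ncpoly R n) :
  poly_eval z (p * q) = poly_eval z p * poly_eval z q.
Proof.
apply: (@poly_mapM R k n R[i]^o (fun x y => x * y) (mword_prod z)).
- by move=> x y t; exact: mulrDl.
- by move=> x y t; exact: mulrDr.
- by move=> c x y; rewrite -[LHS]/(c * x * y) -mulrA.
- by move=> c x y; rewrite -[LHS]/(y * (c * x)) mulrCA.
- exact: mword_prodM.
Qed.

Lemma poly_evalD (p q : ncpoly R n) :
  poly_eval z (p + q) = poly_eval z p + poly_eval z q.
Proof. exact: (@poly_mapD R k n R[i]^o (mword_prod z)). Qed.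

Lemma poly_eval0 : poly_eval z (0 : ncpoly R n) = 0.
Proof. exact: (@poly_map0 R k n R[i]^o (mword_prod z)). Qed.

Lemma poly_evalZ (c : R[i]) (p : ncpoly R n) :
  poly_eval z (c *: p) = c * poly_eval z p.
Proof. exact: (@poly_mapZ R k n R[i]^o (mword_prod z)). Qed.

Lemma poly_evalU (c : R[i]) w : poly_eval z (mkmalgU w c) = c * mword_prod z w.
Proof. exact: (@poly_mapU R k n R[i]^o (mword_prod z)). Qed.

End Evaluation.

Section Kernel.
Context {R : realType} {k : nat} {n : 'I_k -> nat}.
Variable a : forall i : 'I_k, seq 'I_(n i) -> R.
Variable m : 'I_k -> nat.
Hypothesis a_ge0 : forall i s, 0 <= @a i s.
Hypothesis a_gen : forall i j, 0 < @a i [:: j].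
Hypothesis m_gt0 : forall i, (0 < m i)%N.
Variable z : forall i, 'I_(n i) -> R[i].
Variable r : 'I_k -> R.
Hypothesis r_ge0 : forall i, 0 <= r i.
Hypothesis r_lt1 : forall i, r i < 1.
Local Notation weval s := (\prod_(j <- s) z j).
Hypothesis z_le : forall i N,
  \sum_(l < N) lsum l.+1 (fun s => @a i s * sqmod (weval s)) <= r i.
Local Notation "'[ x , y ]" := (l2_inner x y).
Local Notation wprod := (wprod a m).
Local Notation H := (Fock (R := R) (n := n)).

(** The coefficients of the reproducing kernel
    sum_w sqrt(b_w) conj(z_w) e_w at [z]. *)
Definition kernel_fun (w : mword n) : R[i] :=
  rsqrt (wprod w) * (mword_prod z w)^*.

Lemma sqmod1 : sqmod (1 : R[i]) = 1.
Proof. by rewrite /sqmod/= expr0n/= addr0 expr1n. Qed.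

Lemma sqmod_conj (c : R[i]) : sqmod c^* = sqmod c.
Proof. by case: c => x y; rewrite /sqmod/= sqrrN. Qed.

Lemma sqmod_kernel w : sqmod (kernel_fun w) =
  \prod_(i < k) (wcoef a m (w i) * sqmod (weval (w i))).
Proof.
rewrite sqmodM sqmod_rsqrt ?(ltW (wprod_gt0 _ _ _ _))// sqmod_conj.
rewrite big_split/=; congr (_ * _).
by rewrite /mword_prod (big_morph _ (@sqmodM R) sqmod1).
Qed.

Lemma kernel_l2 : kernel_fun \in l2_pred.
Proof.
apply: (@l2_predI _ _ _ (\prod_(i < k) ((1 - r i)^-1) ^+ m i)) => A.
under eq_bigr do rewrite sqmod_kernel.
apply: (@sum_mword_le _ _ _ (fun i s => wcoef a m s * sqmod (weval s))).
  by move=> i s; rewrite mulr_ge0 ?sqmod_ge0 ?(ltW (wcoef_gt0 _ _ _ _)).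
move=> i N.
apply: (@bsum_bcoef_le _ _ _ (fun s => sqmod (weval s))) => //.
- by move=> s; exact: sqmod_ge0.
- by rewrite big_nil sqmod1.
- by move=> s t; rewrite big_cat sqmodM.
Qed.

Definition kernel : H := L2 kernel_l2.

Lemma inner_basis_kernel w : '[l2_basis w, kernel] = rsqrt (wprod w) * mword_prod z w.
Proof.
rewrite l2_innerC l2_inner_basis -[l2_fun _ _]/(kernel_fun w) /kernel_fun.
rewrite /rsqrt; case: (mword_prod z w) => x y.
by apply/eqP; rewrite eq_complex/=; apply/andP; split; apply/eqP; ring.
Qed.

(** The kernel is a joint eigenvector of the adjoint shifts. Both sides are
    linear and continuous in [x], and on a basis vector the weights of the shift
    and of the kernel cancel. *)
Lemma inner_Wword_kernel u (x : H) :
  '[mword_prod (Wop a m) u x, kernel] = mword_prod z u * '[x, kernel].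
Proof.
pose F (x : H) : R[i] :=
  '[mword_prod (Wop a m) u x, kernel] - mword_prod z u * '[x, kernel].
have FL c x1 x2 : F (c *: x1 + x2) = c * F x1 + F x2.
  rewrite /F bop_linear !l2_inner_linear; ring.
have FB x1 x2 : F (x1 - x2) = F x1 - F x2.
  by rewrite -[x1 - x2]addrC -scaleN1r FL mulN1r addrC.
suff : F x = 0 by move/eqP; rewrite subr_eq0 => /eqP.
apply: (l2_closed_ind (M := [set x | F x = 0])) => [||w].
- split=> [|c x1 x2 /= h1 h2]; last by rewrite FL h1 h2 mulr0 addr0.
  by rewrite /= /F bop0 !l2_inner0l mulr0 subrr.
- apply: (@closed_preimage_lip R H R[i] F
    (nrm (mword_prod (Wop a m) u) * nrm kernel + nrm (mword_prod z u) * nrm kernel)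
    [set 0]); last exact: closed_eq0.
  move=> x1 x2; rewrite -FB (le_trans (nrmD _ _))// nrmN mulrDl lerD//.
    by rewrite (le_trans (l2_CS _ _))// mulrAC ler_wpM2r ?nrm_ge0// nrm_bop.
  rewrite nrmM -mulrA ler_wpM2l ?nrm_ge0// mulrC; exact: l2_CS.
- rewrite /= /F WwordE// l2_innerZl !inner_basis_kernel mword_prodM.
  rewrite mulrA -rsqrtM; last by rewrite divr_ge0 ?(ltW (wprod_gt0 _ _ _ _)).
  rewrite mulfVK ?gt_eqF ?wprod_gt0//; ring.
Qed.

Lemma inner_poly_op_kernel p (x : H) :
  '[poly_op (Wop a m) p x, kernel] = poly_eval z p * '[x, kernel].
Proof.
rewrite /poly_op bop_sumE.
rewrite (big_morph (fun y => '[y, kernel]) (fun x y => l2_innerDl x y kernel)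
  (l2_inner0l kernel)).
rewrite /poly_eval mulr_suml; apply: eq_bigr => w _.
by rewrite bop_scaleE l2_innerZl inner_Wword_kernel mulrA.
Qed.

Variable Q : set (ncpoly R n).
Hypothesis Q_ideal : left_ideal Q.
Hypothesis zQ : forall q, Q q -> poly_eval z q = 0.

(** By the eigenvector property, <g(W) x, kernel> = g(z) <x, kernel> vanishes
    when g is in the ideal. *)
Lemma kernel_NQ : kernel \in ocompl_pred (MQ a m Q).
Proof.
apply/ocompl_predP; apply: closed_span_min.
- split=> [|c x y /= hx hy]; first exact: l2_inner0r.
  by rewrite l2_innerDr l2_innerZr hx hy mulr0 addr0.
- apply: (@closed_preimage_lip R H R[i] (fun y => '[kernel, y]) (nrm kernel)
    [set 0]); last exact: closed_eq0.
  by move=> x y; rewrite -l2_innerBr l2_CS.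
- move=> _ [q Qq [x ->]] /=; rewrite l2_innerC inner_poly_op_kernel zQ// mul0r.
  by rewrite rmorph0.
Qed.

Lemma kernel_norm_gt0 : 0 < nrm kernel.
Proof.
rewrite lt_def nrm_ge0 andbT; apply/eqP => /nrm_eq0 k0.
have := inner_basis_kernel (mword_one n); rewrite k0 l2_inner0r => /esym/eqP.
rewrite mulf_eq0 => /orP[|]; apply/negP.
  by rewrite /rsqrt eq_complex/= eqxx andbT gt_eqF// sqrtr_gt0 wprod_gt0.
rewrite /mword_prod big1 ?oner_neq0// => i _.
by rewrite ffunE big_nil.
Qed.

(** Evaluation at a point of the open polydomain is given by the vector state
    of the kernel, an eigenvector of the adjoint shifts, hence contractive. *)
Lemma poly_eval_le_interior p : nrm (poly_eval z p) <= nrm (poly_op (Sop a m Q) p).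
Proof.
pose g : NQ a m Q := OCompl kernel_NQ.
have g0 : 0 < nrm g by exact: kernel_norm_gt0.
rewrite -(ler_pM2r (mulr_gt0 g0 g0)).
have <- : nrm '[ocompl_val (poly_op (Sop a m Q) p g), ocompl_val g] =
    nrm (poly_eval z p) * (nrm g * nrm g).
  rewrite poly_op_Scompress// compressE oproj_inner; last exact: MQ_closed.
    rewrite inner_poly_op_kernel l2_inner_norm nrmM nrm_real.
    by rewrite ger0_norm ?sqr_ge0// expr2.
  exact: MQ_subspace.
rewrite (le_trans (l2_CS _ _))// mulrA ler_wpM2r ?nrm_ge0//.
exact: (nrm_bop (poly_op (Sop a m Q) p) g).
Qed.

End Kernel.

(** * Row contractivity of the universal model *)

Section Aux.
Context {R : realType}.

Lemma ler_sum_subset (T : eqType) (s t : seq T) (F : T -> R) :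
  uniq s -> uniq t -> {subset s <= t} -> (forall x, 0 <= F x) ->
  \sum_(x <- s) F x <= \sum_(x <- t) F x.
Proof.
move=> us ut st F0; rewrite [leRHS](bigID [in s])/= -[leLHS]addr0 lerD//.
  rewrite -[leRHS]big_filter (perm_big [seq x <- t | x \in s])//.
  apply: uniq_perm => //; first exact: filter_uniq.
  by move=> x; rewrite mem_filter; case xs : (x \in s) => //=; rewrite st.
exact: sumr_ge0.
Qed.

Lemma sqmod_sum_CS (T : Type) (s : seq T) (p : T -> R) (q : T -> R[i]) :
  (forall x, 0 <= p x) ->
  sqmod (\sum_(x <- s) (p x)%:C * q x) <=
  (\sum_(x <- s) p x ^+ 2) * (\sum_(x <- s) sqmod (q x)).
Proof.
move=> p0; elim: s => [|x s IH].
  by rewrite !big_nil mul0r /sqmod/= expr0n/= addr0.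
rewrite !big_cons; move: IH.
set z := \sum_(_ <- _) _; set P := \sum_(_ <- _) _; set S := \sum_(_ <- _) _.
have P0 : 0 <= P by apply: sumr_ge0 => y _; exact: sqr_ge0.
have S0 : 0 <= S by apply: sumr_ge0 => y _; exact: sqmod_ge0.
have q0 := sqmod_ge0 (q x).
have pq : sqmod ((p x)%:C * q x) = p x ^+ 2 * sqmod (q x).
  by rewrite sqmodM /sqmod/= expr0n/= addr0.
move=> zPS; have [px|px] := eqVneq (p x) 0.
  rewrite px mul0r !add0r expr0n/= add0r; nra.
have {}px : 0 < p x by rewrite lt_def px p0.
have p2 : 0 < p x ^+ 2 by rewrite exprn_gt0.
have [PE|PE] := eqVneq P 0.
  have -> : z = 0.
    apply: nrm_eq0; apply/eqP; rewrite -sqrf_eq0 nrm_sqmod eq_le sqmod_ge0 andbT.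
    by rewrite (le_trans zPS)// PE mul0r.
  by rewrite addr0 PE addr0 pq ler_pM2l// lerDl.
have {}P0 : 0 < P by rewrite lt_def PE P0.
rewrite addrC (le_trans (sqmodD_weighted z _ P0 p2))// pq.
have -> : (p x ^+ 2 + P) * (sqmod (q x) + S) =
   (1 + p x ^+ 2 / P) * (P * S) + (1 + P / p x ^+ 2) * (p x ^+ 2 * sqmod (q x)).
  by field; rewrite !gt_eqF.
by rewrite lerD2r ler_wpM2l// addr_ge0// divr_ge0// ltW.
Qed.

End Aux.

Section Row_contraction.
Context {R : realType} {k : nat} {n : 'I_k -> nat}.
Variable a : forall i : 'I_k, seq 'I_(n i) -> R.
Variable m : 'I_k -> nat.
Hypothesis a_ge0 : forall i s, 0 <= @a i s.
Hypothesis a_gen : forall i j, 0 < @a i [:: j].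
Local Notation wcoef := (wcoef a m).
Local Notation wprod := (wprod a m).
Local Notation H := (Fock (R := R) (n := n)).
Variable i : 'I_k.
Implicit Types (alpha : seq 'I_(n i)) (v w : mword n).

Definition mword_at alpha : mword n := mupd (mword_one n) alpha.

Lemma mword_at_mul alpha w : mword_mul (mword_at alpha) w = mupd w (alpha ++ w i).
Proof.
apply/ffunP => l; rewrite ffunE.
have [<-|il] := eqVneq i l; first by rewrite !mupdE.
by rewrite !mupd_out// ffunE.
Qed.

Definition strip alpha v : option (mword n) :=
  if prefix alpha (v i) then Some (mupd v (drop (size alpha) (v i))) else None.

Lemma stripP alpha v w : strip alpha v = Some w <-> v = mupd w (alpha ++ w i).
Proof.
rewrite /strip; split=> [|->].
  case: ifP => // /prefixP[s vE] [<-]; rewrite mupd_mupd mupdE.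
  by rewrite vE drop_size_cat// -vE mupd_id.
by rewrite mupdE prefix_prefix drop_size_cat// mupd_mupd mupd_id.
Qed.

Lemma strip_inj alpha v1 v2 w :
  strip alpha v1 = Some w -> strip alpha v2 = Some w -> v1 = v2.
Proof. by move=> /stripP -> /stripP ->. Qed.

Lemma wprod_mupd w (s : seq 'I_(n i)) :
  wprod w / wprod (mupd w s) = wcoef (w i) / wcoef s.
Proof.
rewrite /wprod (bigD1 i)// [X in _ / X](bigD1 i)// mupdE.
rewrite invfM mulrACA -prodf_div big1 ?mulr1// => l il.
by rewrite mupd_out 1?eq_sym// divff// gt_eqF// wcoef_gt0.
Qed.

Lemma Wword_at_basis alpha w : mword_prod (Wop a m) (mword_at alpha) (l2_basis w) =
  rsqrt (wcoef (w i) / wcoef (alpha ++ w i)) *: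
    (l2_basis (mupd w (alpha ++ w i)) : H).
Proof. by rewrite WwordE// mword_at_mul wprod_mupd. Qed.

Lemma Wword_at_coord alpha (x : H) v :
  mword_prod (Wop a m) (mword_at alpha) x v =
  if strip alpha v is Some w then rsqrt (wcoef (w i) / wcoef (v i)) * x w else 0.
Proof.
set T := mword_prod _ _.
pose c v := if strip alpha v is Some w then
  rsqrt (wcoef (w i) / wcoef (v i)) else 0.
have [S SE] : exists S : bop (l2 R (mword n)), forall x v,
    S x v = if strip alpha v is Some w then c v * x w else 0.
  apply: (@partial_shift_exists _ _ (strip alpha) c (nrm T ^+ 2)).
  - exact: strip_inj.
  - move=> u; rewrite /c; case E : strip => [w|]; last first.
      by rewrite /sqmod/= expr0n/= addr0 sqr_ge0.
    rewrite -nrm_sqmod lerXn2r ?nnegrE ?nrm_ge0//.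
    have := nrm_bop T (l2_basis w : H); rewrite Wword_at_basis nrmZ.
    rewrite !l2_basis_norm !mulr1.
    by move/stripP : E => ->; rewrite mupdE.
  - exact: sqr_ge0.
have -> : T = S.
  apply: bop_basis_ext => w; rewrite Wword_at_basis; apply: l2P => u.
  rewrite SE l2_coordZ /c l2_basisE; case E : strip => [w'|].
    rewrite l2_basisE; have [ww'|ww'] := eqVneq w' w.
      by move/stripP : E; rewrite ww' => ->; rewrite eqxx mupdE.
    rewrite (_ : (u == _) = false) ?mulr0//; apply/eqP => uE.
    move: E; have /stripP -> : u = mupd w (alpha ++ w i) by [].
    by move=> [/esym/eqP]; rewrite (negPf ww').
  case: eqP => [uE|]; last by rewrite mulr0.
  by move/stripP : uE; rewrite E.
by rewrite SE /c; case: strip.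
Qed.

(** A prefix of [beta] is determined by its length, so the sum is part of the
    convolution in [front_conv_bcoef_le]. *)
Lemma prefix_conv_le (F : seq (seq 'I_(n i))) (beta : seq 'I_(n i)) :
  uniq F -> [::] \notin F ->
  \sum_(alpha <- F | prefix alpha beta)
    @a i alpha * wcoef (drop (size alpha) beta) <= wcoef beta.
Proof.
move=> uF nF; rewrite (le_trans _ (front_conv_bcoef_le (m i) beta (a_ge0 (i := i))))//.
rewrite /front_conv -(big_mkord xpredT (fun l =>
  @a i (take l.+1 beta) * bcoef (@a i) (m i) (drop l.+1 beta))).
pose s := [seq (size alpha).-1 | alpha <- F & prefix alpha beta].
have sP alpha : alpha \in F -> prefix alpha beta ->
    (0 < size alpha)%N /\ alpha = take (size alpha) beta.
  move=> aF; rewrite prefixE => /eqP aE; split=> //.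
  by case: alpha aF {aE} => //; rewrite (negPf nF).
rewrite (_ : \sum_(alpha <- F | _) _ =
  \sum_(l <- s) @a i (take l.+1 beta) * bcoef (@a i) (m i) (drop l.+1 beta)).
  apply: ler_sum_subset => [||l|l]; last by rewrite mulr_ge0 ?bcoef_ge0.
  - rewrite map_inj_in_uniq ?filter_uniq// => u v.
    rewrite !mem_filter => /andP[pu uF'] /andP[pv vF] E.
    have [u0 ->] := sP _ uF' pu; have [v0 ->] := sP _ vF pv.
    by rewrite -(prednK u0) E prednK.
  - exact: iota_uniq.
  - move=> /mapP[u]; rewrite mem_filter => /andP[pu uF'] ->.
    rewrite mem_index_iota /=; have [u0 _] := sP _ uF' pu.
    by rewrite prednK//; exact: size_prefix.
rewrite big_map big_filter [LHS]big_seq_cond [RHS]big_seq_cond.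
apply: eq_bigr => alpha /andP[aF pa]; have [a0 aE] := sP _ aF pa.
by rewrite prednK// -aE.
Qed.

(** The row operator with entries sqrt(a_alpha) W_alpha is a contraction. On each
    coordinate [v] this is the Cauchy-Schwarz inequality for the weights
    a_alpha b_gamma / b_beta, where beta = alpha gamma is the [i]-th word of [v]:
    their sum is at most 1 by [prefix_conv_le]. *)
Lemma row_contraction (F : seq (seq 'I_(n i))) (lam : seq 'I_(n i) -> R[i]) :
  uniq F -> [::] \notin F ->
  nrm (\sum_(alpha <- F) ((@a i alpha)%:C * lam alpha) *:
        mword_prod (Wop a m) (mword_at alpha)) <=
  Num.sqrt (\sum_(alpha <- F) @a i alpha * sqmod (lam alpha)).
Proof.
move=> uF nF; set L := \sum_(_ <- _) _ * _.
have L0 : 0 <= L by apply: sumr_ge0 => alpha _; rewrite mulr_ge0 ?sqmod_ge0.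
apply: nrm_bop_le => [|x]; first exact: sqrtr_ge0.
apply: l2_norm_le => [|A]; first by rewrite mulr_ge0 ?sqrtr_ge0 ?nrm_ge0.
rewrite exprMn sqr_sqrtr//.
(* The term of index [alpha] at the coordinate [v] is [p v alpha * t v alpha]. *)
pose t v alpha : R[i] := if strip alpha v is Some w then
   rsqrt (@a i alpha) * lam alpha * x w else 0.
pose p v alpha : R := if strip alpha v is Some w then
   Num.sqrt (@a i alpha * wcoef (w i) / wcoef (v i)) else 0.
have p0 v alpha : 0 <= p v alpha by rewrite /p; case: strip => // w; exact: sqrtr_ge0.
apply: (@le_trans _ _ (\sum_(v <- A) \sum_(alpha <- F) sqmod (t v alpha))).
  apply: ler_sum => v _; rewrite bop_sumE l2_coord_sum.
  rewrite (eq_bigr (fun alpha => (p v alpha)%:C * t v alpha)) => [|alpha _]; last first.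
    rewrite bop_scaleE l2_coordZ Wword_at_coord /p /t.
    case E : strip => [w|]; last by rewrite !mulr0.
    have -> : (@a i alpha)%:C = rsqrt (@a i alpha) * rsqrt (@a i alpha).
      by rewrite -rsqrtM// -expr2 /rsqrt sqrtr_sqr ger0_norm.
    rewrite -/(rsqrt _) -[_ * _ / _]mulrA [in RHS]rsqrtM//; ring.
  rewrite (le_trans (sqmod_sum_CS _ _ (p0 v)))// ler_piMl//.
    by apply: sumr_ge0 => alpha _; exact: sqmod_ge0.
  rewrite (eq_bigr (fun alpha => if prefix alpha (v i) then
      @a i alpha * wcoef (drop (size alpha) (v i)) / wcoef (v i) else 0)); last first.
    move=> alpha _; rewrite /p /strip; case: ifP => _; last by rewrite expr0n.
    by rewrite sqr_sqrtr ?mupdE// divr_ge0 ?mulr_ge0 ?(ltW (wcoef_gt0 _ _ _ _)).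
  rewrite -big_mkcond/= -mulr_suml ler_pdivrMr ?wcoef_gt0// mul1r.
  exact: prefix_conv_le.
rewrite exchange_big/= /L mulr_suml; apply: ler_sum => alpha _.
apply: le_trans (ler_wpM2l _ (sum_partial_inj_le x A (@strip_inj alpha))); last first.
  by rewrite mulr_ge0 ?sqmod_ge0.
rewrite mulr_sumr; apply: ler_sum => v _; rewrite /t.
case: strip => [w|]; last by rewrite /sqmod/= expr0n/= addr0 mulr0.
by rewrite !sqmodM sqmod_rsqrt.
Qed.

End Row_contraction.

(** * Contractivity of point evaluations on the whole variety *)

Section Left_ideals.
Context {R : realType} {k : nat} {n : 'I_k -> nat}.
Implicit Types (G : set (ncpoly R n)) (z : forall i, 'I_(n i) -> R[i]).

Lemma left_ideal_generatedP G : left_ideal (left_ideal_generated G).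
Proof.
split=> [J [[]]//|p q hp hq J hJ|p q hq J hJ].
  by have [[_ JD _] _] := hJ; apply: (JD); [exact: hp|exact: hq].
by have [[_ _ JM] _] := hJ; apply: (JM); exact: hq.
Qed.

Lemma poly_eval_ideal_eq0 G z : (forall g, G g -> poly_eval z g = 0) ->
  forall q, left_ideal_generated G q -> poly_eval z q = 0.
Proof.
move=> G0; apply: smallest_sub => //; split=> [|p q /= hp hq|p q /= hq].
- exact: poly_eval0.
- by rewrite poly_evalD hp hq addr0.
- by rewrite poly_evalM hq mulr0.
Qed.

Definition dilate (t : R) z : forall i, 'I_(n i) -> R[i] :=
  fun i j => t%:C * z i j.

Lemma prod_dilate t z i (s : seq 'I_(n i)) :
  \prod_(j <- s) dilate t z j = (t ^+ size s)%:C * \prod_(j <- s) z i j.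
Proof.
elim: s => [|j s IH]; first by rewrite !big_nil expr0 mul1r.
by rewrite !big_cons IH exprS rmorphM /= /dilate mulrACA.
Qed.

Lemma mword_prod_dilate t z (w : mword n) :
  mword_prod (dilate t z) w = (t ^+ mword_length w)%:C * mword_prod z w.
Proof.
rewrite /mword_prod; under eq_bigr do rewrite prod_dilate.
rewrite big_split/=; congr (_ * _); rewrite -rmorph_prod/= prodrXr.
by congr (_ ^+ _)%:C; rewrite /mword_length big_mkord.
Qed.

(** A homogeneous polynomial is multiplied by a power of [t] under dilation,
    hence keeps its zeros. *)
Lemma poly_eval_dilate_homog t z g : homogeneous g ->
  poly_eval z g = 0 -> poly_eval (dilate t z) g = 0.
Proof.
move=> [d gd] g0; rewrite /poly_eval.
rewrite (eq_big_seq (fun w => (t ^+ d)%:C * (mcoeff w g * mword_prod z w))).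
  by rewrite -mulr_sumr -/(poly_eval z g) g0 mulr0.
by move=> w /gd wd; rewrite mword_prod_dilate wd mulrCA.
Qed.

Lemma bernoulli_exp (t : R) d : 0 <= t -> t <= 1 -> 1 - t ^+ d <= d%:R * (1 - t).
Proof.
move=> t0 t1; elim: d => [|d IH]; first by rewrite expr0 subrr mul0r.
have td : t ^+ d <= 1 by rewrite exprn_ile1.
have td0 : 0 <= t ^+ d by rewrite exprn_ge0.
rewrite exprSr -natr1; nra.
Qed.

(** A Lipschitz form of the continuity of the dilation at [t = 1]. *)
Lemma poly_eval_dilate_near z p : exists2 C : R, 0 <= C & forall t,
  0 <= t -> t <= 1 ->
  nrm (poly_eval z p - poly_eval (dilate t z) p) <= C * (1 - t).
Proof.
exists (\sum_(w <- msupp p)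
    nrm (mcoeff w p * mword_prod z w) * (mword_length w)%:R).
  by apply: sumr_ge0 => w _; rewrite mulr_ge0 ?nrm_ge0 ?ler0n.
move=> t t0 t1; rewrite /poly_eval -sumrB mulr_suml.
rewrite (le_trans (nrm_sum _ _ _))//; apply: ler_sum => w _.
rewrite mword_prod_dilate mulrCA -{1}[_ * mword_prod z w]mul1r -mulrBl [leLHS]nrmM.
rewrite mulrC -mulrA ler_wpM2l ?nrm_ge0//.
rewrite -(rmorph1 (real_complex R)) -rmorphB nrm_real ger0_norm.
  exact: bernoulli_exp.
by rewrite subr_ge0 exprn_ile1.
Qed.

End Left_ideals.

Section Variety_points.
Context {R : realType} {k : nat} {n : 'I_k -> nat}.
Variable a : forall i : 'I_k, seq 'I_(n i) -> R.
Variable m : 'I_k -> nat.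
Hypothesis a_ge0 : forall i s, 0 <= @a i s.
Hypothesis a_gen : forall i j, 0 < @a i [:: j].
Hypothesis m_gt0 : forall i, (0 < m i)%N.

Lemma lsum_le_Phi i (z : Cspace (R := R) (n := n)) N : (Phi_one a i z < +oo)%E ->
  \sum_(l < N) lsum l.+1 (fun s => @a i s * sqmod (\prod_(j <- s) entry z j)) <=
  fine (Phi_one a i z).
Proof.
pose F s := @a i s * sqmod (\prod_(j <- s) entry z j); move=> zf.
have F0 s : 0 <= F s by rewrite mulr_ge0 ?sqmod_ge0.
have Pf : Phi_one a i z \is a fin_num.
  by rewrite ge0_fin_numE//; apply: esum_ge0 => s _; rewrite lee_fin; exact: F0.
pose F' s := if (1 <= size s)%N then F s else 0.
rewrite (_ : \sum_(l < N) _ = bsum N F'); last first.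
  rewrite /bsum big_ord_recl (_ : lsum _ F' = 0) ?add0r//.
rewrite -bsum_bseq -lee_fin fineK// /Phi_one esum_mkcond.
pose L : seq (seq 'I_(n i)) := [seq val t | t : N.-bseq 'I_(n i)].
pose A := [fset s in L]%fset.
rewrite (_ : \sum_(t : N.-bseq 'I_(n i)) F' t = \sum_(s <- A) F' s); last first.
  rewrite (perm_big L)/=; last first.
    apply: uniq_perm => [||s]; [exact: fset_uniq| |by rewrite inE].
    by rewrite /L /image_mem map_inj_uniq ?enum_uniq//; exact: val_inj.
  by rewrite /L /image_mem big_map big_enum.
apply: le_trans (fin_le_esum F' A) _; apply: le_esum => s _.
rewrite /F'; case: ifPn => s1; last first.
  by case: ifP => _; [rewrite lee_fin; exact: F0|exact: lexx].
by rewrite ifT// inE.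
Qed.

Variables (G : set (ncpoly R n)).
Hypothesis G_homog : forall g, G g -> homogeneous g.
Local Notation Q := (left_ideal_generated G).

(** Among the exponents allowed in the definition of the polydomain are those
    that single out one factor. *)
Lemma variety_PhiP (z : Cspace (R := R) (n := n)) : variety a m Q z ->
  forall i, (Phi_one a i z < +oo)%E /\ fine (Phi_one a i z) <= 1.
Proof.
move=> [[zf zp] _] i; split=> //.
have /zp : forall l, ((l == i) <= m l)%N by move=> l; case: eqP => [->|].
rewrite (bigD1 i)//= eqxx expr1 big1 ?mulr1 ?subr_ge0// => l /negPf ->.
by rewrite expr0.
Qed.

(** Points of the boundary are reached by dilating: homogeneity keeps the
    dilated point inside the variety. *)
Lemma poly_eval_le (z : Cspace (R := R) (n := n)) : variety a m Q z ->
  forall p, nrm (poly_eval (entry z) p) <= nrm (poly_op (Sop a m Q) p).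
Proof.
move=> zV p; have zP := variety_PhiP zV.
have [C C0 zC] := poly_eval_dilate_near (entry z) p.
apply/ler_addgt0Pr => e e0.
have C1 : 0 < C + 1 by lra.
pose d := Num.min (2^-1) (e / (C + 1)).
have d0 : 0 < d by rewrite lt_min invr_gt0 ltr0n divr_gt0.
have d1 : d <= 2^-1 by rewrite ge_min lexx.
have dC : C * d <= e.
  rewrite (@le_trans _ _ (C * (e / (C + 1))))//.
    by rewrite ler_wpM2l// ge_min lexx orbT.
  by rewrite mulrA ler_pdivrMr// mulrC; nra.
pose t := 1 - d; have t0 : 0 < t by rewrite /t; lra.
have t1 : t < 1 by rewrite /t; lra.
have := zC t (ltW t0) (ltW t1).
rewrite (_ : 1 - t = d) => [near|]; last by rewrite /t opprB addrC subrK.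
have : nrm (poly_eval (dilate t (entry z)) p) <= nrm (poly_op (Sop a m Q) p).
  apply: (@poly_eval_le_interior _ _ _ a m a_ge0 a_gen m_gt0 _ (fun=> t)) => //.
  - move=> i N; have [zf z1] := zP i.
    apply: (@le_trans _ _ (t * \sum_(l < N) lsum l.+1
        (fun s => @a i s * sqmod (\prod_(j <- s) entry z j)))).
      rewrite mulr_sumr; apply: ler_sum => l _; rewrite -lsumZ.
      apply: (@ler_lsum _ _ l.+1) => s sl; rewrite prod_dilate sqmodM.
      rewrite mulrCA mulrA [leRHS]mulrA.
      rewrite ler_wpM2r ?sqmod_ge0// ler_wpM2r//.
      rewrite /sqmod/= expr0n/= addr0 -exprM sl.
      by rewrite exprSr -[leRHS]mul1r ler_wpM2r ?(ltW t0)// exprn_ile1// ltW.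
    by rewrite ler_piMr ?(ltW t0)// (le_trans (lsum_le_Phi N zf)).
  - exact: left_ideal_generatedP.
  - apply: poly_eval_ideal_eq0 => g Gg; apply: poly_eval_dilate_homog.
      exact: G_homog.
    by case: zV => _; apply; exact: sub_gen_smallest.
move=> h; have := nrmD (poly_eval (entry z) p - poly_eval (dilate t (entry z)) p)
  (poly_eval (dilate t (entry z)) p).
rewrite subrK; lra.
Qed.

End Variety_points.

(** * Extending a point evaluation to the closed algebra *)

Section Mword_prod_generators.
Context {k : nat} {n : 'I_k -> nat}.

Lemma mword_prod_one (A : pzRingType) (X : forall i, 'I_(n i) -> A) :
  mword_prod X (mword_one n) = 1.
Proof. by rewrite /mword_prod big1// => i _; rewrite ffunE big_nil. Qed.

End Mword_prod_generators.

Section Generated_algebra.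
Context {R : realType} {k : nat} {n : 'I_k -> nat}.
Variable V : normedModType R[i].
Variable X : forall i, 'I_(n i) -> bop V.
Hypothesis X_gen : forall i j, @X i j = mword_prod X (mword_gen j).
Hypothesis X_mul : forall u v,
  mword_prod X (mword_mul u v) = mword_prod X u * mword_prod X v.
Local Notation polyX := (poly_op X).
Local Notation gens :=
  [set T | T = 1 \/ exists i : 'I_k, exists j : 'I_(n i), T = X j].
Local Notation alg := (closed_algebra_generated gens).
Implicit Types (S T : bop V) (p q : ncpoly R n).

Lemma bop_mul_dist S1 T1 S2 T2 (d : R) : d <= 1 ->
  nrm (S1 - T1) <= d -> nrm (S2 - T2) <= d ->
  nrm (S1 * S2 - T1 * T2) <= (nrm T1 + nrm T2 + 1) * d.
Proof.
move=> d1 h1 h2.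
have -> : S1 * S2 - T1 * T2 = (S1 - T1) * S2 + T1 * (S2 - T2).
  by rewrite mulrBl mulrBr subrKA.
rewrite (le_trans (nrmD _ _))//.
have := nrm_bopM (S1 - T1) S2; have := nrm_bopM T1 (S2 - T2).
have := nrmD (S2 - T2) T2; rewrite subrK.
have := nrm_ge0 T1; have := nrm_ge0 T2; have := nrm_ge0 S2.
have := nrm_ge0 (S1 - T1); have := nrm_ge0 (S2 - T2).
set x1 := nrm (S1 - T1) in h1 *; set x2 := nrm (S2 - T2) in h2 *.
set t1 := nrm T1; set t2 := nrm T2; set s2 := nrm S2 => *; nra.
Qed.

Lemma complex_mul_dist (x1 y1 x2 y2 : R[i]) (d : R) : d <= 1 ->
  nrm (x1 - y1) <= d -> nrm (x2 - y2) <= d ->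
  nrm (x1 * x2 - y1 * y2) <= (nrm y1 + nrm y2 + 1) * d.
Proof.
move=> d1 h1 h2.
have -> : x1 * x2 - y1 * y2 = (x1 - y1) * x2 + y1 * (x2 - y2) by ring.
rewrite (le_trans (nrmD _ _))// !nrmM.
have := nrmD (x2 - y2) y2; rewrite subrK.
have := nrm_ge0 y1; have := nrm_ge0 y2; have := nrm_ge0 x2.
have := nrm_ge0 (x1 - y1); have := nrm_ge0 (x2 - y2).
set u1 := nrm (x1 - y1) in h1 *; set u2 := nrm (x2 - y2) in h2 *.
set t1 := nrm y1; set t2 := nrm y2; set s2 := nrm x2 => *; nra.
Qed.

Lemma small_radius (K e : R) : 0 <= K -> 0 < e ->
  exists d : R, [/\ 0 < d, d <= 1 & K * d < e].
Proof.
move=> K0 e0; have K1 : 0 < K + 1 by lra.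
exists (Num.min 1 (e / (K + 1))); split.
- by rewrite lt_min ltr01 divr_gt0.
- by rewrite ge_min lexx.
- rewrite (@le_lt_trans _ _ (K * (e / (K + 1))))//.
    by rewrite ler_wpM2l// ge_min lexx orbT.
  by rewrite mulrA ltr_pdivrMr// mulrC; nra.
Qed.

Lemma alg_closed : closed alg.
Proof. by apply: closed_bigI => B [[_ cB] _]. Qed.

Lemma alg_subalgebra : subalgebra_set alg.
Proof.
split; [split=> [|c S T hS hT]|move=> S T hS hT] => B BP.
- by have [[[[]]]] := BP.
- by have [[[[_ BL] _] _] _] := BP; apply: (BL); [exact: hS|exact: hT].
- by have [[[_ BM] _] _] := BP; apply: (BM); [exact: hS|exact: hT].
Qed.

Lemma algD S T : alg S -> alg T -> alg (S + T).
Proof.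
by move=> hS hT; have := alg_subalgebra.1.2 1 _ _ hS hT; rewrite scale1r.
Qed.

Lemma algZ (c : R[i]) T : alg T -> alg (c *: T).
Proof.
move=> hT; have := alg_subalgebra.1.2 c _ _ hT alg_subalgebra.1.1.
by rewrite addr0.
Qed.

Lemma algM S T : alg S -> alg T -> alg (S * T).
Proof. exact: alg_subalgebra.2. Qed.

Lemma alg1 : alg 1.
Proof. by apply: sub_gen_smallest; left. Qed.

Lemma poly_op_alg p : alg (polyX p).
Proof.
rewrite /poly_op; apply: (big_ind alg) => [|S T|w _].
- exact: alg_subalgebra.1.1.
- exact: algD.
- apply: algZ; rewrite /mword_prod; apply: (big_ind alg) => [|S T|i _].
  + exact: alg1.
  + exact: algM.
  + apply: (big_ind alg) => [|S T|j _]; [exact: alg1|exact: algM|].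
    by apply: sub_gen_smallest; right; exists i, j.
Qed.

(** The limits of polynomials in the generators form a closed subalgebra. *)
Lemma poly_op_dense T : alg T -> forall e : R, 0 < e ->
  exists p, nrm (polyX p - T) < e.
Proof.
pose D := [set T | forall e : R, 0 < e -> exists p, nrm (polyX p - T) < e].
have Dpoly p : D (polyX p).
  by move=> e e0; exists p; rewrite subrr nrm0.
move=> /(_ D); apply; split; [split|]; [split; [split|]|..].
- have := Dpoly 0; rewrite /poly_op msupp0 big_seq_fset0; exact.
- move=> c S1 S2 h1 h2 e e0.
  have [d [d0 d1 de]] := small_radius (addr_ge0 (nrm_ge0 c) ler01) e0.
  have [p1 hp1] := h1 _ d0; have [p2 hp2] := h2 _ d0.
  exists (c *: p1 + p2); rewrite poly_opD poly_opZ opprD addrACA -scalerBr.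
  rewrite (le_lt_trans (nrmD _ _))// nrmZ (le_lt_trans _ de)// mulrDl mul1r.
  by rewrite lerD// ?(ltW hp2)// ler_wpM2l ?nrm_ge0// ltW.
- move=> S1 S2 h1 h2 e e0.
  have K0 : 0 <= nrm S1 + nrm S2 + 1 by rewrite !addr_ge0 ?nrm_ge0.
  have [d [d0 d1 de]] := small_radius K0 e0.
  have [p1 /ltW hp1] := h1 _ d0; have [p2 /ltW hp2] := h2 _ d0.
  exists (p1 * p2); rewrite poly_opM//.
  by rewrite (le_lt_trans _ de)// bop_mul_dist.
- apply/closed_nrmP => S hS e e0.
  have e2 : 0 < e / 2 by lra.
  have [S' hS' SS'] := hS _ e2; have [p hp] := hS' _ e2.
  exists p; rewrite (le_lt_trans (nrmB S' _ _))// [ltRHS]splitr.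
  apply: ltrD; first exact: hp.
  rewrite nrm_distC; exact: SS'.
- move=> S [->|[i [j ->]]].
    by rewrite -(mword_prod_one X) -poly_opU; exact: Dpoly.
  by rewrite X_gen -poly_opU; exact: Dpoly.
Qed.

Section Evaluation_functional.
Variable z : forall i, 'I_(n i) -> R[i].
Hypothesis z_le : forall p, nrm (poly_eval z p) <= nrm (polyX p).

(** The value at [T] of the continuous extension of the evaluation at [z]. It is
    the limit of the values of any polynomials converging to [T]; this
    inequality singles it out without choosing a sequence. *)
Definition evaluation T : R[i] :=
  xget 0 [set c : R[i] | forall p, nrm (poly_eval z p - c) <= nrm (polyX p - T)].

Lemma poly_evalB p q : poly_eval z (p - q) = poly_eval z p - poly_eval z q.
Proof. by rewrite -scaleN1r poly_evalD poly_evalZ mulN1r. Qed.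

Lemma poly_opB p q : polyX (p - q) = polyX p - polyX q.
Proof. by rewrite -scaleN1r poly_opD poly_opZ scaleN1r. Qed.

Lemma evaluationP T : alg T ->
  forall p, nrm (poly_eval z p - evaluation T) <= nrm (polyX p - T).
Proof.
move=> hT; apply: (@xgetPex _ 0 [set c : R[i] | forall p,
  nrm (poly_eval z p - c) <= nrm (polyX p - T)]).
pose e l : R := l.+1%:R^-1.
have e0 l : 0 < e l by rewrite invr_gt0 ltr0n.
have /choice[f fT] : forall l, exists p, nrm (polyX p - T) < e l.
  by move=> l; exact: poly_op_dense.
have mono l l' : (l <= l')%N -> e l' <= e l.
  by move=> ll; rewrite lef_pV2 ?posrE ?ltr0n// ler_nat.
have null2 : null_seq (fun l => e l * 2).
  apply: null_seqM => //; first exact: null_seq_natSinv.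
  by move=> l; exact: ltW.
have [|c cP] := @complex_rate_complete R (fun l => poly_eval z (f l)) _ null2.
  move=> l l' ll; rewrite -poly_evalB (le_trans (z_le _))// poly_opB.
  rewrite (le_trans (nrmB T _ _))// (nrm_distC T).
  rewrite mulr_natr mulr2n; apply: lerD; first exact: ltW (fT l).
  exact: le_trans (ltW (fT l')) (mono _ _ ll).
exists c => p /=; rewrite -subr_le0.
apply: (@null_seq_le0 _ _ e 3); [exact: null_seq_natSinv|by []|move=> l].
have := nrmB (poly_eval z (f l)) (poly_eval z p) c; rewrite -poly_evalB.
have := z_le (p - f l); rewrite poly_opB.
have := nrmB T (polyX p) (polyX (f l)); rewrite (nrm_distC T).
have := fT l; have := cP l.
move: (nrm (poly_eval z (f l) - c)) (nrm (poly_eval z p - c)).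
move: (nrm (polyX (f l) - T)) (nrm (polyX p - T)) (nrm (polyX p - polyX (f l))).
move: (nrm (poly_eval z (p - f l))) (e l) => *; lra.
Qed.

Lemma evaluation_poly p : evaluation (polyX p) = poly_eval z p.
Proof.
have := evaluationP (poly_op_alg p) p; rewrite subrr nrm0 => h.
apply/esym/eqP; rewrite -subr_eq0; apply/eqP/nrm_eq0/eqP.
by rewrite eq_le h nrm_ge0.
Qed.

Lemma evaluation_eq T (c : R[i]) : alg T -> (forall e : R, 0 < e ->
    exists2 p, nrm (polyX p - T) < e & nrm (poly_eval z p - c) < e) ->
  evaluation T = c.
Proof.
move=> hT H; apply/eqP; rewrite -subr_eq0; apply/eqP/nrm_eq0/eqP.
rewrite eq_le nrm_ge0 andbT; apply/ler_addgt0Pr => e e0; rewrite add0r.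
have e2 : 0 < e / 2 by lra.
have [p pT pc] := H _ e2.
rewrite (le_trans (nrmB (poly_eval z p) _ _))// nrm_distC.
rewrite [leRHS]splitr lerD// ?(ltW pc)//.
exact: le_trans (evaluationP hT p) (ltW pT).
Qed.

Lemma evaluation_linear (c : R[i]) S T : alg S -> alg T ->
  evaluation (c *: S + T) = c * evaluation S + evaluation T.
Proof.
move=> hS hT; have hcST : alg (c *: S + T) by apply: algD => //; exact: algZ.
apply: evaluation_eq => // e e0.
have [d [d0 d1 de]] := small_radius (addr_ge0 (nrm_ge0 c) ler01) e0.
have [p pS] := poly_op_dense hS d0; have [q qT] := poly_op_dense hT d0.
have pS' := le_lt_trans (evaluationP hS p) pS.
have qT' := le_lt_trans (evaluationP hT q) qT.
exists (c *: p + q); rewrite (le_lt_trans _ de)// mulrDl mul1r.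
  rewrite poly_opD poly_opZ opprD addrACA -scalerBr (le_trans (nrmD _ _))// nrmZ.
  by rewrite lerD ?(ltW qT)// ler_wpM2l ?nrm_ge0// ltW.
rewrite poly_evalD poly_evalZ opprD addrACA -mulrBr (le_trans (nrmD _ _))// nrmM.
by rewrite lerD ?(ltW qT')// ler_wpM2l ?nrm_ge0// ltW.
Qed.

Lemma evaluation_mul S T : alg S -> alg T ->
  evaluation (S * T) = evaluation S * evaluation T.
Proof.
move=> hS hT; have hST : alg (S * T) by exact: algM.
apply: evaluation_eq => // e e0.
have K0 : 0 <= (nrm S + nrm T + 1) + (nrm (evaluation S) + nrm (evaluation T) + 1).
  by rewrite !addr_ge0 ?nrm_ge0.
have [d [d0 d1 de]] := small_radius K0 e0.
have [p pS] := poly_op_dense hS d0; have [q qT] := poly_op_dense hT d0.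
have pS' := le_lt_trans (evaluationP hS p) pS.
have qT' := le_lt_trans (evaluationP hT q) qT.
exists (p * q); rewrite (le_lt_trans _ de)//.
  rewrite (poly_opM X_mul) (le_trans (bop_mul_dist d1 (ltW pS) (ltW qT)))//.
  by rewrite ler_wpM2r ?(ltW d0)// lerDl !addr_ge0 ?nrm_ge0.
rewrite poly_evalM (le_trans (complex_mul_dist d1 (ltW pS') (ltW qT')))//.
by rewrite ler_wpM2r ?(ltW d0)// lerDr !addr_ge0 ?nrm_ge0.
Qed.

End Evaluation_functional.

End Generated_algebra.

(** * Characters of the variety algebra *)

Section Neumann.
Context {R : realType}.
Variable V : normedModType R[i].
Hypothesis V_complete : rate_complete V.
Variable B : set (bop V).
Hypothesis B_subalgebra : subalgebra_set B.
Hypothesis B_closed : closed B.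

Lemma geometric_null (c : R) : 0 <= c -> c < 1 -> null_seq (fun l => c ^+ l).
Proof.
move=> c0 c1 e e0.
have : `|c| < 1 by rewrite ger0_norm.
move=> /cvg_expr /cvgrPdist_lt /(_ e e0)[l _ /(_ l (leqnn l))] /=.
by rewrite sub0r normrN ger0_norm ?exprn_ge0// => ?; exists l.
Qed.

(** U is the sum of the Neumann series T + T^2 + T^3 + ... *)
Lemma neumann_fixpoint (T : bop V) : B T -> nrm T < 1 ->
  exists2 U, B U & U = T + T * U.
Proof.
move=> BT T1; set c := nrm T in T1.
have c0 : 0 <= c by exact: nrm_ge0.
have c1 : 0 < 1 - c by rewrite subr_gt0.
pose S l := iter l (fun U => T + T * U) T.
have SS l : S l.+1 = T + T * S l by [].
have BS l : B (S l).
  elim: l => // l IH; rewrite SS.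
  by have := B_subalgebra.1.2 1 _ _ BT (B_subalgebra.2 _ _ BT IH); rewrite scale1r.
pose K : R := c / (1 - c).
have K0 : 0 <= K by rewrite divr_ge0// ltW.
have KE : c + c * K = K by rewrite /K; field; rewrite gt_eqF.
have cK : c <= K by rewrite -KE lerDl mulr_ge0.
have SK l : nrm (S l) <= K.
  elim: l => [|l IH]; first exact: cK.
  rewrite SS -[leRHS]KE (le_trans (nrmD _ _))//; apply: lerD => //.
  by rewrite (le_trans (nrm_bopM _ _))//; apply: ler_wpM2l.
have dist l d : nrm (S l - S (l + d)%N) <= c ^+ l * (2 * K).
  elim: l => [|l IH].
    rewrite expr0 mul1r mulr_natl mulr2n (le_trans (nrmD _ _))// nrmN.
    by apply: lerD; exact: SK.
  rewrite addSn !SS opprD addrACA subrr add0r -mulrBr.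
  rewrite (le_trans (nrm_bopM _ _))// exprS -mulrA; exact: ler_wpM2l.
have null : null_seq (fun l => c ^+ l * (2 * K)).
  apply: null_seqM; [exact: geometric_null|by rewrite mulr_ge0|].
  by move=> l; rewrite exprn_ge0.
have [|U UP] := bop_complete V_complete (x := S) null.
  by move=> l l' ll; rewrite -(subnKC ll); exact: dist.
have BU : B U.
  move/closed_nrmP : B_closed; apply=> e /null[l le]; exists (S l) => //.
  by rewrite nrm_distC (le_lt_trans (UP l)).
exists U => //; apply/eqP; rewrite -subr_eq0; apply/eqP/nrm_eq0/eqP.
rewrite eq_le nrm_ge0 andbT; apply: (null_seq_le0 null (c := 2)) => // l.
rewrite (le_trans (nrmB (S l.+1) _ _))// mulr_natl mulr2n; apply: lerD.
  rewrite nrm_distC (le_trans (UP l.+1))//.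
  apply: ler_wpM2r; first by rewrite mulr_ge0.
  by rewrite exprSr; apply: ler_piMr; [exact: exprn_ge0|exact: ltW].
rewrite SS opprD addrACA subrr add0r -mulrBr (le_trans (nrm_bopM _ _))//.
apply: le_trans (UP l); apply: ler_piMl; [exact: nrm_ge0|exact: ltW].
Qed.

End Neumann.

Section Characters.
Context {R : realType} {k : nat} {n : 'I_k -> nat}.
Variable a : forall i : 'I_k, seq 'I_(n i) -> R.
Variable m : 'I_k -> nat.
Variable Q : set (ncpoly R n).
Local Notation VA := (variety_algebra a m Q).
Local Notation SS := (Sop a m Q).
Implicit Types (T : VA) (p : ncpoly R n).

Lemma va_valM (T U : VA) : va_val (T * U) = va_val T * va_val U.
Proof. by []. Qed.
Lemma va_val1 : va_val (1 : VA) = 1.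
Proof. by []. Qed.
Lemma va_valD (T U : VA) : va_val (T + U) = va_val T + va_val U.
Proof. by []. Qed.
Lemma va_valZ (c : R[i]) (T : VA) : va_val (c *: T) = c *: va_val T.
Proof. by []. Qed.
Lemma va_val0 : va_val (0 : VA) = 0.
Proof. by []. Qed.

Lemma Sop_in i (j : 'I_(n i)) : SS j \in variety_algebra_pred (Q := Q).
Proof.
by apply/variety_algebra_predP; apply: sub_gen_smallest; right; exists i, j.
Qed.

Definition va_gen i (j : 'I_(n i)) : VA := VarietyAlgebra (Sop_in j).

Lemma va_val_word w : va_val (mword_prod va_gen w) = mword_prod SS w.
Proof.
rewrite /mword_prod (big_morph _ va_valM va_val1); apply: eq_bigr => i _.
by rewrite (big_morph _ va_valM va_val1).
Qed.

Lemma va_polyE p :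
  va_poly a m Q p = \sum_(w <- msupp p) mcoeff w p *: mword_prod va_gen w.
Proof.
apply: val_inj; rewrite /= (big_morph _ va_valD va_val0); apply: eq_bigr => w _.
by rewrite va_valZ va_val_word.
Qed.

Section One_character.
Variable phi : VA -> R[i].
Hypothesis phi_char : is_character phi.

Lemma character0 : phi 0 = 0.
Proof.
have [L _ _] := phi_char; have := L (-1) 0 0.
by rewrite scaler0 addr0 mulN1r addNr.
Qed.

Lemma characterD T U : phi (T + U) = phi T + phi U.
Proof. by have [L _ _] := phi_char; have := L 1 T U; rewrite scale1r mul1r. Qed.

Lemma characterZ (c : R[i]) T : phi (c *: T) = c * phi T.
Proof. by have [L _ _] := phi_char; have := L c T 0; rewrite character0 !addr0. Qed.

Lemma characterM T U : phi (T * U) = phi T * phi U.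
Proof. by have [_ M _] := phi_char; exact: M. Qed.

Lemma character1 : phi 1 = 1.
Proof.
have [_ _ [T T0]] := phi_char; have := characterM T 1; rewrite mulr1 => E.
by apply: (mulfI T0); rewrite -E mulr1.
Qed.

Definition character_value i (j : 'I_(n i)) : R[i] := phi (va_gen j).

Lemma character_word w : phi (mword_prod va_gen w) = mword_prod character_value w.
Proof.
rewrite /mword_prod (big_morph _ characterM character1); apply: eq_bigr => i _.
by rewrite (big_morph _ characterM character1).
Qed.

Lemma character_poly p : phi (va_poly a m Q p) = poly_eval character_value p.
Proof.
rewrite va_polyE (big_morph _ characterD character0); apply: eq_bigr => w _.
by rewrite characterZ character_word.
Qed.

(** Automatic continuity. Otherwise some [T] of norm less than 1 has value 1,
    and a character maps U = T + T U to an impossible equation. *)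
Lemma character_le T : nrm (phi T) <= nrm (va_val T).
Proof.
rewrite leNgt; apply/negP => h.
have c0 : 0 < nrm (phi T) by rewrite (le_lt_trans _ h)// nrm_ge0.
have cn0 : phi T != 0 by apply: contraTneq c0 => ->; rewrite nrm0 ltxx.
pose T' : VA := (phi T)^-1 *: T.
have phiT' : phi T' = 1 by rewrite characterZ mulVf.
have T'1 : nrm (va_val T') < 1.
  have : nrm (phi T) * nrm (va_val T') = nrm (va_val T).
    by rewrite va_valZ -nrmZ scalerA divff// scale1r.
  move=> E; move: h; rewrite -E => h.
  by rewrite -(ltr_pM2l c0) mulr1.
have algT' : variety_algebra_set (a := a) (m := m) (Q := Q) (va_val T').
  by apply/variety_algebra_predP; exact: va_valP.
have [||U /variety_algebra_predP algU UE] :=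
  @neumann_fixpoint R (NQ a m Q) (@ocompl_complete R _ _) _ _ _ _ algT' T'1.
- exact: alg_subalgebra.
- exact: alg_closed.
pose U' : VA := VarietyAlgebra algU.
have : U' = T' + T' * U' by apply: val_inj.
move/(congr1 phi); rewrite characterD characterM phiT' mul1r => /eqP.
by rewrite -subr_eq0 opprD addrCA subrr addr0 oppr_eq0 oner_eq0.
Qed.

End One_character.

Hypothesis a_ge0 : forall i s, 0 <= @a i s.
Hypothesis a_gen : forall i j, 0 < @a i [:: j].
Hypothesis Q_ideal : left_ideal Q.

(** Characters are contractive and polynomials are dense. *)
Lemma eq_character (phi psi : VA -> R[i]) : is_character phi ->
  is_character psi ->
  (forall p, phi (va_poly a m Q p) = psi (va_poly a m Q p)) -> phi = psi.
Proof.
move=> hphi hpsi E; apply/funext => T; apply/eqP; rewrite -subr_eq0.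
apply/eqP/nrm_eq0/eqP; rewrite eq_le nrm_ge0 andbT.
apply/ler_addgt0Pr => e e0; rewrite add0r.
have e2 : 0 < e / 2 by rewrite divr_gt0.
have algT : variety_algebra_set (va_val T).
  by apply/variety_algebra_predP; exact: va_valP.
have [p pT] := poly_op_dense (Sop_gen m a_ge0 a_gen Q_ideal)
  (Sword_mul m a_ge0 a_gen Q_ideal) algT e2.
have close (chi : VA -> R[i]) : is_character chi ->
    nrm (chi (va_poly a m Q p) - chi T) <= e / 2.
  move=> hchi.
  have -> : chi (va_poly a m Q p) - chi T = chi (va_poly a m Q p + (-1) *: T).
    by rewrite characterD// characterZ// mulN1r.
  rewrite (le_trans (character_le hchi _))// va_valD va_valZ scaleN1r.
  exact: ltW pT.
rewrite (le_trans (nrmB (phi (va_poly a m Q p)) _ _))// [leRHS]splitr.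
apply: lerD; first by rewrite nrm_distC; exact: close.
by rewrite E; exact: close.
Qed.

Lemma mword_prod_at (z : forall i, 'I_(n i) -> R[i]) i (s : seq 'I_(n i)) :
  mword_prod z (mword_at s) = \prod_(j <- s) z i j.
Proof.
rewrite /mword_prod (bigD1 i)//= mupdE [X in _ * X]big1 ?mulr1// => l il.
by rewrite mupd_out 1?eq_sym// ffunE big_nil.
Qed.

(** For the weights [a_alpha conj(z_alpha)], the value of a character is the
    squared length of the weight vector, while row contractivity bounds it by
    the length; so that length is at most 1. *)
Lemma character_value_row_le (phi : VA -> R[i]) i (F : seq (seq 'I_(n i))) :
  is_character phi -> uniq F -> [::] \notin F ->
  \sum_(s <- F) @a i s * sqmod (\prod_(j <- s) character_value phi j) <= 1.
Proof.
move=> hphi uF nF; pose z := character_value phi.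
pose lam (s : seq 'I_(n i)) : R[i] := (\prod_(j <- s) z i j)^*.
have lamE s : sqmod (lam s) = sqmod (\prod_(j <- s) z i j) by exact: sqmod_conj.
pose p : ncpoly R n := \sum_(s <- F) mkmalgU (mword_at s) ((@a i s)%:C * lam s).
under eq_bigr do rewrite -lamE.
set L := \sum_(s <- F) _.
have L0 : 0 <= L by apply: sumr_ge0 => s _; rewrite mulr_ge0 ?sqmod_ge0.
have phip : phi (va_poly a m Q p) = L%:C.
  rewrite character_poly// -[LHS]/(poly_map (A := R[i]^o) (mword_prod z) p).
  rewrite poly_map_sum /L rmorph_sum; apply: eq_bigr => s _.
  rewrite poly_mapU -[LHS]/(_ * _) mword_prod_at -mulrA rmorphM; congr (_ * _).
  by rewrite mulrC lamE; exact: mul_conj.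
have : L <= Num.sqrt L.
  rewrite -{1}(ger0_norm L0) -nrm_real -phip (le_trans (character_le hphi _))//.
  rewrite -[va_val _]/(poly_op SS p) poly_op_Scompress//.
  rewrite (le_trans (nrm_compress _ _ _))//.
  rewrite -[poly_op _ _]/(poly_map _ p) poly_map_sum.
  under eq_bigr do rewrite poly_mapU.
  exact: row_contraction.
rewrite -(@ler_pXn2r _ 2)// ?nnegrE ?sqrtr_ge0// sqr_sqrtr//.
have [->|Ln0] := eqVneq L 0; first by rewrite ler01.
have {}Ln0 : 0 < L by rewrite lt_def Ln0.
by rewrite -[in X in _ -> X](ler_pM2l Ln0) mulr1 expr2.
Qed.

Definition character_point (phi : VA -> R[i]) : Cspace (R := R) (n := n) :=
  fun i => \row_j character_value phi j.

Lemma entry_char_point phi : entry (character_point phi) = character_value phi.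
Proof.
apply: functional_extensionality_dep => i; apply/funext => j.
by rewrite /entry /character_point mxE.
Qed.

(** The values on the ideal vanish since g(S) = 0, and every finite partial sum
    of Phi is at most 1. *)
Lemma character_point_variety phi :
  is_character phi -> variety a m Q (character_point phi).
Proof.
move=> hphi; have Phi1 i : (Phi_one a i (character_point phi) <= 1)%E.
  apply: ub_ereal_sup => _ [A [fA sA] <-].
  rewrite fsbig_finite// sumEFin lee_fin entry_char_point.
  apply: character_value_row_le => //; first exact: fset_uniq.
  apply/negP; rewrite in_fset_set// inE => /sA; by [].
have Phi_fin i : Phi_one a i (character_point phi) \is a fin_num.
  rewrite ge0_fin_numE; first by rewrite (le_lt_trans (Phi1 i))// ltry.
  by apply: esum_ge0 => s _; rewrite lee_fin mulr_ge0 ?sqmod_ge0.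
split; [split|] => [i|p _|q Qq].
- by rewrite (le_lt_trans (Phi1 i))// ltry.
- apply: prodr_ge0 => i _; rewrite exprn_ge0// subr_ge0 -lee_fin fineK//.
- rewrite entry_char_point -character_poly//.
  have -> : va_poly a m Q q = 0 by apply: val_inj; exact: poly_op_S_eq0.
  exact: character0.
Qed.

End Characters.

(** * The homeomorphism *)

Section Pointwise_topology.

Lemma continuous_prod_topology (X : topologicalType) (I : eqType)
    (K : I -> topologicalType) (f : X -> prod_topology K) :
  (forall i, continuous (fun x => f x i)) -> continuous f.
Proof.
move=> cf x; apply/cvg_sup => i.
exact: (@continuous_comp_initial _ X (K i) (fun g : prod_topology K => g i) f (cf i)).
Qed.

Lemma continuous_set_type (X Y : topologicalType) (A : set Y) (f : X -> A) :
  continuous (fun x => set_val (f x)) -> continuous f.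
Proof. exact: continuous_comp_initial. Qed.

Lemma continuous_set_val (Y : topologicalType) (A : set Y) :
  continuous (set_val : A -> Y).
Proof. exact: initial_continuous. Qed.

Lemma continuous_row (X T : topologicalType) l (f : X -> 'rV[T]_l) :
  (forall j, continuous (fun x => f x 0 j)) -> continuous f.
Proof.
move=> cf x U [P Px PU].
have : \forall y \near x, forall j, P ord0 j (f y ord0 j).
  by apply: filter_forall => j; exact: (cf j x _ (Px ord0 j)).
by apply: filterS => y Py; apply: PU => i j; rewrite ord1.
Qed.

End Pointwise_topology.

Section Complex_continuity.
Context {R : realType} {X : topologicalType}.

Lemma continuous_nrmP (f : X -> R[i]) :
  (forall x (e : R), 0 < e -> \forall y \near x, nrm (f x - f y) < e) ->
  continuous f.
Proof.
move=> H x; apply/cvgrPdist_lt => e e0.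
have eE : e = (complex.Re e)%:C by rewrite RRe_real// gtr0_real.
have {}e0 : 0 < complex.Re e by rewrite -(ltcR 0) -eE.
have := H x _ e0; apply: filterS => y xy.
by rewrite eE nrmE ltcR.
Qed.

Lemma near_nrm (f : X -> R[i]) x (e : R) : {for x, continuous f} -> 0 < e ->
  \forall y \near x, nrm (f x - f y) < e.
Proof.
move=> /cvgrPdist_lt cf e0.
have := cf e%:C; rewrite (ltcR 0) => /(_ e0); apply: filterS => y.
by rewrite nrmE ltcR.
Qed.

Lemma continuous_sumC (T : Type) (s : seq T) (F : T -> X -> R[i]) :
  (forall t, continuous (F t)) -> continuous (fun x => \sum_(t <- s) F t x).
Proof.
move=> cF; elim: s => [|t s IH] x.
  by under eq_fun do rewrite big_nil; exact: cvg_cst.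
under eq_fun do rewrite big_cons.
exact: (cvgD (cF t x) (IH x)).
Qed.

Lemma continuous_prodC (T : Type) (s : seq T) (P : pred T) (F : T -> X -> R[i]^o) :
  (forall t, continuous (F t)) ->
  continuous (fun x => \prod_(t <- s | P t) F t x : R[i]^o).
Proof.
move=> cF; elim: s => [|t s IH] x.
  by under eq_fun do rewrite big_nil; exact: cvg_cst.
under eq_fun do rewrite big_cons; case: (P t); last exact: IH.
exact: (cvgM (cF t x) (IH x)).
Qed.

End Complex_continuity.

Section Homeomorphism.
Context {R : realType} {k : nat} {n : 'I_k -> nat}.

Lemma entry_continuous i (j : 'I_(n i)) :
  continuous (fun z : Cspace (R := R) (n := n) => entry z j).
Proof.
move=> z; apply: (@continuous_comp _ 'rV[R[i]]_(n i) _
  (fun z : Cspace (R := R) (n := n) => z i)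
  (fun M : 'rV[R[i]]_(n i) => M 0 j)).
  exact: (@proj_continuous _ (fun i : 'I_k => 'rV[R[i]]_(n i)) i).
exact: coord_continuous.
Qed.

Lemma poly_eval_continuous p :
  continuous (fun z : Cspace (R := R) (n := n) => poly_eval (entry z) p).
Proof.
apply: continuous_sumC => w.
have cw : continuous (fun z : Cspace (R := R) (n := n) =>
    mword_prod (entry z) w : R[i]^o).
  apply: continuous_prodC => i; apply: continuous_prodC => j.
  exact: entry_continuous.
by move=> z; exact: (cvgM (cvg_cst _) (cw z)).
Qed.

Variable a : forall i : 'I_k, seq 'I_(n i) -> R.
Variable m : 'I_k -> nat.
Hypothesis a_ge0 : forall i s, 0 <= @a i s.
Hypothesis a_gen : forall i j, 0 < @a i [:: j].
Variable Q : set (ncpoly R n).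
Hypothesis Q_ideal : left_ideal Q.
Hypothesis z_le : forall z : Cspace, variety a m Q z ->
  forall p, nrm (poly_eval (entry z) p) <= nrm (poly_op (Sop a m Q) p).
Local Notation VA := (variety_algebra a m Q).
Local Notation V := (variety a m Q).
Local Notation M := (characters a m Q).

Definition ev (z : V) (T : VA) : R[i] :=
  evaluation (Sop a m Q) (entry (set_val z)) (va_val T).

Let dense := poly_op_dense (Sop_gen m a_ge0 a_gen Q_ideal)
  (Sword_mul m a_ge0 a_gen Q_ideal).

Lemma va_alg (T : VA) : variety_algebra_set (va_val T).
Proof. by apply/variety_algebra_predP; exact: va_valP. Qed.

Let le_of (z : V) := z_le (set_valP z).

Lemma ev_character z : is_character (ev z).
Proof.
split=> [c S T|S T|].
- exact: (evaluation_linear (Sop_gen m a_ge0 a_gen Q_ideal)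
    (Sword_mul m a_ge0 a_gen Q_ideal) (le_of z) c (va_alg S) (va_alg T)).
- exact: (evaluation_mul (Sop_gen m a_ge0 a_gen Q_ideal)
    (Sword_mul m a_ge0 a_gen Q_ideal) (le_of z) (va_alg S) (va_alg T)).
- exists (va_poly a m Q (mkmalgU (mword_one n) 1)).
  rewrite /ev (evaluation_poly (Sop_gen m a_ge0 a_gen Q_ideal)
    (Sword_mul m a_ge0 a_gen Q_ideal) (le_of z)).
  by rewrite poly_evalU mword_prod_one mul1r oner_neq0.
Qed.

Lemma ev_poly z p : ev z (va_poly a m Q p) = poly_eval (entry (set_val z)) p.
Proof.
exact: (evaluation_poly (Sop_gen m a_ge0 a_gen Q_ideal)
  (Sword_mul m a_ge0 a_gen Q_ideal) (le_of z)).
Qed.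

Definition Psi (z : V) : M := SigSub (mem_set (ev_character z)).

(** On polynomials the evaluation is continuous in the point; contractivity makes
    the approximation of [T] by polynomials uniform over the variety. *)
Lemma Psi_continuous : continuous Psi.
Proof.
apply: continuous_set_type; apply: continuous_prod_topology => T.
apply: continuous_nrmP => z e e0; have e3 : 0 < e / 3 by rewrite divr_gt0.
have [p pT] := dense (va_alg T) e3.
have close (y : V) : nrm (poly_eval (entry (set_val y)) p - ev y T) < e / 3.
  apply: le_lt_trans pT; exact: (evaluationP (Sop_gen m a_ge0 a_gen Q_ideal)
    (Sword_mul m a_ge0 a_gen Q_ideal) (le_of y) (va_alg T) p).
have cp : {for z, continuous (fun y : V => poly_eval (entry (set_val y)) p)}.
  apply: (@continuous_comp _ _ _ (set_val : V -> _)
    (fun z => poly_eval (entry z) p)); first exact: continuous_set_val.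
  exact: poly_eval_continuous.
have := near_nrm cp e3; apply: filterS => y zy.
have -> : set_val (Psi z) T - set_val (Psi y) T = ev z T - ev y T by [].
have := close z; have := close y.
have := nrmB (poly_eval (entry (set_val z)) p) (ev z T) (ev y T).
have := nrmB (poly_eval (entry (set_val y)) p)
  (poly_eval (entry (set_val z)) p) (ev y T).
rewrite (nrm_distC (ev z T) (poly_eval (entry (set_val z)) p)); move: zy.
set x1 := nrm _; set x2 := nrm _; set x3 := nrm _; set x4 := nrm _.
set x5 := nrm _ => *; lra.
Qed.

Definition Psi_inv (phi : M) : V :=
  SigSub (mem_set (character_point_variety a_ge0 a_gen Q_ideal (set_valP phi))).

Lemma Psi_inv_continuous : continuous Psi_inv.
Proof.
apply: continuous_set_type; apply: continuous_prod_topology => i.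
apply: continuous_row => j.
have -> : (fun phi : M => set_val (Psi_inv phi) i 0 j) =
    (fun phi : M => set_val phi (va_gen a m Q j)).
  by apply/funext => phi; rewrite -[LHS]/(character_point (set_val phi) i 0 j) mxE.
move=> phi; apply: (@continuous_comp _ _ _ (set_val : M -> _)
  (fun chi : {ptws VA -> R[i]} => chi (va_gen a m Q j))).
  exact: continuous_set_val.
exact: (@proj_continuous _ (fun _ : VA => R[i]) (va_gen a m Q j)).
Qed.

Lemma va_gen_poly i (j : 'I_(n i)) :
  va_gen a m Q j = va_poly a m Q (mkmalgU (mword_gen j) 1).
Proof.
by apply: val_inj; rewrite /= Sop_gen// -[RHS]/(poly_map _ _) poly_mapU scale1r.
Qed.

Lemma mword_gen_at i (j : 'I_(n i)) : mword_gen j = mword_at [:: j].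
Proof.
rewrite -[LHS](mword_1mul (mword_gen j)) mword_mul_gen; congr mupd.
by rewrite ffunE.
Qed.

Lemma PsiK : cancel Psi Psi_inv.
Proof.
move=> z; apply: val_inj; apply: functional_extensionality_dep => i.
apply/rowP => j; rewrite mxE -[LHS]/(ev z (va_gen a m Q j)).
by rewrite va_gen_poly ev_poly poly_evalU mul1r mword_gen_at mword_prod_at big_seq1.
Qed.

Lemma eval_unique (phi psi : M) :
  (forall p, \val phi (va_poly a m Q p) = \val psi (va_poly a m Q p)) ->
  phi = psi.
Proof.
move=> E; apply: val_inj.
exact: (eq_character a_ge0 a_gen Q_ideal (set_valP phi) (set_valP psi) E).
Qed.

Lemma Psi_invK : cancel Psi_inv Psi.
Proof.
move=> phi; apply: eval_unique => p.
rewrite -[LHS]/(ev (Psi_inv phi) (va_poly a m Q p)) ev_poly.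
rewrite (character_poly (set_valP phi)).
by rewrite -[set_val _]/(character_point (set_val phi)) entry_char_point.
Qed.

End Homeomorphism.

Theorem theorem3p4 (R : realType) (k : nat) (k_ge1 : (1 <= k)%N)
    (n m : 'I_k -> nat)
    (n_ge1 : forall i, (1 <= n i)%N) (m_ge1 : forall i, (1 <= m i)%N)
    (a : forall i : 'I_k, seq 'I_(n i) -> R)
    (a_posreg : forall i, positive_regular (a i))
    (Q : set (ncpoly R n))
    (Q_homog : exists2 G : set (ncpoly R n),
       (forall g, G g -> homogeneous g) & Q = left_ideal_generated G)
    (NQ_neq0 : exists x : NQ a m Q, x != 0) :
  exists Psi : variety a m Q -> characters a m Q,
    [/\ forall lambda, is_evaluation lambda (Psi lambda),
        forall lambda phi, is_evaluation lambda phi -> phi = Psi lambda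
      & is_homeomorphism Psi].
Proof.
have a_ge0 i s : 0 <= a i s by case: (a_posreg i).
have a_gen i j : 0 < a i [:: j] by case: (a_posreg i).
have [G G_homog QE] := Q_homog; move: NQ_neq0 => _; subst Q.
have Q_ideal := left_ideal_generatedP G.
have z_le := poly_eval_le a_ge0 a_gen m_ge1 G_homog.
exists (Psi a_ge0 a_gen Q_ideal z_le); split=> [z p|z phi phiP|].
- exact: ev_poly.
- by apply: (eval_unique a_ge0 a_gen Q_ideal) => p; rewrite phiP [RHS]ev_poly.
- split; first exact: Psi_continuous.
  exists (Psi_inv a_ge0 a_gen Q_ideal); split.
  + exact: Psi_inv_continuous.
  + exact: PsiK.
  + exact: Psi_invK.
Qed.
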